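(* Let $p_c(5)<p<3$, where $p_c(5)$ is the positive root of $4p^2-6p-2=0$, and let $f,g\in C_0^\infty(\mathbb{R}^3)$ with $\operatorname{supp} f,\ \operatorname{supp} g\subset\{x:|x|\le 1\}$ (no radial symmetry is assumed). Then, for small data (that is, for all sufficiently small $\varepsilon>0$), the Cauchy problem $$\partial_t^2\Phi-\Delta\Phi+\frac{2}{1+t}\partial_t\Phi=|\Phi|^p\ \text{ in } \mathbb{R}_+\times\mathbb{R}^3,\qquad \Phi(0,x)=\varepsilon f(x),\quad \partial_t\Phi(0,x)=\varepsilon g(x),\quad x\in\mathbb{R}^3,$$ has a global solution.
   Context: $\mathbb{R}_+$ denotes the time half-line $t\ge0$. For $n\ge2$, $p_c(n)$ denotes the positive root of $(n-1)p^2-(n+1)p-2=0$. ''Global'' means that the solution exists for all times $t\ge 0$. The parameter $\varepsilon>0$ measures the size of the initial data. *)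

(* Defs.v *)
From mathcomp Require Import all_boot all_order all_algebra.
From mathcomp Require Import all_classical all_reals all_analysis.
From mathcomp Require Import ring lra.
Import Order.TTheory GRing.Theory Num.Theory.
Import numFieldNormedType.Exports.

Set Implicit Arguments.
Unset Strict Implicit.
Unset Printing Implicit Defensive.

Local Open Scope classical_set_scope.
Local Open Scope ring_scope.

(* [get] picks an arbitrary element of the set, or 0 if it is empty;
   [p_c_root] and [p_c_unique] show that for n >= 2 the positive root exists
   and is unique. *)
Definition p_c {R : realType} (n : nat) : R :=
  get [set q : R | 0 < q /\ (n%:R - 1) * q ^+ 2 - (n%:R + 1) * q - 2 = 0].

Lemma p_c_root (R : realType) (n : nat) : (2 <= n)%N ->
  0 < p_c n :> R /\
  (n%:R - 1) * (p_c n : R) ^+ 2 - (n%:R + 1) * p_c n - 2 = 0.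
Proof.
move=> n2.
have a1 : 2 <= n%:R :> R by rewrite (ler_nat R 2 n).
suff : exists q : R, 0 < q /\ (n%:R - 1) * q ^+ 2 - (n%:R + 1) * q - 2 = 0.
  exact: getPex.
set D : R := (n%:R + 1) ^+ 2 + 8 * (n%:R - 1).
have D0 : 0 <= D by rewrite /D; nra.
exists ((n%:R + 1 + Num.sqrt D) / (2 * (n%:R - 1))); split.
  by apply: divr_gt0; [have := sqrtr_ge0 D; lra|lra].
have nz : n%:R - 1 != 0 :> R by apply: lt0r_neq0; lra.
apply: (mulfI (_ : 4 * (n%:R - 1) != 0)); first by rewrite mulf_neq0 ?pnatr_eq0.
transitivity (Num.sqrt D ^+ 2 - D); first by rewrite /D; field.
by rewrite sqr_sqrtr// subrr mulr0.
Qed.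

Lemma p_c_unique (R : realType) (n : nat) (q : R) : (2 <= n)%N ->
  0 < q -> (n%:R - 1) * q ^+ 2 - (n%:R + 1) * q - 2 = 0 -> p_c n = q.
Proof.
move=> n2 q0 qE; have [r0 rE] := p_c_root R n2.
have a1 : 2 <= n%:R :> R by rewrite (ler_nat R 2 n).
have [//|rq] := eqVneq (p_c n) q.
move: (p_c n) r0 rE rq => r r0 rE rq.
have E : (r - q) * ((n%:R - 1) * (r + q) - (n%:R + 1)) = 0.
  transitivity (((n%:R - 1) * r ^+ 2 - (n%:R + 1) * r - 2)
              - ((n%:R - 1) * q ^+ 2 - (n%:R + 1) * q - 2)); first by ring.
  by rewrite rE qE subrr.
move/eqP: E; rewrite mulf_eq0 subr_eq0 (negbTE rq) /= => /eqP E.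
suff : (n%:R - 1) * (r * q) = - 2.
  have : 0 <= (n%:R - 1) * (r * q) by rewrite !mulr_ge0 ?ltW//; lra.
  lra.
have : (n%:R - 1) * r ^+ 2 - (n%:R - 1) * (r + q) * r - 2 = 0.
  by have -> : (n%:R - 1) * (r + q) = n%:R + 1 by lra.
by rewrite expr2; lra.
Qed.

(* R^3 as an iterated product. The library norm on it is the sup norm, hence
   the separate Euclidean norm below. *)
Notation space R := (R * R * R)%type (only parsing).

Notation spacetime R := (R * (R * R * R))%type (only parsing).

(* The same carriers with the Borel structure on which the library puts the
   Lebesgue measure. *)
Notation mspace R :=
  (measurableTypeR R * measurableTypeR R * measurableTypeR R)%type
  (only parsing).

Notation mspacetime R :=
  (measurableTypeR R *
    (measurableTypeR R * measurableTypeR R * measurableTypeR R))%type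
  (only parsing).

Definition enorm {R : realType} (x : space R) : R :=
  Num.sqrt (x.1.1 ^+ 2 + x.1.2 ^+ 2 + x.2 ^+ 2).

Definition unit_vec {R : realType} (i : 'I_3) : space R :=
  ((i == 0 :> nat)%:R, (i == 1 :> nat)%:R, (i == 2 :> nat)%:R).

Definition leb3 {R : realType} : {measure set (mspace R) -> \bar R} :=
  ((@lebesgue_measure R \x @lebesgue_measure R) \x @lebesgue_measure R)%E.

Definition leb4 {R : realType} : {measure set (mspacetime R) -> \bar R} :=
  (@lebesgue_measure R \x^ @leb3 R)%E.

(* In finite dimension, existence and continuity of all iterated directional
   derivatives of order <= k is the usual C^k. *)
Fixpoint Ck {R : realType} {V : normedModType R} (k : nat)
    (f : V -> R) : Prop :=
  match k with
  | 0 => continuous f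
  | k'.+1 => continuous f /\
      forall v : V, (forall x, derivable f x v) /\ Ck k' (fun x => 'D_v f x)
  end.

Definition Cinfty {R : realType} {V : normedModType R} (f : V -> R) : Prop :=
  forall k, Ck k f.

Definition supp {R : realType} {V : normedModType R} (f : V -> R) : set V :=
  closure [set x | f x != 0].

Definition Cc_infty {R : realType} {V : normedModType R} (f : V -> R) : Prop :=
  Cinfty f /\ compact (supp f).

Definition L2 {R : realType} (u : space R -> R) : Prop :=
  u \in Lfun leb3 2%:E.

Definition L2_dist {R : realType} (u v : space R -> R) : \bar R :=
  Lnorm leb3 2%:E (EFin \o (u \- v)).

Definition weak_partial {R : realType} (i : 'I_3)
    (u w : space R -> R) : Prop :=
  forall psi : space R -> R, Cc_infty psi ->
    \int[leb3]_x (u x * 'D_(unit_vec i) psi x) = - \int[leb3]_x (w x * psi x).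

(* u belongs to C([0,oo); L^2); only the values u t with t >= 0 matter. *)
Definition C_L2 {R : realType} (u : R -> space R -> R) : Prop :=
  (forall t, 0 <= t -> L2 (u t)) /\
  forall t, 0 <= t ->
    L2_dist (u s) (u t) @[s --> within [set s | 0 <= s] (nbhs t)] --> 0%E.

(* v is the strong L^2 time derivative of u on [0,oo), one-sided at 0. *)
Definition L2_time_derivative {R : realType} (u v : R -> space R -> R) : Prop :=
  forall t, 0 <= t ->
    L2_dist (fun x => (u s x - u t x) / (s - t)) (v t)
      @[s --> within [set s | 0 <= s] t^'] --> 0%E.

(* u belongs to C([0,oo); H^1) and [G i t] is the weak partial derivative of
   u t in the i-th coordinate. *)
Definition C_H1 {R : realType} (u : R -> space R -> R)
    (G : 'I_3 -> R -> space R -> R) : Prop :=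
  [/\ C_L2 u, (forall i, C_L2 (G i)) &
      forall i t, 0 <= t -> weak_partial i (u t) (G i t)].

(* u belongs to C^1([0,oo); L^2) with derivative v. *)
Definition C1_L2 {R : realType} (u v : R -> space R -> R) : Prop :=
  [/\ C_L2 u, C_L2 v & L2_time_derivative u v].

(* u is jointly measurable and belongs to L^p_loc([0,oo) x R^3). *)
Definition Lp_loc {R : realType} (p : R) (u : R -> space R -> R) : Prop :=
  measurable_fun [set z : mspacetime R | 0 <= z.1]
    (fun z => u z.1 z.2) /\
  forall T r : R,
    (\int[leb4]_(z in [set z : mspacetime R |
                        ((0 <= z.1 <= T) && (enorm z.2 <= r))%R])
       (`|u z.1 z.2| `^ p)%:E < +oo)%E.

(* u is a solution on [0,oo) x R^3, in the energy class, of
     u_tt - Laplacian u + 2/(1+t) u_t = |u|^p,  u(0) = u0,  u_t(0) = u1: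
   the equation is multiplied by a test function and integrated by parts once
   over [0,t] x R^3. A test function in C_0^infty([0,oo) x R^3) is the
   restriction to t >= 0 of one on the whole of R x R^3; [(1, 0)] and
   [(0, unit_vec i)] are the time and space directions. *)
Definition global_energy_solution {R : realType} (p : R)
    (u0 u1 : space R -> R) (u : R -> space R -> R) : Prop :=
  exists (ut : R -> space R -> R) (G : 'I_3 -> R -> space R -> R),
    [/\ C_H1 u G, C1_L2 u ut, Lp_loc p u,
        {ae leb3, forall x, u 0 x = u0 x} /\ {ae leb3, forall x, ut 0 x = u1 x} &
        forall phi : spacetime R -> R, Cc_infty phi -> forall t, 0 <= t ->
          \int[leb3]_x (ut t x * phi (t, x))
          - \int[leb3]_x (ut 0 x * phi (0, x))
          + \int[lebesgue_measure]_(s in `[0, t])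
              \int[leb3]_x (- (ut s x * 'D_(1, 0) phi (s, x))
                 + \sum_(i < 3) G i s x * 'D_(0, unit_vec i) phi (s, x))
          + \int[lebesgue_measure]_(s in `[0, t])
              \int[leb3]_x (2 / (1 + s) * ut s x * phi (s, x))
          = \int[lebesgue_measure]_(s in `[0, t])
              \int[leb3]_x (`|u s x| `^ p * phi (s, x))].

(* Main.v *)
(* With w = (1 + t) u the damped equation becomes the undamped wave equation
   w_tt - Lap w = (1 + t)^(1-p) |w|^p, and John's method for small data applies.
   Subtracting an explicit exponentially decaying function with the right
   Cauchy data leaves a wave equation with zero data and source F, solved by
   Kirchhoff's and Duhamel's formulas. The operator L inverting the wave
   equation in this way is bounded in the weight W = (1 + t)^-1
   (4 + t - (1+|x|^2)^(1/2))^-(2p-3), supported in |x| <= 1 + t: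
   |F| <= A (1 + t)^(1-p) W^p implies |L F| <= C A W, precisely because
   p (2p - 3) > 1, which is the condition p > p_c(5). Indeed F is dominated by
   radial functions whose spherical means integrate in closed form. Then
   w = eps a + L F(w) is solved by iteration; the gradients converge as well,
   since |w|^p is differentiable with a Hoelder continuous derivative. As L
   only involves integrals over spheres, the solution satisfies the equation
   in the weak form obtained by moving the derivatives to the test function. *)

Require Import Defs.
From mathcomp Require Import all_boot all_order all_algebra.
From mathcomp Require Import all_classical all_reals all_analysis.
From mathcomp Require Import measurable_realfun.
From mathcomp Require Import ring lra.
From HB Require Import structures.
Import Order.TTheory GRing.Theory Num.Theory.
Import numFieldNormedType.Exports.

Set Implicit Arguments.
Unset Strict Implicit.
Unset Printing Implicit Defensive.

Local Open Scope classical_set_scope.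
Local Open Scope ring_scope.

(** * Compactly supported functionals and parametric integrals *)

(** Integrals of continuous functions are handled as functionals [cfunctional], for which
    continuity, differentiation under the integral and interchange of order have elementary proofs;
    Lebesgue integrals return only to meet the definition of a solution. Functions are extended to
    all real times, by truncating t at 0 where necessary, so that continuity needs no domain. The
    obstacle is regularity. For p < 2, |w|^p is not C^2 as a function of w, so the source is only
    C^1 in space and Duhamel's integral need not have second derivatives. Hence its time derivative
    is differentiated only after pairing with a test function, on which the spherical means act by
    duality. For the same reason a difference of gradients is controlled by the square root of a
    difference of functions: the functions must converge like 4^-n for the gradients to converge
    like 2^-n. The Hoelder exponent 1/2 is admissible because p_c(5) = (3 + sqrt 17)/4 exceeds 3/2.
    In the weight, (1+|x|^2)^(1/2) replaces |x| so that the radial comparison functions are smooth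
    at the origin, and the constant 4 keeps the base above 2 in the cone. *)

Section continuity.
Context {R : realType} {T : topologicalType}.
Implicit Types f g : T -> R.

Lemma continuous_cst (U : topologicalType) (c : U) : continuous (fun _ : T => c).
Proof. by move=> x; exact: cvg_cst. Qed.

Lemma continuous_id : continuous (fun x : T => x).
Proof. by move=> x; exact: cvg_id. Qed.

Lemma continuous_add (V : normedModType R) (f g : T -> V) :
  continuous f -> continuous g -> continuous (fun x => f x + g x).
Proof. by move=> cf cg x; apply: cvgD; [exact: cf|exact: cg]. Qed.

Lemma continuous_opp (V : normedModType R) (f : T -> V) :
  continuous f -> continuous (fun x => - f x).
Proof. by move=> cf x; apply: cvgN; exact: cf. Qed.

Lemma continuous_mul f g :
  continuous f -> continuous g -> continuous (fun x => f x * g x).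
Proof. by move=> cf cg x; apply: cvgM; [exact: cf|exact: cg]. Qed.

Lemma continuous_scale (V : normedModType R) f (g : T -> V) :
  continuous f -> continuous g -> continuous (fun x => f x *: g x).
Proof. by move=> cf cg x; apply: cvgZ; [exact: cf|exact: cg]. Qed.

Lemma continuous_inv f : continuous f -> (forall x, f x != 0) ->
  continuous (fun x => (f x)^-1).
Proof. by move=> cf f0 x; apply: cvgV; [exact: f0|exact: cf]. Qed.

Lemma continuous_exp f n : continuous f -> continuous (fun x => f x ^+ n).
Proof.
move=> cf; elim: n => [|n ih]; first exact: continuous_cst.
have -> : (fun x => f x ^+ n.+1) = (fun x => f x * f x ^+ n).
  by apply/funext => x; rewrite exprS.
exact: continuous_mul.
Qed.

Lemma continuous_pair (U V : topologicalType) (f : T -> U) (g : T -> V) :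
  continuous f -> continuous g -> continuous (fun x => (f x, g x)).
Proof. by move=> cf cg x; apply: cvg_pair; [exact: cf|exact: cg]. Qed.

Lemma continuous_compose (U V : topologicalType) (f : U -> V) (g : T -> U) :
  continuous f -> continuous g -> continuous (fun x => f (g x)).
Proof. by move=> cf cg x; apply: continuous_comp; [exact: cg|exact: cf]. Qed.

Lemma continuous_proj1 (U V : topologicalType) (g : T -> (U * V)%type) :
  continuous g -> continuous (fun x => (g x).1).
Proof. by move=> cg x; apply: continuous_comp; [exact: cg|exact: cvg_fst]. Qed.

Lemma continuous_proj2 (U V : topologicalType) (g : T -> (U * V)%type) :
  continuous g -> continuous (fun x => (g x).2).
Proof. by move=> cg x; apply: continuous_comp; [exact: cg|exact: cvg_snd]. Qed.

Lemma continuous_sum n (F : 'I_n -> T -> R) :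
  (forall i, continuous (F i)) -> continuous (fun x => \sum_(i < n) F i x).
Proof.
elim: n F => [|n ih] F cF.
  have -> : (fun x => \sum_(i < 0) F i x) = (fun _ => 0) by apply/funext => x; rewrite big_ord0.
  exact: continuous_cst.
have -> : (fun x => \sum_(i < n.+1) F i x) =
    (fun x => F ord0 x + \sum_(i < n) F (lift ord0 i) x).
  by apply/funext => x; rewrite big_ord_recl.
by apply: continuous_add => //; exact: ih.
Qed.

Lemma continuous_norm f : continuous f -> continuous (fun x => `|f x|).
Proof. by move=> cf x; apply: cvg_norm; exact: cf. Qed.

Lemma continuous_maxr f g : continuous f -> continuous g ->
  continuous (fun x => Num.max (f x) (g x)).
Proof.
move=> cf cg; have -> : (fun x => Num.max (f x) (g x)) =
    (fun x => 2^-1 * (f x + g x + `|f x - g x|)).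
  by apply/funext => x; rewrite maxr_absE; field.
apply: continuous_mul; first exact: continuous_cst.
apply: continuous_add; first exact: continuous_add.
by apply: continuous_norm; apply: continuous_add => //; exact: continuous_opp.
Qed.

Lemma continuous_sin_comp f : continuous f -> continuous (fun x => sin (f x)).
Proof. by apply: continuous_compose; exact: continuous_sin. Qed.

Lemma continuous_cos_comp f : continuous f -> continuous (fun x => cos (f x)).
Proof. by apply: continuous_compose; exact: continuous_cos. Qed.

Lemma continuous_expR_comp f : continuous f -> continuous (fun x => expR (f x)).
Proof. by apply: continuous_compose; exact: continuous_expR. Qed.

Lemma continuous_sqrt_comp f :
  continuous f -> continuous (fun x => Num.sqrt (f x)).
Proof. by apply: continuous_compose; exact: sqrt_continuous. Qed.

End continuity.

Lemma continuous_fstE (U V : topologicalType) : continuous (@fst U V).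
Proof. by move=> x; exact: cvg_fst. Qed.

Lemma continuous_sndE (U V : topologicalType) : continuous (@snd U V).
Proof. by move=> x; exact: cvg_snd. Qed.

(** Each rule peels off the outermost operation. The last rule closes leaves by the hypotheses at
    hand, indexed families included, and eta-expands partially applied operations so that the other
    rules see them. *)
Ltac cont1 := lazymatch goal with
  | |- continuous (fun x => x) => exact: continuous_id
  | |- continuous (fun x => (@?f x, @?g x)) => apply: continuous_pair
  | |- continuous (fun x => GRing.add (@?f x) (@?g x)) => apply: continuous_add
  | |- continuous (fun x => GRing.opp (@?f x)) => apply: continuous_opp
  | |- continuous (fun x => GRing.mul (@?f x) (@?g x)) => apply: continuous_mul
  | |- continuous (fun x => GRing.scale (@?f x) (@?g x)) =>
      apply: continuous_scale
  | |- continuous (fun x => GRing.exp (@?f x) _) => apply: continuous_exp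
  | |- continuous (fun x => Num.norm (@?f x)) => apply: continuous_norm
  | |- continuous (fun x => Order.max (@?f x) (@?g x)) => apply: continuous_maxr
  | |- continuous (fun x => sin (@?f x)) => apply: continuous_sin_comp
  | |- continuous (fun x => cos (@?f x)) => apply: continuous_cos_comp
  | |- continuous (fun x => Num.sqrt (@?f x)) => apply: continuous_sqrt_comp
  | |- continuous (fun x => expR (@?f x)) => apply: continuous_expR_comp
  | |- continuous (fun x => fst (@?f x)) => apply: continuous_proj1
  | |- continuous (fun x => snd (@?f x)) => apply: continuous_proj2
  | |- continuous ?f => first [
      match goal with H : continuous ?g |- continuous ?g => exact H end |
      exact: continuous_cst |
      lazymatch f with
      | (fun _ => _) => fail
      | sin => exact: continuous_sin
      | cos => exact: continuous_cos
      | expR => exact: continuous_expR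
      | @Num.norm _ _ => exact: (continuous_norm (@continuous_id _))
      | @fst _ _ => exact: continuous_fstE
      | @snd _ _ => exact: continuous_sndE
      | GRing.add _ => change (continuous (fun x => f x))
      | GRing.mul _ => change (continuous (fun x => f x))
      | GRing.scale _ => change (continuous (fun x => f x))
      | GRing.opp => change (continuous (fun x => f x))
      | pair _ => change (continuous (fun x => f x))
      | _ => fail
      end |
      match goal with
      | H : continuous ?F |- continuous (fun x => ?F (@?g x)) =>
          apply: (continuous_compose H)
      | H : forall i, continuous (?F i) |- continuous (fun x => ?F ?j (@?g x)) =>
          apply: (continuous_compose (H j))
      | H : forall i j, continuous (?F i j) |-
            continuous (fun x => ?F ?k ?l (@?g x)) =>
          apply: (continuous_compose (H k l))
      end | assumption ]
  end.
Ltac cont := repeat cont1.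

(** * Directional derivatives and the mean value theorem *)

Section derivation.
Context {R : realType}.

Lemma is_deriveP (V : normedModType R) (f : V -> R) (x v : V) (d : R) :
  is_derive x v f d <->
  forall e : R, 0 < e -> \forall h \near 0^', `|h^-1 * (f (h *: v + x) - f x) - d| <= e.
Proof.
split=> [[dv dE] e e0|H].
  have : (fun h => h^-1 *: (f (h *: v + x) - f x)) @ 0^' --> d.
    by rewrite -dE; exact: dv.
  move/cvgrPdist_le => /(_ e e0); apply: filterS => h /=.
  by rewrite distrC.
have cv : (fun h => h^-1 *: (f (h *: v + x) - f x)) @ 0^' --> d.
  apply/cvgrPdist_le => e e0; apply: filterS (H e e0) => h /=.
  by rewrite distrC.
apply: DeriveDef; first by apply/cvg_ex; exists d.
by apply: cvg_lim => //; exact: norm_hausdorff.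
Qed.

(** Turns directional derivatives into ordinary ones along a line, where the one-variable mean value
    theorem and chain rule apply. *)
Lemma is_derive_line (V : normedModType R) (f : V -> R) (x v : V) (t d : R) :
  is_derive (t *: v + x) v f d <-> is_derive (t : R) 1 (fun h => f (h *: v + x)) d.
Proof.
split=> /is_deriveP H; apply/is_deriveP => e e0; apply: filterS (H e e0) => h /=.
  by rewrite [h *: 1]mulr1 scalerDl addrA.
by rewrite [h *: 1]mulr1 scalerDl addrA.
Qed.

Lemma is_derive_line0 (V : normedModType R) (f : V -> R) (x v : V) (d : R) :
  is_derive x v f d <-> is_derive (0 : R) 1 (fun h => f (h *: v + x)) d.
Proof. by rewrite -is_derive_line scale0r add0r. Qed.

Lemma is_derive_unique (V : normedModType R) (f : V -> R) (x v : V) (d d' : R) :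
  is_derive x v f d -> is_derive x v f d' -> d = d'.
Proof. by move=> [_ <-] [_ <-]. Qed.

Lemma is_derive_continuous (f df : R -> R) :
  (forall x : R, is_derive x 1 f (df x)) -> continuous f.
Proof.
move=> H x; have := H x => -[dv _].
by apply/differentiable_continuous/derivable1_diffP.
Qed.

(** No order between [a] and [b] is assumed, since increments of both signs occur in difference
    quotients; the position of [c] is therefore given by its distance to [a]. *)
Lemma mean_value (f df : R -> R) (a b : R) :
  (forall x : R, is_derive x 1 f (df x)) ->
  exists2 c, `|c - a| <= `|b - a| & f b - f a = df c * (b - a).
Proof.
move=> H; have cf := is_derive_continuous H.
have [ab|/ltW ba] := leP a b.
  have [c] := @MVT_segment _ f df a b ab (fun x _ => H x) (continuous_subspaceT cf).
  rewrite in_itv /= => /andP[ac cb] E; exists c => //.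
  by rewrite !ger0_norm ?subr_ge0//; lra.
have [c] := @MVT_segment _ f df b a ba (fun x _ => H x) (continuous_subspaceT cf).
rewrite in_itv /= => /andP[ac cb] E; exists c.
  by rewrite ler0_norm ?ler0_norm ?subr_le0//; lra.
by rewrite -opprB E; ring.
Qed.

End derivation.

Section cfunctional.
Context {R : realType}.

(* The positive measures with compact support, seen as functionals; everything
   about parametric integrals below only uses these three properties. *)
Definition cfunctional (E : topologicalType) (Lam : (E -> R) -> R) : Prop :=
  [/\ forall k l : E -> R, continuous k -> continuous l ->
        Lam (fun e => k e + l e) = Lam k + Lam l,
      forall (a : R) (k : E -> R), continuous k -> Lam (fun e => a * k e) = a * Lam k &
      exists (K : set E) (C : R), [/\ compact K, 0 <= C & forall (k : E -> R) (m : R), continuous k ->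
        (forall e, K e -> `|k e| <= m) -> `|Lam k| <= C * m]].

Lemma tube (T E : topologicalType) (k : T * E -> R) (K : set E) (z : T) (e : R) :
  continuous k -> compact K -> 0 < e ->
  \forall z' \near z, forall y, K y -> `|k (z', y) - k (z, y)| <= e.
Proof.
move=> ck cK e0.
have := (@compact_near_coveringP _ K).1 cK T (nbhs z)
  (fun z' y => `|k (z', y) - k (z, y)| <= e) _.
apply => y Ky.
have e2 : 0 < e / 2 by rewrite divr_gt0.
have /cvgrPdist_le/(_ _ e2) [[A B] /= [nA nB] AB] := ck (z, y).
exists (B, A) => //= -[y' z'] /= [By' Az'].
have H1 := AB (z', y') (conj Az' By').
have H2 := AB (z, y') (conj (nbhs_singleton nA) By').
move: H1 H2 => /=; rewrite (distrC (k (z, y))) => H1 H2.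
have := ler_normD (k (z', y') - k (z, y)) (k (z, y) - k (z, y')).
have -> : k (z', y') - k (z, y) + (k (z, y) - k (z, y')) = k (z', y') - k (z, y') by ring.
by lra.
Qed.

Section theory.
Variables (E : topologicalType) (Lam : (E -> R) -> R).
Hypothesis HL : cfunctional Lam.

Lemma cfunctional_add (k l : E -> R) : continuous k -> continuous l ->
  Lam (fun e => k e + l e) = Lam k + Lam l.
Proof. by case: HL => + _ _; exact. Qed.

Lemma cfunctional_scale (a : R) (k : E -> R) : continuous k ->
  Lam (fun e => a * k e) = a * Lam k.
Proof. by case: HL => _ + _; exact. Qed.

Lemma cfunctional_opp (k : E -> R) : continuous k -> Lam (fun e => - k e) = - Lam k.
Proof.
move=> ck; have -> : (fun e => - k e) = (fun e => -1 * k e).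
  by apply/funext => e; rewrite mulN1r.
by rewrite cfunctional_scale// mulN1r.
Qed.

Lemma cfunctional_sub (k l : E -> R) : continuous k -> continuous l ->
  Lam (fun e => k e - l e) = Lam k - Lam l.
Proof.
move=> ck cl; rewrite cfunctional_add ?cfunctional_opp//.
exact: continuous_opp.
Qed.

Lemma cfunctional0 : Lam (fun _ => 0) = 0.
Proof.
have c0 : continuous (fun _ : E => 0 : R) by exact: continuous_cst.
have := @cfunctional_scale 0 _ c0.
have -> : (fun _ : E => 0 * 0 : R) = (fun _ => 0).
  by apply/funext => e; rewrite mul0r.
by move=> ->; rewrite mul0r.
Qed.

Lemma cfunctional_continuous (T : topologicalType) (k : T * E -> R) :
  continuous k -> continuous (fun z => Lam (fun e => k (z, e))).
Proof.
move=> ck z; case: HL => _ _ [K [C [cK C0 HC]]].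
have ckz z' : continuous (fun e => k (z', e)).
  by apply: (@continuous_compose _ _ _ k (fun e => (z', e))) => //; cont.
apply/cvgrPdist_le => e e0.
have C1 : 0 < C + 1 by rewrite ltr_wpDl.
have := tube z ck cK (divr_gt0 e0 C1); apply: filterS => z' H.
rewrite -cfunctional_sub//.
apply: (@le_trans _ _ (C * (e / (C + 1)))).
  apply: HC => [|y Ky]; last by rewrite distrC; exact: H.
  by apply: continuous_add => //; apply: continuous_opp.
by rewrite mulrCA -[leRHS]mulr1 ler_pM2l// ler_pdivrMr// mul1r lerDl ler01.
Qed.

(** By the mean value theorem the difference quotient at [e] is a value of [k'] at an intermediate
    parameter, so [tube] applied to [k'] makes it close to [k' t] uniformly on the compact set that
    carries [Lam]. *)
Lemma cfunctional_is_derive (k k' : R -> E -> R) (t : R) :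
  (forall (t : R) e, is_derive t 1 (k^~ e) (k' t e)) ->
  (forall t, continuous (k t)) ->
  continuous (fun z : R * E => k' z.1 z.2) ->
  is_derive t 1 (fun t => Lam (k t)) (Lam (k' t)).
Proof.
move=> dk ck ck'; case: HL => _ _ [K [C [cK C0 HC]]].
have ckt s : continuous (k' s).
  by apply: (@continuous_compose _ _ _ _ (fun e => (s, e)) ck'); cont.
apply/is_deriveP => e e0.
have C1 : 0 < C + 1 by rewrite ltr_wpDl.
have /nbhs_ballP[d /= d0 Hd] := tube t ck' cK (divr_gt0 e0 C1).
exists d => //= h hd h0.
have {}hd : `|h| < d by move: hd; rewrite /= sub0r normrN.
rewrite [h *: 1]mulr1 -cfunctional_sub// -cfunctional_scale; last first.
  by apply: continuous_add => //; exact: continuous_opp.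
have cdq : continuous (fun e => h^-1 * (k (h + t) e - k t e)).
  apply: continuous_mul; first exact: continuous_cst.
  by apply: continuous_add => //; exact: continuous_opp.
rewrite -cfunctional_sub//.
apply: (@le_trans _ _ (C * (e / (C + 1)))); last first.
  by rewrite mulrCA -[leRHS]mulr1 ler_pM2l// ler_pdivrMr// mul1r lerDl ler01.
apply: HC => [|y Ky].
  by apply: continuous_add => //; exact: continuous_opp.
have [c ch ->] := @mean_value R (k^~ y) (k'^~ y) t (h + t) (fun x => dk x y).
rewrite addrK mulrA mulrAC mulVf// mul1r in ch *.
apply: (Hd c) => //=; rewrite /ball/= distrC.
exact: le_lt_trans ch hd.
Qed.

End theory.

(** The image under [u] of the measure with density [w]. The spherical mean arises in this way from
    the product measure on the two angles, with density sin a. *)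
Lemma cfunctional_push (E E' : topologicalType) (Lam : (E -> R) -> R)
    (u : E -> E') (w : E -> R) :
  cfunctional Lam -> continuous u -> continuous w ->
  cfunctional (fun k => Lam (fun e => w e * k (u e))).
Proof.
move=> HL cu cw; have cw' k : continuous k -> continuous (fun e => w e * k (u e)).
  by move=> ck; apply: continuous_mul => //; exact: continuous_compose.
split.
- move=> k l ck cl; rewrite -(cfunctional_add HL) ?cw'//; last 2 first.
    exact: cw'.
    exact: cw'.
  by congr Lam; apply/funext => e; ring.
- move=> a k ck; rewrite -(cfunctional_scale HL); last exact: cw'.
  by congr Lam; apply/funext => e; ring.
- case: HL => _ _ [K [C [cK C0 HC]]].
  have [M M0 HM] : exists2 M, 0 <= M & forall e, K e -> `|w e| <= M.
    have cwK : compact (w @` K).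
      by apply: continuous_compact => //; exact: continuous_subspaceT.
    have [M [_ HM]] := compact_bounded cwK.
    exists (`|M| + 1); first by rewrite addr_ge0.
    move=> e Ke; apply: (HM (`|M| + 1)); last by exists e.
    by rewrite (le_lt_trans (ler_norm _))// ltrDl.
  exists (u @` K), (C * M); split.
  + by apply: continuous_compact => //; exact: continuous_subspaceT.
  + exact: mulr_ge0.
  + move=> k m ck Hm; rewrite -mulrA; apply: HC => [|e Ke]; first exact: cw'.
    rewrite normrM; apply: ler_pM => //; first exact: HM.
    by apply: Hm; exists e.
Qed.

Lemma cfunctional_comp (E E' : topologicalType) (Lam : (E -> R) -> R)
    (Lam' : (E' -> R) -> R) :
  cfunctional Lam -> cfunctional Lam' ->
  cfunctional (fun k : E * E' -> R => Lam (fun e => Lam' (fun e' => k (e, e')))).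
Proof.
move=> HL HL'.
have cs (k : E * E' -> R) e : continuous k -> continuous (fun e' => k (e, e')).
  by move=> ck; apply: (@continuous_compose _ _ _ k (fun e' => (e, e'))) => //; cont.
have cL (k : E * E' -> R) : continuous k ->
  continuous (fun e => Lam' (fun e' => k (e, e'))).
  by move=> ck; exact: (cfunctional_continuous HL' ck).
split.
- move=> k l ck cl; rewrite -(cfunctional_add HL); [|exact: cL..].
  congr Lam; apply/funext => e.
  by rewrite -(cfunctional_add HL')//; exact: cs.
- move=> a k ck; rewrite -(cfunctional_scale HL); last exact: cL.
  congr Lam; apply/funext => e.
  by rewrite -(cfunctional_scale HL')//; exact: cs.
- case: (HL) => _ _ [K [C [cK C0 HC]]]; case: (HL') => _ _ [K' [C' [cK' C0' HC']]].
  exists (K `*` K'), (C * C'); split.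
  + exact: compact_setX.
  + exact: mulr_ge0.
  + move=> k m ck Hm; rewrite -mulrA; apply: HC => [|e Ke]; first exact: cL.
    by apply: HC' => [|e' Ke']; [exact: cs|exact: Hm].
Qed.

End cfunctional.

(** * Integrals over intervals and the fundamental theorem of calculus *)

Section unit_interval.
Context {R : realType}.
Local Notation mu := (@lebesgue_measure R).

Definition int01 (k : R -> R) : R := \int[mu]_(x in `[0, 1]) k x.

Lemma continuous_integrable (a b : R) (k : R -> R) : continuous k ->
  mu.-integrable `[a, b] (EFin \o k).
Proof.
move=> ck; apply: continuous_compact_integrable; first exact: segment_compact.
exact: continuous_subspaceT.
Qed.

Lemma int01_cfunctional : cfunctional int01.
Proof.
split.
- by move=> k l ck cl; rewrite /int01 RintegralD//; exact: continuous_integrable.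
- by move=> a k ck; rewrite /int01 RintegralZl//; exact: continuous_integrable.
- exists `[0, 1]%classic, 1; split => //; first exact: segment_compact.
  move=> k m ck Hm; rewrite mul1r /int01.
  apply: le_trans (le_normr_Rintegral _ _) _ => //.
    exact: continuous_integrable.
  have -> : m = \int[mu]_(x in `[0, 1]) m.
    rewrite Rintegral_cst//= lebesgue_measure_itv/= lte01.
    by rewrite sube0 mulr1.
  apply: le_Rintegral => //.
    by apply: continuous_integrable; exact: continuous_norm.
  by apply: continuous_integrable; exact: continuous_cst.
Qed.

Lemma FTC2_segment (k K : R -> R) (a b : R) : a <= b -> continuous k ->
  (forall x : R, a <= x <= b -> is_derive x 1 K (k x)) ->
  \int[mu]_(x in `[a, b]) k x = K b - K a.
Proof.
rewrite le_eqVlt => /orP[/eqP->|ab] ck dK.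
  by rewrite set_itv1 Rintegral_set1 subrr.
have cK x : a <= x <= b -> {for x, continuous K}.
  by move=> /dK[dv _]; apply/differentiable_continuous/derivable1_diffP.
rewrite /Rintegral (@continuous_FTC2 _ k K)//.
- exact: continuous_subspaceT.
- split.
  + by move=> x; rewrite in_itv/= => /andP[/ltW ax /ltW xb]; case: (dK x) => //; rewrite ax.
  + by apply: cvg_at_right_filter; apply: cK; rewrite lexx ltW.
  + by apply: cvg_at_left_filter; apply: cK; rewrite lexx ltW.
- move=> x; rewrite in_itv/= => /andP[/ltW ax /ltW xb]; rewrite derive1E.
  by case: (dK x) => //; rewrite ax.
Qed.

(** The primitive is the integral from -M, hence the restriction to a bounded interval, which is all
    that an integral with fixed end points sees. *)
Lemma local_primitive (k : R -> R) (M : R) : continuous k ->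
  exists K : R -> R, forall x : R, `|x| < M -> is_derive x 1 K (k x).
Proof.
move=> ck; exists (fun x => \int[mu]_(s in `[- M, x]) k s) => x.
rewrite ltr_norml => /andP[Mx xM].
have [] := @continuous_FTC1 _ k (BLeft (- M)) x M xM.
- exact: continuous_integrable.
- by first [exact: (ltW Mx) | exact: Mx | rewrite lteBSide/= ltW | rewrite ltBSide /= ?ltW].
- exact: ck.
by rewrite derive1E => d1 d2; split; [exact: d1|exact: d2].
Qed.

End unit_interval.

Section oriented_integral.
Context {R : realType}.
Local Notation mu := (@lebesgue_measure R).

(* Valid for b < a as well, with the usual sign convention. *)
Definition oint (a b : R) (k : R -> R) : R :=
  (b - a) * int01 (fun s => k (a + (b - a) * s)).

Lemma cfunctional_cmul (E : topologicalType) (Lam : (E -> R) -> R) (c : R) :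
  cfunctional Lam -> cfunctional (fun k => c * Lam k).
Proof.
move=> HL; split.
- by move=> k l ck cl; rewrite (cfunctional_add HL)// mulrDr.
- by move=> a k ck; rewrite (cfunctional_scale HL)// mulrCA.
- case: HL => _ _ [K [C [cK C0 HC]]]; exists K, (`|c| * C); split => //.
    exact: mulr_ge0.
  by move=> k m ck Hm; rewrite normrM -mulrA ler_wpM2l//; exact: HC.
Qed.

Lemma oint_cfunctional a b : cfunctional (oint a b).
Proof.
have ca : continuous (fun s : R => a + (b - a) * s) by cont.
have c1 : continuous (fun _ : R => 1 : R) by exact: continuous_cst.
have H := cfunctional_cmul (b - a) (cfunctional_push int01_cfunctional ca c1).
have -> : oint a b = (fun k => (b - a) * int01 (fun e => 1 * k (a + (b - a) * e))).
  apply/funext => k; rewrite /oint; congr (_ * int01 _).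
  by apply/funext => e; rewrite mul1r.
exact: H.
Qed.

Lemma oint_continuous (T : topologicalType) (a b : T -> R) (k : T * R -> R) :
  continuous a -> continuous b -> continuous k ->
  continuous (fun z => oint (a z) (b z) (fun s => k (z, s))).
Proof.
move=> ca cb ck; rewrite /oint; apply: continuous_mul.
  by apply: continuous_add => //; exact: continuous_opp.
apply: (@cfunctional_continuous _ _ _ (@int01_cfunctional R) _
  (fun y : T * R => k (y.1, a y.1 + (b y.1 - a y.1) * y.2))).
apply: continuous_compose => //.
have c1 : continuous (fun y : T * R => y.1) by cont.
have ca1 := continuous_compose ca c1; have cb1 := continuous_compose cb c1.
by apply: continuous_pair => //; cont.
Qed.

Lemma oint_FTC2_local (k K : R -> R) (a b M : R) : continuous k ->
  (forall x : R, `|x| < M -> is_derive x 1 K (k x)) ->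
  `|a| < M -> `|b| < M -> oint a b k = K b - K a.
Proof.
move=> ck dK aM bM.
have cl : continuous (fun s : R => a + (b - a) * s) by cont.
have ckl := continuous_compose ck cl.
rewrite /oint -(cfunctional_scale (@int01_cfunctional R))//.
pose K' s := K (a + (b - a) * s).
have -> : K b - K a = K' 1 - K' 0 by rewrite /K' mulr1 mulr0 addr0 subrKC.
apply: FTC2_segment => //.
- by apply: continuous_mul => //; exact: continuous_cst.
- move=> s /andP[s0 s1].
  have : `|a + (b - a) * s| < M.
    have mM : Num.max `|a| `|b| < M by rewrite gt_max aM.
    apply: le_lt_trans mM; set m := Num.max _ _.
    have : `|a| <= m by rewrite le_max lexx.
    have : `|b| <= m by rewrite le_max lexx orbT.
    rewrite !ler_norml => /andP[b1 b2] /andP[a1 a2].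
    have P1 : 0 <= (a + m) * (1 - s) by apply: mulr_ge0; lra.
    have P2 : 0 <= (b + m) * s by apply: mulr_ge0; lra.
    have P3 : 0 <= (m - a) * (1 - s) by apply: mulr_ge0; lra.
    have P4 : 0 <= (m - b) * s by apply: mulr_ge0; lra.
    by apply/andP; split; lra.
  move=> /dK dKs.
  rewrite mulrC; apply: (@is_derive1_comp _ K (fun s => a + (b - a) * s)) => //.
  by apply: is_derive_eq; rewrite /= [_ *: _]mulr1; ring.
Qed.

Lemma oint_FTC2 (k K : R -> R) (a b : R) : continuous k ->
  (forall x : R, is_derive x 1 K (k x)) -> oint a b k = K b - K a.
Proof.
move=> ck dK; apply: (@oint_FTC2_local _ _ _ _ (`|a| + `|b| + 1)) => //.
  by have := normr_ge0 b; lra.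
by have := normr_ge0 a; lra.
Qed.

Lemma oint_Rintegral (k : R -> R) (a b : R) : continuous k -> a <= b ->
  oint a b k = \int[mu]_(x in `[a, b]) k x.
Proof.
move=> ck ab; have [K dK] := local_primitive (`|a| + `|b| + 1) ck.
rewrite (@oint_FTC2_local k K a b (`|a| + `|b| + 1))//; last 2 first.
- by have := normr_ge0 b; lra.
- by have := normr_ge0 a; lra.
apply/esym/FTC2_segment => // x /andP[ax xb]; apply: dK.
have := ler_norm b; have := normr_ge0 a; have := normr_ge0 b.
by have := ler_norm (- a); rewrite normrN => *; rewrite ltr_norml; apply/andP; split; lra.
Qed.

Lemma oint_chasles (k : R -> R) (a b c : R) : continuous k ->
  oint a b k + oint b c k = oint a c k.
Proof.
move=> ck; set M := `|a| + `|b| + `|c| + 1; have [K dK] := local_primitive M ck.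
have a0 := normr_ge0 a; have b0 := normr_ge0 b; have c0 := normr_ge0 c.
rewrite !(@oint_FTC2_local k K _ _ M)//; rewrite /M; lra.
Qed.

Lemma oint_point (k : R -> R) (a : R) : oint a a k = 0.
Proof. by rewrite /oint subrr mul0r. Qed.

Lemma oint_shift (k : R -> R) (a b c : R) :
  oint a b (fun x => k (x + c)) = oint (a + c) (b + c) k.
Proof.
rewrite /oint; have -> : b + c - (a + c) = b - a by ring.
by congr (_ * int01 _); apply/funext => s; congr k; ring.
Qed.

Lemma oint_is_derive (k : R -> R) (a b : R) : continuous k ->
  is_derive b 1 (fun b => oint a b k) (k b).
Proof.
move=> ck; set M := `|a| + `|b| + 1; have [K dK] := local_primitive M ck.
have a0 := normr_ge0 a; have b0 := normr_ge0 b.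
have bM : `|b| < M by rewrite /M; lra.
apply: (@near_eq_is_derive _ _ _ (fun b => K b - K a)); last first.
  have dKb := dK b bM; rewrite -[k b]subr0.
  exact: (is_deriveB dKb (is_derive_cst (K a) b 1)).
near=> x; rewrite (@oint_FTC2_local k K _ _ M)//.
  by rewrite /M; lra.
near: x; exact: (@cvgr_lt _ _ _ _ (fun x : R => `|x|) `|b| (cvg_norm cvg_id)).
Unshelve. all: by end_near. Qed.

Lemma oint_le (k l : R -> R) (a b : R) : continuous k -> continuous l ->
  a <= b -> (forall x, a <= x <= b -> k x <= l x) -> oint a b k <= oint a b l.
Proof.
move=> ck cl ab kl; rewrite !oint_Rintegral//.
by apply: le_Rintegral => //; exact: continuous_integrable.
Qed.

Lemma oint_cst (a b c : R) : oint a b (fun _ => c) = c * (b - a).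
Proof.
have -> : c * (b - a) = c * b - c * a by ring.
apply: (@oint_FTC2 _ (fun x => c * x)); first exact: continuous_cst.
by move=> x; apply: is_derive_eq; rewrite /= [_ *: _]mulr1; ring.
Qed.

Lemma oint_norm_le (k : R -> R) (a b m : R) : continuous k ->
  a <= b -> (forall x, a <= x <= b -> `|k x| <= m) ->
  `|oint a b k| <= m * (b - a).
Proof.
move=> ck ab Hm; rewrite ler_norml -!oint_cst.
rewrite -(cfunctional_opp (oint_cfunctional a b)); last exact: continuous_cst.
apply/andP; split; apply: oint_le => //; try exact: continuous_cst.
  by move=> x /Hm; rewrite ler_norml => /andP[].
by move=> x /Hm; rewrite ler_norml => /andP[].
Qed.

(** Fubini without measure theory: as functions of the upper limit both sides have the derivative
    [Lam (fun e => k (e, b))], and both vanish when the limits coincide. *)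
Lemma cfunctional_oint (E : topologicalType) (Lam : (E -> R) -> R) (a b : R)
    (k : E * R -> R) : cfunctional Lam -> continuous k ->
  Lam (fun e => oint a b (fun s => k (e, s))) =
  oint a b (fun s => Lam (fun e => k (e, s))).
Proof.
move=> HL ck.
have ck2 e : continuous (fun s => k (e, s)).
  by apply: (@continuous_compose _ _ _ k (fun s => (e, s))) => //; cont.
have cks : continuous (fun z : R * E => k (z.2, z.1)).
  by apply: (@continuous_compose _ _ _ k (fun z : R * E => (z.2, z.1))) => //; cont.
have cLk : continuous (fun s => Lam (fun e => k (e, s))).
  exact: (cfunctional_continuous HL cks).
apply/eqP; rewrite -subr_eq0; apply/eqP.
pose D b := Lam (fun e => oint a b (fun s => k (e, s))) -
  oint a b (fun s => Lam (fun e => k (e, s))).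
have dD (x : R) : is_derive x 1 D 0.
  rewrite -(subrr (Lam (fun e => k (e, x)))); apply: is_deriveB; last first.
    exact: oint_is_derive.
  apply: (cfunctional_is_derive HL (k := fun x e => oint a x (fun s => k (e, s)))
    (k' := fun x e => k (e, x))) => //.
  - by move=> t e; exact: oint_is_derive.
  - by move=> t; apply: oint_continuous => //; exact: continuous_cst.
rewrite -[LHS]/(D b) (is_derive_0_is_cst b a dD) /D oint_point.
have -> : (fun e => oint a a (fun s => k (e, s))) = (fun _ => 0).
  by apply/funext => e; rewrite oint_point.
by rewrite (cfunctional0 HL) subrr.
Qed.

End oriented_integral.

(** * C^1 functions of three variables *)
Section C1_functions.
Context {R : realType}.
Local Notation space := (R * R * R)%type.

Definition i0 : 'I_3 := @Ordinal 3 0 isT.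
Definition i1 : 'I_3 := @Ordinal 3 1 isT.
Definition i2 : 'I_3 := @Ordinal 3 2 isT.

Lemma sum3 (F : 'I_3 -> R) : \sum_(i < 3) F i = F i0 + F i1 + F i2.
Proof.
rewrite !big_ord_recl big_ord0 addr0 addrA.
by congr (F _ + F _ + F _); exact/val_inj.
Qed.

Lemma ord3P (P : 'I_3 -> Prop) : P i0 -> P i1 -> P i2 -> forall i, P i.
Proof.
move=> p0 p1 p2 [[|[|[|m]]] Hm] //.
- by have -> : Ordinal Hm = i0 by exact/val_inj.
- by have -> : Ordinal Hm = i1 by exact/val_inj.
- by have -> : Ordinal Hm = i2 by exact/val_inj.
Qed.

Definition coord (i : 'I_3) (x : space) : R :=
  if i == 0%N :> nat then x.1.1 else if i == 1%N :> nat then x.1.2 else x.2.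

Lemma coord_continuous i : continuous (coord i).
Proof. by move: i; apply: ord3P; rewrite /coord/=; cont. Qed.

(** The partial derivatives are carried along as data, so that closed formulas can be supplied for
    them and differentiated again. *)
Definition C1 (f : space -> R) (df : 'I_3 -> space -> R) : Prop :=
  (forall i x, is_derive x (unit_vec i) f (df i x)) /\
  (forall i, continuous (df i)).

Lemma prod3_norm_le (a b c a' b' c' : R) : `|a| <= `|a'| -> `|b| <= `|b'| ->
  `|c| <= `|c'| -> `|(a, b, c)| <= `|(a', b', c')|.
Proof.
move=> H1 H2 H3; rewrite !prod_normE/= !ge_max !le_max H1 H2 H3 /=.
by rewrite ?orbT.
Qed.

Lemma space_lineE (h x1 x2 x3 y1 y2 y3 : R) :
  h *: (x1, x2, x3) + (y1, y2, y3) = (h * x1 + y1, h * x2 + y2, h * x3 + y3) :> space.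
Proof. by []. Qed.

(** The path from x to y changes one coordinate at a time, and the mean value theorem is applied on
    each leg. In the sup norm every point of such a path is at most as far from x as y is. *)
Lemma C1_increment (f : space -> R) df : C1 f df -> forall x y, exists z : 'I_3 -> space,
  (forall i, `|z i - x| <= `|y - x|) /\
  f y - f x = \sum_(i < 3) df i (z i) * (coord i y - coord i x).
Proof.
move=> [d1 _] [[x1 x2] x3] [[y1 y2] y3].
have L (i : 'I_3) (w : space) (a b : R) : exists2 c, `|c - a| <= `|b - a| &
    f (b *: unit_vec i + w) - f (a *: unit_vec i + w) =
    df i (c *: unit_vec i + w) * (b - a).
  apply: (@mean_value _ (fun h => f (h *: unit_vec i + w))
    (fun h => df i (h *: unit_vec i + w))) => h.
  exact: ((is_derive_line f w (unit_vec i) h _).1 (d1 i _)).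
have U (a b c h : R) :
  [/\ h *: unit_vec i0 + (0, b, c) = (h, b, c),
      h *: unit_vec i1 + (a, 0, c) = (a, h, c) &
      h *: unit_vec i2 + (a, b, 0) = (a, b, h) :> space].
  by split; rewrite space_lineE ?mulr1 ?mulr0 ?addr0 ?add0r.
have [c1 h1 E1] := L i0 (0, y2, y3) x1 y1.
have [c2 h2 E2] := L i1 (x1, 0, y3) x2 y2.
have [c3 h3 E3] := L i2 (x1, x2, 0) x3 y3.
have [e1 _ _] := U 0 y2 y3 c1; have [e1x _ _] := U 0 y2 y3 x1; have [e1y _ _] := U 0 y2 y3 y1.
have [_ e2 _] := U x1 0 y3 c2; have [_ e2x _] := U x1 0 y3 x2; have [_ e2y _] := U x1 0 y3 y2.
have [_ _ e3] := U x1 x2 0 c3; have [_ _ e3x] := U x1 x2 0 x3; have [_ _ e3y] := U x1 x2 0 y3.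
rewrite e1 e1x e1y in E1; rewrite e2 e2x e2y in E2; rewrite e3 e3x e3y in E3.
exists (fun i => if i == 0%N :> nat then (c1, y2, y3)
  else if i == 1%N :> nat then (x1, c2, y3) else (x1, x2, c3)); split.
  apply: ord3P => /=.
  - exact: prod3_norm_le.
  - by apply: prod3_norm_le => //=; rewrite subrr normr0.
  - by apply: prod3_norm_le => //=; rewrite subrr normr0.
by rewrite sum3 /coord/= -E1 -E2 -E3; ring.
Qed.

(** The intermediate points of [C1_increment] tend to [c t] by their distance bound, so each term of
    the difference quotient is a product of two convergent factors. *)
Lemma C1_curve (f : space -> R) df (c : R -> space) (c' : 'I_3 -> R) (t : R) :
  C1 f df -> (forall i, is_derive t 1 (fun t => coord i (c t)) (c' i)) ->
  is_derive t 1 (fun t => f (c t)) (\sum_(i < 3) df i (c t) * c' i).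
Proof.
move=> Hf Hc; have [Z HZ] := choice (C1_increment Hf (c t)).
have cc : {for t, continuous c}.
  have ci i : {for t, continuous (fun t => coord i (c t))}.
    by have [dv _] := Hc i; apply/differentiable_continuous/derivable1_diffP.
  have -> : c = (fun t => (coord i0 (c t), coord i1 (c t), coord i2 (c t))).
    by apply/funext => s; rewrite /coord/=; case: (c s) => [[]].
  exact: (cvg_pair (cvg_pair (ci i0) (ci i1)) (ci i2)).
have cq i : (fun h : R => h^-1 *: (coord i (c (h *: 1 + t)) - coord i (c t)))
    @ 0^' --> c' i.
  by have [dv <-] := Hc i; exact: dv.
have c0 : c (h *: (1:R) + t) @[h --> 0^'] --> c t.
  have : {for 0, continuous (fun h : R => c (h *: (1:R) + t))}.
    apply: continuous_comp; last by rewrite /= scale0r add0r.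
    by apply: cvgD; [apply: cvgZr_tmp|exact: cvg_cst].
  rewrite /prop_for /continuous_at scale0r add0r => H.
  by apply: cvg_trans H; apply: cvg_app; exact: nbhs_dnbhs.
have cZ i : Z (c (h *: (1:R) + t)) i @[h --> 0^'] --> c t.
  apply/cvgrPdist_le => e e0; move/cvgrPdist_le/(_ e e0) : c0.
  apply: filterS => h /= H; rewrite distrC; apply: le_trans ((HZ _).1 i) _.
  by rewrite distrC.
have H : (fun h : R => h^-1 *: (f (c (h *: 1 + t)) - f (c t))) @ 0^' -->
    \sum_(i < 3) df i (c t) * c' i.
  have -> : (fun h : R => h^-1 *: (f (c (h *: 1 + t)) - f (c t))) =
    (fun h : R => \sum_(i < 3) df i (Z (c (h *: 1 + t)) i) *
      (h^-1 *: (coord i (c (h *: 1 + t)) - coord i (c t)))).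
    apply/funext => h; rewrite (HZ _).2 /GRing.scale/= mulr_sumr.
    by apply: eq_bigr => i _; ring.
  rewrite sum3; under eq_fun do rewrite sum3.
  have T i : df i (Z (c (h *: 1 + t)) i) *
      (h^-1 *: (coord i (c (h *: 1 + t)) - coord i (c t))) @[h --> 0^'] --> df i (c t) * c' i.
    apply: cvgM; last exact: cq.
    by apply: cvg_comp (cZ i) _; case: Hf => _; exact.
  by apply: cvgD; [apply: cvgD|]; exact: T.
apply: DeriveDef; first by apply/cvg_ex; eexists; exact: H.
by apply: cvg_lim => //; exact: norm_hausdorff.
Qed.

(* Two-variable chain rule on the diagonal, obtained by ignoring one space
   coordinate. *)
Lemma is_derive_diagonal (q q1 q2 : R -> R -> R) (t : R) :
  (forall a b : R, is_derive a 1 (q^~ b) (q1 a b)) ->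
  (forall a b : R, is_derive b 1 (q a) (q2 a b)) ->
  continuous (fun z : R * R => q1 z.1 z.2) ->
  continuous (fun z : R * R => q2 z.1 z.2) ->
  is_derive t 1 (fun t => q t t) (q1 t t + q2 t t).
Proof.
move=> d1 d2 c1 c2.
pose f (x : space) := q x.1.1 x.1.2.
pose df (i : 'I_3) (x : space) : R := if i == 0%N :> nat then q1 x.1.1 x.1.2
  else if i == 1%N :> nat then q2 x.1.1 x.1.2 else 0.
have Cf : C1 f df.
  split.
    move=> i [[x1 x2] x3]; apply/is_derive_line0; move: i; apply: ord3P;
      rewrite /f /df/=.
    - under eq_fun do rewrite /unit_vec/= scaler0 add0r [_ *: 1]mulr1.
      have := d1 (0 + x1) x2; rewrite add0r => d.
      have ds : is_derive (0 : R) 1 (fun h : R => h + x1) 1.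
        by apply: is_derive_eq; rewrite addr0.
      rewrite -[q1 x1 x2]mulr1; apply: (@is_derive1_comp _ (q^~ x2) (fun h => h + x1)) => //.
      by rewrite add0r.
    - under eq_fun do rewrite /unit_vec/= scaler0 add0r [_ *: 1]mulr1.
      have ds : is_derive (0 : R) 1 (fun h : R => h + x2) 1.
        by apply: is_derive_eq; rewrite addr0.
      rewrite -[q2 x1 x2]mulr1; apply: (@is_derive1_comp _ (q x1) (fun h => h + x2)) => //.
      by rewrite add0r.
    - under eq_fun do rewrite /unit_vec/= !scaler0 !add0r.
      exact: is_derive_cst.
  apply: ord3P; rewrite /df/=.
  - by apply: (@continuous_compose _ _ _ _ (fun x : space => (x.1.1, x.1.2)) c1); cont.
  - by apply: (@continuous_compose _ _ _ _ (fun x : space => (x.1.1, x.1.2)) c2); cont.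
  - exact: continuous_cst.
have := @C1_curve f df (fun t => (t, t, 0)) (fun i => (i != 2%N :> nat)%:R) t Cf _.
rewrite sum3 /df/= !mulr1 mul0r addr0; apply.
by apply: ord3P; rewrite /coord/=; exact: is_derive_id || exact: is_derive_cst.
Qed.

(** The upper limit and the parameter are taken as two independent variables and identified by
    [is_derive_diagonal]. *)
Lemma oint_leibniz (k k' : R -> R -> R) (t : R) :
  (forall (t s : R), is_derive t 1 (k^~ s) (k' t s)) ->
  continuous (fun z : R * R => k z.1 z.2) ->
  continuous (fun z : R * R => k' z.1 z.2) ->
  is_derive t 1 (fun t => oint 0 t (k t)) (k t t + oint 0 t (k' t)).
Proof.
move=> dk ck ck'; rewrite addrC.
have cs a : continuous (k a).
  by apply: (@continuous_compose _ _ _ _ (fun s : R => (a, s)) ck); cont.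
apply: (@is_derive_diagonal (fun a b => oint 0 b (k a))
  (fun a b => oint 0 b (k' a)) (fun a b => k a b)) => //.
- by move=> a b; apply: (cfunctional_is_derive (oint_cfunctional 0 b)).
- by move=> a b; exact: oint_is_derive.
- apply: (@oint_continuous _ _ (fun _ => 0) snd
    (fun z : (R * R) * R => k' z.1.1 z.2)).
  + exact: continuous_cst.
  + by move=> x; exact: cvg_snd.
  + by apply: (@continuous_compose _ _ _ _ (fun z : (R * R) * R => (z.1.1, z.2)) ck'); cont.
Qed.

End C1_functions.

(** * Spherical means and Kirchhoff's formula *)
Section derive_calculus.
Context {R : realType} {V : normedModType R}.
Implicit Types (f g : V -> R) (x v : V).

Lemma der_eq f x v (d d' : R) : is_derive x v f d' -> d' = d -> is_derive x v f d.
Proof. by move=> + <-. Qed.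

Lemma der_cst x v (c : R) : is_derive x v (fun _ => c) 0.
Proof. exact: is_derive_cst. Qed.

Lemma der_add f g x v (a b : R) : is_derive x v f a -> is_derive x v g b ->
  is_derive x v (fun x => f x + g x) (a + b).
Proof. by move=> ? ?; exact: is_deriveD. Qed.

Lemma der_opp f x v (a : R) : is_derive x v f a ->
  is_derive x v (fun x => - f x) (- a).
Proof. by move=> ?; exact: is_deriveN. Qed.

Lemma der_mul f g x v (a b : R) : is_derive x v f a -> is_derive x v g b ->
  is_derive x v (fun x => f x * g x) (a * g x + f x * b).
Proof.
move=> ? ?; apply: der_eq (is_deriveM _ _) _ => //.
by rewrite /GRing.scale/= addrC mulrC.
Qed.

Lemma der_exp f x v (a : R) n : is_derive x v f a ->
  is_derive x v (fun x => f x ^+ n.+1) (n.+1%:R * f x ^+ n * a).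
Proof.
move=> df; elim: n => [|n ih].
  have -> : (fun x => f x ^+ 1) = f by apply/funext => y; rewrite expr1.
  by apply: der_eq df _; rewrite expr0 mulr1 mul1r.
have -> : (fun x => f x ^+ n.+2) = (fun x => f x * f x ^+ n.+1).
  by apply/funext => y; rewrite exprS.
apply: der_eq (der_mul df ih) _.
by rewrite [n.+2%:R]mulrS exprS; ring.
Qed.

Lemma der_comp (h : R -> R) f x v (a b : R) :
  is_derive (f x) 1 h a -> is_derive x v f b ->
  is_derive x v (fun x => h (f x)) (a * b).
Proof.
move=> dh /is_derive_line0 df; apply/is_derive_line0.
by apply: (@is_derive1_comp _ h (fun t => f (t *: v + x))) => //; rewrite scale0r add0r.
Qed.

Lemma der_sin f x v (b : R) : is_derive x v f b ->
  is_derive x v (fun x => sin (f x)) (cos (f x) * b).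
Proof. by apply: der_comp; exact: is_derive_sin. Qed.

Lemma der_cos f x v (b : R) : is_derive x v f b ->
  is_derive x v (fun x => cos (f x)) (- sin (f x) * b).
Proof. by apply: der_comp; exact: is_derive_cos. Qed.

Lemma der_expR f x v (b : R) : is_derive x v f b ->
  is_derive x v (fun x => expR (f x)) (expR (f x) * b).
Proof. by apply: der_comp; exact: is_derive_expR. Qed.

End derive_calculus.

Lemma der_id (R : realType) (x : R) : is_derive x 1 (fun x : R => x) 1.
Proof. exact: is_derive_id. Qed.

(** The derivative is computed from the syntax of the function; [der] then leaves the equation
    between the computed and the expected value. *)
Ltac der1 := lazymatch goal with
  | |- is_derive _ _ (fun x => x) _ => exact: der_id
  | |- is_derive _ _ (fun x => GRing.add (@?f x) (@?g x)) _ => eapply (@der_add _ _ f g)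
  | |- is_derive _ _ (fun x => GRing.opp (@?f x)) _ => eapply (@der_opp _ _ f)
  | |- is_derive _ _ (fun x => GRing.mul (@?f x) (@?g x)) _ => eapply (@der_mul _ _ f g)
  | |- is_derive _ _ (fun x => GRing.exp (@?f x) _) _ => eapply (@der_exp _ _ f)
  | |- is_derive _ _ (fun x => sin (@?f x)) _ => eapply (@der_sin _ _ f)
  | |- is_derive _ _ (fun x => cos (@?f x)) _ => eapply (@der_cos _ _ f)
  | |- is_derive _ _ (fun x => expR (@?f x)) _ => eapply (@der_expR _ _ f)
  | |- is_derive _ _ _ _ => first [ eassumption | exact: der_cst ]
  end; cbv beta.
Ltac der := eapply der_eq; [ solve [repeat der1] | ].

Lemma C1_continuous (R : realType) (f : R * R * R -> R) df : C1 f df -> continuous f.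
Proof.
move=> Hf x; have [Z HZ] := choice (C1_increment Hf x).
have cZ i : Z y i @[y --> x] --> x.
  apply/cvgrPdist_le => e e0; near=> y.
  rewrite distrC; apply: le_trans ((HZ y).1 i) _; near: y.
  have /cvgrPdist_le/(_ e e0) : (fun y : R * R * R => y) y @[y --> x] --> x by exact: cvg_id.
  by apply: filterS => y /=; rewrite distrC.
have cd i : df i (Z y i) * (coord i y - coord i x) @[y --> x] -->
    df i x * (coord i x - coord i x).
  apply: cvgM; first by apply: cvg_comp (cZ i) _; exact: Hf.2.
  by apply: cvgB; [exact: coord_continuous|exact: cvg_cst].
have H : f x + (df i0 (Z y i0) * (coord i0 y - coord i0 x) +
      df i1 (Z y i1) * (coord i1 y - coord i1 x) +
      df i2 (Z y i2) * (coord i2 y - coord i2 x)) @[y --> x] --> f x + (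
      df i0 x * (coord i0 x - coord i0 x) +
      df i1 x * (coord i1 x - coord i1 x) +
      df i2 x * (coord i2 x - coord i2 x)).
  by apply: cvgD; [exact: cvg_cst|apply: cvgD; [apply: cvgD|]; exact: cd].
rewrite !subrr !mulr0 !addr0 in H.
apply: cvg_trans H; apply: near_eq_cvg; apply: nearW => y.
have E := sum3 (fun i => df i (Z y i) * (coord i y - coord i x)).
by rewrite -E -(HZ y).2 addrC subrK.
Unshelve. all: by end_near. Qed.

Section sphere.
Context {R : realType}.
Local Notation space := (R * R * R)%type.
Implicit Types k l : space -> R.

Definition om (a b : R) : space := (sin a * cos b, sin a * sin b, cos a).

(* The mean over the unit sphere, in spherical coordinates. *)
Definition sph (k : space -> R) : R :=
  (4 * pi)^-1 *
  oint 0 pi (fun a => oint 0 (2 * pi) (fun b => sin a * k (om a b))).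

Definition sqn (x : space) : R := x.1.1 ^+ 2 + x.1.2 ^+ 2 + x.2 ^+ 2.

Lemma sqn_om a b : sqn (om a b) = 1.
Proof.
rewrite /sqn/= !exprMn -mulrDr cos2Dsin2 mulr1 addrC; exact: cos2Dsin2.
Qed.

Lemma om_continuous : continuous (fun z : R * R => om z.1 z.2).
Proof. by rewrite /om; cont. Qed.

Lemma sph_cfunctional : cfunctional sph.
Proof.
have cs : continuous (fun z : R * R => sin z.1 : R) by cont.
exact: (cfunctional_cmul (4 * pi)^-1 (cfunctional_push (cfunctional_comp
  (oint_cfunctional 0 pi) (oint_cfunctional 0 (2 * pi))) om_continuous cs)).
Qed.

Lemma sph_eq k l : (forall w, sqn w = 1 -> k w = l w) -> sph k = sph l.
Proof.
move=> kl; rewrite /sph; congr (_ * oint _ _ _); apply/funext => a.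
by congr oint; apply/funext => b; rewrite kl// sqn_om.
Qed.

Lemma integrand_continuous k : continuous k ->
  continuous (fun z : R * R => sin z.1 * k (om z.1 z.2)).
Proof.
by move=> ck; apply: continuous_mul; [cont|exact: continuous_compose ck om_continuous].
Qed.

Lemma integrand_slice k a : continuous k -> continuous (fun b => sin a * k (om a b)).
Proof.
move=> ck; apply: (@continuous_compose _ _ _ _ (fun b : R => (a, b))
  (integrand_continuous ck)); cont.
Qed.

Lemma integrand_oint_continuous k : continuous k ->
  continuous (fun a => oint 0 (2 * pi) (fun b => sin a * k (om a b))).
Proof.
move=> ck; apply: (@oint_continuous _ _ (fun _ => 0) (fun _ => 2 * pi)
  (fun z : R * R => sin z.1 * k (om z.1 z.2))); try exact: continuous_cst.
exact: integrand_continuous.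
Qed.

Lemma twopi_ge0 : 0 <= 2 * pi :> R.
Proof. by rewrite mulr_ge0// pi_ge0. Qed.

Lemma sph_le k l : continuous k -> continuous l ->
  (forall w, sqn w = 1 -> k w <= l w) -> sph k <= sph l.
Proof.
move=> ck cl kl; rewrite /sph ler_wpM2l//.
  by rewrite invr_ge0 mulr_ge0// pi_ge0.
apply: oint_le; [exact: integrand_oint_continuous..|exact: pi_ge0|move=> a api].
apply: oint_le; [exact: integrand_slice..|exact: twopi_ge0|move=> b _].
by rewrite ler_wpM2l//; [exact: sin_ge0_pi|apply: kl; exact: sqn_om].
Qed.

Lemma sph_cst (c : R) : sph (fun _ => c) = c.
Proof.
rewrite /sph; under [X in oint _ _ X]eq_fun do rewrite oint_cst subr0.
have cs : continuous (fun x : R => sin x * c * (2 * pi)) by cont.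
have dc (x : R) : is_derive x 1 (fun a => - cos a * c * (2 * pi))
  (sin x * c * (2 * pi)) by der; ring.
rewrite (oint_FTC2 0 pi cs dc).
have p0 : pi != 0 :> R by rewrite gt_eqF// pi_gt0.
rewrite cospi cos0; have -> : - -1 * c * (2 * pi) - - 1 * c * (2 * pi) = c * (4 * pi) by ring.
by rewrite mulrC mulfK// mulf_neq0// pnatr_eq0.
Qed.

(** The divergence theorem in the rectangle of angles. The boundary terms cancel in pairs: A agrees
    at the two poles and B is periodic in the longitude. *)
Lemma divergence_torus (A B a b : R -> R -> R) :
  (forall s t : R, is_derive s 1 (A^~ t) (a s t)) ->
  (forall s t : R, is_derive t 1 (B s) (b s t)) ->
  continuous (fun z : R * R => a z.1 z.2) ->
  continuous (fun z : R * R => b z.1 z.2) ->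
  (forall t, A pi t = A 0 t) -> (forall s, B s (2 * pi) = B s 0) ->
  oint 0 pi (fun s => oint 0 (2 * pi) (fun t => a s t + b s t)) = 0.
Proof.
move=> dA dB ca cb Api Bpi.
have sl (c : R -> R -> R) s : continuous (fun z : R * R => c z.1 z.2) -> continuous (c s).
  by move=> cc; apply: (@continuous_compose _ _ _ _ (fun b : R => (s, b)) cc); cont.
have sr (c : R -> R -> R) t : continuous (fun z : R * R => c z.1 z.2) -> continuous (c^~ t).
  by move=> cc; apply: (@continuous_compose _ _ _ _ (fun b : R => (b, t)) cc); cont.
have so (c : R -> R -> R) : continuous (fun z : R * R => c z.1 z.2) ->
   continuous (fun s => oint 0 (2 * pi) (c s)).
  by move=> cc; apply: (@oint_continuous _ _ (fun _ => 0) (fun _ => 2 * pi) _ _ _ cc);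
    exact: continuous_cst.
have -> : (fun s => oint 0 (2 * pi) (fun t => a s t + b s t)) =
    (fun s => oint 0 (2 * pi) (a s) + oint 0 (2 * pi) (b s)).
  by apply/funext => s; rewrite (cfunctional_add (oint_cfunctional _ _))//; exact: sl.
rewrite (cfunctional_add (oint_cfunctional _ _)); [|exact: so..].
rewrite (cfunctional_oint _ _ (oint_cfunctional 0 pi) ca).
have -> : (fun s => oint 0 pi (fun e => a (e, s).1 (e, s).2)) = (fun _ => 0).
  apply/funext => t; rewrite (@oint_FTC2 _ (a^~ t) (A^~ t))//; last exact: sr.
  by rewrite Api subrr.
have -> : (fun s => oint 0 (2 * pi) (b s)) = (fun _ => 0).
  apply/funext => s; rewrite (@oint_FTC2 _ (b s) (B s))//; last exact: sl.
  by rewrite Bpi subrr.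
by rewrite !oint_cst !mul0r addr0.
Qed.

Lemma om_per a : om a (2 * pi) = om a 0.
Proof. by rewrite /om mulr_natl cos2pi sin2pi cos0 sin0. Qed.

Section rotation.
Variables (k : space -> R) (dk : 'I_3 -> space -> R).
Hypothesis Ck : C1 k dk.

Let dka (a b : R) : R := dk i0 (om a b) * (cos a * cos b) +
  dk i1 (om a b) * (cos a * sin b) - dk i2 (om a b) * sin a.
Let dkb (a b : R) : R := - dk i0 (om a b) * (sin a * sin b) +
  dk i1 (om a b) * (sin a * cos b).

Let dka_derive (a b : R) : is_derive a 1 (fun a => k (om a b)) (dka a b).
Proof.
apply: der_eq (@C1_curve _ k dk (fun a => om a b) (fun i =>
  if i == 0%N :> nat then cos a * cos b else if i == 1%N :> nat then
  cos a * sin b else - sin a) a Ck _) _; last by rewrite sum3 /dka/=; ring.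
by apply: ord3P; rewrite /coord/=; der; ring.
Qed.

Let dkb_derive (a b : R) : is_derive b 1 (fun b => k (om a b)) (dkb a b).
Proof.
apply: der_eq (@C1_curve _ k dk (fun b => om a b) (fun i =>
  if i == 0%N :> nat then - (sin a * sin b) else if i == 1%N :> nat then
  sin a * cos b else 0) b Ck _) _; last by rewrite sum3 /dkb/=; ring.
by apply: ord3P; rewrite /coord/=; der; ring.
Qed.

Let dk_om i : continuous (fun z : R * R => dk i (om z.1 z.2)).
Proof. exact: continuous_compose (Ck.2 i) om_continuous. Qed.

Let dka_continuous : continuous (fun z : R * R => dka z.1 z.2).
Proof. by have := @dk_om i0; have := @dk_om i1; have := @dk_om i2; rewrite /dka => ? ? ?; cont. Qed.

Let dkb_continuous : continuous (fun z : R * R => dkb z.1 z.2).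
Proof. by have := @dk_om i0; have := @dk_om i1; rewrite /dkb => ? ?; cont. Qed.

(* Rotation invariance of the sphere, in infinitesimal form. *)
Lemma sph_rotation (ij : 'I_3 * 'I_3) :
  ij \in [:: (i0, i1); (i0, i2); (i1, i2)] ->
  sph (fun w => coord ij.1 w * dk ij.2 w - coord ij.2 w * dk ij.1 w) = 0.
Proof.
have ck : continuous (fun z : R * R => k (om z.1 z.2)).
  apply: continuous_compose om_continuous.
  exact: C1_continuous Ck.
have S2 (x : R) : sin x ^+ 2 = 1 - cos x ^+ 2 by rewrite -(cos2Dsin2 x); ring.
have dkA (x y : R) := dka_derive x y; have dkB (x y : R) := dkb_derive x y.
rewrite !inE => /or3P[]/eqP -> /=; rewrite /sph -[RHS](mulr0 (4 * pi)^-1); congr (_ * _).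
- etransitivity; last apply: (@divergence_torus (fun _ _ => 0) (fun a b => sin a * k (om a b))
    (fun _ _ => 0) (fun a b => sin a * dkb a b)).
  + congr oint; apply/funext => a; congr oint; apply/funext => b.
    by rewrite /coord/= /dkb; ring.
  + by move=> s t; have := dkB s t => ?; der; ring.
  + exact: continuous_cst.
  + by cont.
  + by [].
  + by move=> s; rewrite om_per.
(* In the angles the field x d_z - z d_x reads - cos b d_a + cot a sin b d_b. Multiplied by the
   density sin a it is divergence free, so A and B are its components times k. The next case is the
   same with y in place of x. *)
- etransitivity; last apply: (@divergence_torus (fun a b => - sin a * cos b * k (om a b))
    (fun a b => cos a * sin b * k (om a b))
    (fun a b => - cos a * cos b * k (om a b) - sin a * cos b * dka a b)
    (fun a b => cos a * cos b * k (om a b) + cos a * sin b * dkb a b)).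
  + congr oint; apply/funext => a; congr oint; apply/funext => b.
    rewrite /coord/= /dkb /dka; have := S2 b; move: (sin b) (cos b) => sb cb Sb.
    apply/eqP; rewrite -subr_eq0; apply/eqP.
    transitivity (dk i0 (om a b) * sin a * cos a * (sb ^+ 2 - (1 - cb ^+ 2))); first by ring.
    by rewrite Sb subrr mulr0.
  + by move=> s t; have := dkA s t => ?; der; ring.
  + by move=> s t; have := dkB s t => ?; der; ring.
  + by cont.
  + by cont.
  + by move=> t; rewrite sinpi sin0 oppr0 !mul0r.
  + by move=> s; rewrite mulr_natl sin2pi sin0 !mulr0 !mul0r.
- etransitivity; last apply: (@divergence_torus (fun a b => - sin a * sin b * k (om a b))
    (fun a b => - cos a * cos b * k (om a b))
    (fun a b => - cos a * sin b * k (om a b) - sin a * sin b * dka a b)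
    (fun a b => cos a * sin b * k (om a b) - cos a * cos b * dkb a b)).
  + congr oint; apply/funext => a; congr oint; apply/funext => b.
    rewrite /coord/= /dkb /dka; have := S2 b; move: (sin b) (cos b) => sb cb Sb.
    apply/eqP; rewrite -subr_eq0; apply/eqP.
    transitivity (dk i1 (om a b) * sin a * cos a * (sb ^+ 2 - (1 - cb ^+ 2))); first by ring.
    by rewrite Sb subrr mulr0.
  + by move=> s t; have := dkA s t => ?; der; ring.
  + by move=> s t; have := dkB s t => ?; der; ring.
  + by cont.
  + by cont.
  + by move=> t; rewrite sinpi sin0 oppr0 !mul0r.
  + by move=> s; rewrite om_per mulr_natl cos2pi cos0.
Qed.

End rotation.
End sphere.

Section sphere_fubini.
Context {R : realType}.
Local Notation space := (R * R * R)%type.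

Lemma cfunctional_sph (E : topologicalType) (Lam : (E -> R) -> R)
    (k : E * space -> R) : cfunctional Lam -> continuous k ->
  Lam (fun e => sph (fun w => k (e, w))) = sph (fun w => Lam (fun e => k (e, w))).
Proof.
move=> HL ck.
have c3 : continuous (fun z : (E * R) * R => sin z.1.2 * k (z.1.1, om z.1.2 z.2)).
  apply: continuous_mul; first by cont.
  apply: (continuous_compose ck); apply: continuous_pair; first by cont.
  by apply: (@continuous_compose _ _ _ _ (fun z : (E * R) * R => (z.1.2, z.2)) (@om_continuous R)); cont.
have c2 : continuous (fun z : E * R => oint 0 (2 * pi) (fun b => sin z.2 * k (z.1, om z.2 b))).
  by apply: (@oint_continuous _ _ (fun _ => 0) (fun _ => 2 * pi) _ _ _ c3); exact: continuous_cst.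
have c1 : continuous (fun e => oint 0 pi (fun a => oint 0 (2 * pi) (fun b => sin a * k (e, om a b)))).
  by apply: (@oint_continuous _ _ (fun _ => 0) (fun _ => pi) _ _ _ c2); exact: continuous_cst.
rewrite /sph (cfunctional_scale HL)//; congr (_ * _).
rewrite (cfunctional_oint _ _ HL c2) /=; congr oint; apply/funext => a.
have c4 : continuous (fun z : E * R => sin a * k (z.1, om a z.2)).
  by apply: (@continuous_compose _ _ _ _ (fun z : E * R => ((z.1, a), z.2)) c3); cont.
rewrite (cfunctional_oint _ _ HL c4) /=; congr oint; apply/funext => b.
rewrite (cfunctional_scale HL)//.
by apply: (continuous_compose ck); cont.
Qed.

End sphere_fubini.

Section C1_calculus.
Context {R : realType}.
Local Notation space := (R * R * R)%type.
Implicit Types f g h : space -> R.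

Lemma coordD i (x y : space) : coord i (x + y) = coord i x + coord i y.
Proof. by move: i; apply: ord3P. Qed.

Lemma coordZ i (a : R) (x : space) : coord i (a *: x) = a * coord i x.
Proof. by move: i; apply: ord3P. Qed.

Lemma coord_unit_vec i j : coord i (unit_vec j) = (i == j)%:R :> R.
Proof. by move: i; apply: ord3P; move: j; apply: ord3P. Qed.

Lemma C1_coord i : C1 (coord i : space -> R) (fun j _ => (i == j)%:R).
Proof.
split=> [j x|j]; last exact: continuous_cst.
apply/is_derive_line0; under eq_fun do rewrite coordD coordZ coord_unit_vec.
by der; ring.
Qed.

Lemma C1_add f g df dg : C1 f df -> C1 g dg ->
  C1 (fun x => f x + g x) (fun i x => df i x + dg i x).
Proof.
move=> [f1 f2] [g1 g2]; split=> [i x|i]; first exact: der_add.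
exact: continuous_add.
Qed.

Lemma C1_opp f df : C1 f df -> C1 (fun x => - f x) (fun i x => - df i x).
Proof.
move=> [f1 f2]; split=> [i x|i]; first exact: der_opp.
exact: continuous_opp.
Qed.

Lemma C1_mul f g df dg : C1 f df -> C1 g dg ->
  C1 (fun x => f x * g x) (fun i x => df i x * g x + f x * dg i x).
Proof.
move=> Hf Hg; have cf := C1_continuous Hf; have cg := C1_continuous Hg.
case: Hf Hg => [f1 f2] [g1 g2]; split=> [i x|i]; first exact: der_mul.
by apply: continuous_add; apply: continuous_mul.
Qed.

Lemma C1_affine h dh (x : space) (tau : R) : C1 h dh ->
  C1 (fun w => h (x + tau *: w)) (fun i w => tau * dh i (x + tau *: w)).
Proof.
move=> [h1 h2]; split=> [i w|i]; last by cont.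
apply/is_derive_line0.
have E a : x + tau *: (a *: unit_vec i + w) = (a * tau) *: unit_vec i + (x + tau *: w).
  by rewrite scalerDr scalerA addrCA mulrC.
under eq_fun do rewrite E.
have := (is_derive_line h (x + tau *: w) (unit_vec i) 0 _).1.
move=> /(_ (dh i (x + tau *: w))); rewrite scale0r add0r => /(_ (h1 _ _)) H.
have H0 : is_derive ((0 : R) * tau) 1 (fun a : R => h (a *: unit_vec i + (x + tau *: w)))
  (dh i (x + tau *: w)) by rewrite mul0r.
have H1 : is_derive (0 : R) 1 (fun a : R => a * tau) tau by der; ring.
rewrite mulrC.
exact: (@der_comp R R (fun a => h (a *: unit_vec i + (x + tau *: w))) (fun a => a * tau) 0 1 _ _ H0 H1).
Qed.

Lemma C1_ray h dh (x w : space) (tau : R) : C1 h dh ->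
  is_derive tau 1 (fun tau => h (x + tau *: w))
    (\sum_(i < 3) dh i (x + tau *: w) * coord i w).
Proof.
move=> Ch; apply: C1_curve => // i.
under eq_fun do rewrite coordD coordZ.
by der; ring.
Qed.

End C1_calculus.

(** * Kirchhoff's formula *)

Section kirchhoff.
Context {R : realType}.
Local Notation space := (R * R * R)%type.
Implicit Types h k : space -> R.

(* Kirchhoff's solution of the wave equation with data (0, h) at time tau,
   and its time derivative. *)
Definition kir (tau : R) h (x : space) : R := tau * sph (fun w => h (x + tau *: w)).

Definition kir' (tau : R) h (dh : 'I_3 -> space -> R) (x : space) : R :=
  sph (fun w => h (x + tau *: w)) +
  tau * sph (fun w => \sum_(i < 3) dh i (x + tau *: w) * coord i w).

Lemma sph_ray_continuous (T : topologicalType) (k : T * space -> R)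
    (a : T -> R) (x : T -> space) : continuous k -> continuous a -> continuous x ->
  continuous (fun z => sph (fun w => k (z, x z + a z *: w))).
Proof.
move=> ck ca cx.
apply: (@cfunctional_continuous _ _ _ (@sph_cfunctional R) _
  (fun z : T * space => k (z.1, x z.1 + a z.1 *: z.2))).
apply: (continuous_compose ck); apply: continuous_pair; first by cont.
have c1 : continuous (fun z : T * space => z.1) by cont.
have c2 := continuous_compose ca c1; have c3 := continuous_compose cx c1.
by apply: continuous_add => //; apply: continuous_scale => //; cont.
Qed.

Lemma kir_derive h dh (x : space) (tau : R) : C1 h dh ->
  is_derive tau 1 (fun tau => kir tau h x) (kir' tau h dh x).
Proof.
move=> Ch; have ch := C1_continuous Ch; have cdh := Ch.2.
have H : is_derive tau 1 (fun tau => sph (fun w => h (x + tau *: w)))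
    (sph (fun w => \sum_(i < 3) dh i (x + tau *: w) * coord i w)).
  apply: (cfunctional_is_derive sph_cfunctional
    (k := fun tau w => h (x + tau *: w))
    (k' := fun tau w => \sum_(i < 3) dh i (x + tau *: w) * coord i w)).
  - by move=> t w; exact: C1_ray.
  - by move=> t; cont.
  - apply: continuous_sum => i; apply: continuous_mul; first by cont.
    by have cco := @coord_continuous R; cont.
rewrite /kir; der; rewrite /kir'; ring.
Qed.

Section second_order.
Variables (h : space -> R) (dh : 'I_3 -> space -> R) (ddh : 'I_3 -> 'I_3 -> space -> R).
Hypotheses (Ch : C1 h dh) (Cdh : forall i, C1 (dh i) (ddh i)).

(** Direct differentiation gives the mean of 2 d_w h + tau D^2h(w, w). On the unit sphere this is
    tau times the Laplacian of h minus 1/tau times the spherical Laplacian of w -> h(x + tau w). The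
    latter is a sum of squares of rotation fields, so its mean is zero by [sph_rotation]. *)
Lemma kir'_derive (x : space) (tau : R) :
  is_derive tau 1 (fun tau => kir' tau h dh x)
    (kir tau (fun y => \sum_(i < 3) ddh i i y) x).
Proof.
have ch := C1_continuous Ch; have cdh := Ch.2.
have cddh i j : continuous (ddh i j) by exact: (Cdh i).2.
have cco i : continuous (coord i : space -> R) by exact: coord_continuous.
pose y (w : space) : space := x + tau *: w.
have H0 : is_derive tau 1 (fun tau => sph (fun w => h (x + tau *: w)))
    (sph (fun w => \sum_(i < 3) dh i (x + tau *: w) * coord i w)).
  apply: (cfunctional_is_derive sph_cfunctional
    (k := fun tau w => h (x + tau *: w))
    (k' := fun tau w => \sum_(i < 3) dh i (x + tau *: w) * coord i w)).
  - by move=> t w; exact: C1_ray.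
  - by move=> t; cont.
  - by apply: continuous_sum => i; cont.
have H1 : is_derive tau 1 (fun tau => sph (fun w => \sum_(i < 3) dh i (x + tau *: w) * coord i w))
    (sph (fun w => \sum_(i < 3) (\sum_(j < 3) ddh i j (x + tau *: w) * coord j w) * coord i w)).
  apply: (cfunctional_is_derive sph_cfunctional
    (k := fun tau w => \sum_(i < 3) dh i (x + tau *: w) * coord i w)
    (k' := fun tau w => \sum_(i < 3) (\sum_(j < 3) ddh i j (x + tau *: w) * coord j w) * coord i w)).
  - move=> t w; under eq_fun do rewrite sum3.
    rewrite sum3.
    have d0 := C1_ray x w t (Cdh i0); have d1 := C1_ray x w t (Cdh i1).
    have d2 := C1_ray x w t (Cdh i2).
    by der; ring.
  - by move=> t; apply: continuous_sum => i; cont.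
  - apply: continuous_sum => i; apply: continuous_mul; last by cont.
    by apply: continuous_sum => j; cont.
rewrite /kir'; der.
(* The rotation field in the plane (i, j) applied to w_i d_j h - w_j d_i h, with derivatives of h
   taken at x + tau w; the second factor is again a rotation derivative, of w -> h(x + tau w), up to
   the factor tau. *)
pose rot (i j : 'I_3) (w : space) := coord i w * (coord i w * (tau * ddh j j (y w)) - dh i (y w)
  - coord j w * (tau * ddh i j (y w))) - coord j w * (dh j (y w) +
  coord i w * (tau * ddh j i (y w)) - coord j w * (tau * ddh i i (y w))).
have cy : continuous y by rewrite /y; cont.
have crot i j : continuous (rot i j) by rewrite /rot; cont.
have R0 i j : (i, j) \in [:: (i0, i1); (i0, i2); (i1, i2)] -> sph (rot i j) = 0.
  move=> ij.
  have Ck := C1_add (C1_mul (C1_coord i) (C1_affine x tau (Cdh j)))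
    (C1_opp (C1_mul (C1_coord j) (C1_affine x tau (Cdh i)))).
  rewrite -[RHS](sph_rotation Ck ij); congr sph; apply/funext => w /=.
  have -> : (i == j) = false by move: ij; rewrite !inE => /or3P[]/eqP[-> ->].
  have -> : (j == i) = false by move: ij; rewrite !inE => /or3P[]/eqP[-> ->].
  by rewrite !eqxx /= ?mulr1n ?mulr0n /rot /y; ring.
have E : sph (fun w => tau * \sum_(i < 3) ddh i i (y w)
      - (rot i0 i1 w + rot i0 i2 w + rot i1 i2 w)) =
   kir tau (fun y => \sum_(i < 3) ddh i i y) x.
  have cL : continuous (fun w : space => \sum_(i < 3) ddh i i (y w)).
    by apply: continuous_sum => i; cont.
  have ctL : continuous (fun w : space => tau * \sum_(i < 3) ddh i i (y w)) by cont.
  have c12 : continuous (fun w => rot i0 i1 w + rot i0 i2 w) by apply: continuous_add.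
  have c123 : continuous (fun w => rot i0 i1 w + rot i0 i2 w + rot i1 i2 w).
    by apply: continuous_add.
  rewrite (cfunctional_sub sph_cfunctional ctL c123).
  rewrite (cfunctional_add sph_cfunctional c12 (crot i1 i2)).
  rewrite (cfunctional_add sph_cfunctional (crot i0 i1) (crot i0 i2)).
  rewrite (R0 i0 i1) ?inE// (R0 i0 i2) ?inE// (R0 i1 i2) ?inE//.
  by rewrite !addr0 subr0 (cfunctional_scale sph_cfunctional)//.
rewrite -E.
have c1 : continuous (fun w : space => \sum_(i < 3) dh i (x + tau *: w) * coord i w).
  by apply: continuous_sum => i; cont.
have c2 : continuous (fun w : space => \sum_(i < 3)
    (\sum_(j < 3) ddh i j (x + tau *: w) * coord j w) * coord i w).
  apply: continuous_sum => i; apply: continuous_mul; last by cont.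
  by apply: continuous_sum => j; cont.
set f1 := (fun w : space => _) in c1; set f2 := (fun w : space => _) in c2.
transitivity (sph f1 + sph f1 + tau * sph f2); first by rewrite /f1 /f2; ring.
rewrite -(cfunctional_add sph_cfunctional c1 c1) -(cfunctional_scale sph_cfunctional)//.
rewrite -(cfunctional_add sph_cfunctional) /f1 /f2.
- apply: sph_eq => w; rewrite /sqn => w1.
  rewrite !sum3 /rot -!/(y w).
  have w1' : coord i0 w ^+ 2 + coord i1 w ^+ 2 + coord i2 w ^+ 2 = 1 by exact: w1.
  apply/eqP; rewrite -subr_eq0; apply/eqP.
  transitivity ((coord i0 w ^+ 2 + coord i1 w ^+ 2 + coord i2 w ^+ 2 - 1) *
    tau * (ddh i0 i0 (y w) + ddh i1 i1 (y w) + ddh i2 i2 (y w))); first by ring.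
  by rewrite w1' subrr !mul0r.
- by apply: continuous_add.
- by cont.
Qed.

End second_order.

Lemma kir0 h x : kir 0 h x = 0.
Proof. by rewrite /kir mul0r. Qed.

Lemma kir'0 h dh x : kir' 0 h dh x = h x.
Proof.
rewrite /kir' mul0r addr0 -[RHS]sph_cst; congr sph; apply/funext => w.
by rewrite scale0r addr0.
Qed.

End kirchhoff.

(** * Duhamel's formula and its weak form *)
Section box.
Context {R : realType}.
Local Notation space := (R * R * R)%type.

Lemma oint_eq (k l : R -> R) (a b : R) :
  (forall s, 0 <= s <= 1 -> k (a + (b - a) * s) = l (a + (b - a) * s)) ->
  oint a b k = oint a b l.
Proof.
move=> kl; rewrite /oint /int01; congr (_ * _).
by apply: eq_Rintegral => s; rewrite inE/= in_itv/= => s01; exact: kl.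
Qed.

Lemma oint_eq0 (k : R -> R) (a b : R) :
  (forall s, 0 <= s <= 1 -> k (a + (b - a) * s) = 0) -> oint a b k = 0.
Proof. by move=> k0; rewrite (@oint_eq _ (fun _ => 0))// oint_cst mul0r. Qed.

Lemma oint_tail (k : R -> R) (a b n : R) : (forall x, n <= `|x| -> k x = 0) ->
  (n <= a /\ n <= b) \/ (a <= - n /\ b <= - n) -> oint a b k = 0.
Proof.
move=> k0 ab; apply: oint_eq0 => s /andP[s0 s1]; apply: k0.
case: ab => -[an bn].
  have P1 : 0 <= (a - n) * (1 - s) by apply: mulr_ge0; lra.
  have P2 : 0 <= (b - n) * s by apply: mulr_ge0; lra.
  by apply: le_trans (ler_norm _); lra.
have P1 : 0 <= (- n - a) * (1 - s) by apply: mulr_ge0; lra.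
have P2 : 0 <= (- n - b) * s by apply: mulr_ge0; lra.
by rewrite -normrN; apply: le_trans (ler_norm _); lra.
Qed.

Lemma oint_extend (k : R -> R) (n N M : R) : continuous k ->
  (forall x, n <= `|x| -> k x = 0) -> n <= N -> n <= M ->
  oint (- N) N k = oint (- M) M k.
Proof.
move=> ck k0 nN nM.
rewrite -(oint_chasles (- M) (- N) M ck) -(oint_chasles (- N) N M ck).
rewrite (@oint_tail k (- M) (- N) n)//; last by right; split; lra.
by rewrite (@oint_tail k N M n)//; [rewrite add0r addr0|left].
Qed.

Lemma oint_translate (k : R -> R) (n M c : R) : continuous k ->
  (forall x, n <= `|x| -> k x = 0) -> `|c| <= M - n ->
  oint (- M) M (fun x => k (x + c)) = oint (- M) M k.
Proof.
move=> ck k0; rewrite ler_norml => /andP[c1 c2]; rewrite oint_shift.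
rewrite -(oint_chasles (- M + c) (- M) _ ck) -(oint_chasles (- M) M _ ck).
rewrite (@oint_tail k (- M + c) (- M) n)//; last by right; split; lra.
by rewrite (@oint_tail k M (M + c) n)//; [rewrite add0r addr0|left; split; lra].
Qed.

(** Stands for the integral over R^3 of functions supported in the cube. As a [cfunctional] it may
    be differentiated in parameters and exchanged with spherical means; [Rintegral_vanish]
    identifies it with the Lebesgue integral. *)
Definition box (N : R) (k : space -> R) : R :=
  oint (- N) N (fun a => oint (- N) N (fun b => oint (- N) N (fun c => k (a, b, c)))).

Lemma box_cfunctional N : cfunctional (box N).
Proof.
exact: (cfunctional_comp (cfunctional_comp (oint_cfunctional (- N) N)
  (oint_cfunctional (- N) N)) (oint_cfunctional (- N) N)).
Qed.

Definition vanish (n : R) (k : space -> R) : Prop :=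
  forall x i, n <= `|coord i x| -> k x = 0.

Section slices.
Variables (k : space -> R) (N : R).
Hypothesis ck : continuous k.

Lemma box_slice3 a b : continuous (fun c => k (a, b, c)).
Proof. by apply: (@continuous_compose _ _ _ k (fun c => (a, b, c))) => //; cont. Qed.

Lemma box_slice2 a : continuous (fun b => oint (- N) N (fun c => k (a, b, c))).
Proof.
apply: (@oint_continuous _ _ (fun _ => - N) (fun _ => N) (fun z : R * R => k (a, z.1, z.2)));
  try exact: continuous_cst.
by apply: (@continuous_compose _ _ _ k (fun z : R * R => (a, z.1, z.2))) => //; cont.
Qed.

Lemma box_slice1 :
  continuous (fun a => oint (- N) N (fun b => oint (- N) N (fun c => k (a, b, c)))).
Proof.
apply: (@oint_continuous _ _ (fun _ => - N) (fun _ => N)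
  (fun z : R * R => oint (- N) N (fun c => k (z.1, z.2, c)))); try exact: continuous_cst.
apply: (@oint_continuous _ _ (fun _ => - N) (fun _ => N)
  (fun z : (R * R) * R => k (z.1.1, z.1.2, z.2))); try exact: continuous_cst.
by apply: (@continuous_compose _ _ _ k (fun z : R * R * R => (z.1.1, z.1.2, z.2))) => //; cont.
Qed.
End slices.

Lemma box_extend k n N M : continuous k -> vanish n k -> n <= N -> n <= M ->
  box N k = box M k.
Proof.
move=> ck k0 nN nM; rewrite /box.
have E3 a b : oint (- N) N (fun c => k (a, b, c)) = oint (- M) M (fun c => k (a, b, c)).
  apply: (@oint_extend _ n) => //; first exact: box_slice3.
  by move=> x nx; apply: (k0 _ i2).
have E2 a : oint (- N) N (fun b => oint (- N) N (fun c => k (a, b, c))) =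
    oint (- M) M (fun b => oint (- M) M (fun c => k (a, b, c))).
  under eq_fun do rewrite E3.
  apply: (@oint_extend _ n) => //; first exact: box_slice2.
  by move=> x nx; apply: oint_eq0 => s _; apply: (k0 _ i1).
under eq_fun do rewrite E2.
apply: (@oint_extend _ n) => //; first exact: box_slice1.
by move=> x nx; apply: oint_eq0 => s _; apply: oint_eq0 => s' _; apply: (k0 _ i0).
Qed.

Lemma box_translate k n M (v : space) : continuous k -> vanish n k ->
  (forall i, `|coord i v| <= M - n) ->
  box M (fun x => k (x + v)) = box M k.
Proof.
case: v => [[v1 v2] v3] ck k0 Hv; rewrite /box.
have E3 a b : oint (- M) M (fun c => k ((a, b, c) + (v1, v2, v3))) =
    oint (- M) M (fun c => k (a + v1, b + v2, c)).
  apply: (@oint_translate (fun c => k (a + v1, b + v2, c)) n) => //.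
  - exact: box_slice3.
  - by move=> x nx; apply: (k0 _ i2).
  - exact: (Hv i2).
have E2 a : oint (- M) M (fun b => oint (- M) M (fun c => k ((a, b, c) + (v1, v2, v3)))) =
    oint (- M) M (fun b => oint (- M) M (fun c => k (a + v1, b, c))).
  under eq_fun do rewrite E3.
  apply: (@oint_translate (fun b => oint (- M) M (fun c => k (a + v1, b, c))) n) => //.
  - exact: box_slice2.
  - by move=> x nx; apply: oint_eq0 => s _; apply: (k0 _ i1).
  - exact: (Hv i1).
under eq_fun do rewrite E2.
apply: (@oint_translate (fun a => oint (- M) M (fun b => oint (- M) M (fun c => k (a, b, c)))) n) => //.
- exact: box_slice1.
- by move=> x nx; apply: oint_eq0 => s _; apply: oint_eq0 => s' _; apply: (k0 _ i0).
- exact: (Hv i0).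
Qed.

Lemma coord_sphere (w : space) i : sqn w = 1 -> `|coord i w| <= 1.
Proof.
rewrite /sqn => w1; rewrite -[leRHS]normr1 -ler_sqr// ?nnegrE// !real_normK ?num_real//.
have := sqr_ge0 w.1.1; have := sqr_ge0 w.1.2; have := sqr_ge0 w.2.
by move: i; apply: ord3P; rewrite /coord/= expr1n => *; lra.
Qed.

(** After the mean and the integral are exchanged, each direction w is treated by the translation x
    -> x - tau w, under which the support of psi stays in the box because |tau| <= M - n. The sign
    comes from the factor tau in [kir]. *)
Lemma box_kir_dual (h psi : space -> R) (n M tau : R) :
  continuous h -> continuous psi -> vanish n psi -> `|tau| <= M - n ->
  box M (fun x => kir tau h x * psi x) = - box M (fun x => h x * kir (- tau) psi x).
Proof.
move=> ch cpsi psi0 tM.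
have c1 : continuous (fun z : space * space => psi z.1 * h (z.1 + tau *: z.2)) by cont.
have c2 : continuous (fun z : space * space => h z.1 * psi (z.1 + (- tau) *: z.2)) by cont.
have cs1 x : continuous (fun w : space => h (x + tau *: w)) by cont.
have cs2 x : continuous (fun w : space => psi (x + (- tau) *: w)) by cont.
have cS1 : continuous (fun x => sph (fun w => psi x * h (x + tau *: w))).
  exact: (cfunctional_continuous (@sph_cfunctional R) c1).
have cS2 : continuous (fun x => sph (fun w => h x * psi (x + (- tau) *: w))).
  exact: (cfunctional_continuous (@sph_cfunctional R) c2).
have E1 : (fun x => kir tau h x * psi x) =
    (fun x => tau * sph (fun w => psi x * h (x + tau *: w))).
  apply/funext => x; rewrite /kir (cfunctional_scale (@sph_cfunctional R))//; ring.
have E2 : (fun x => h x * kir (- tau) psi x) =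
    (fun x => - tau * sph (fun w => h x * psi (x + (- tau) *: w))).
  apply/funext => x; rewrite /kir (cfunctional_scale (@sph_cfunctional R))//; ring.
have F1 := cfunctional_scale (box_cfunctional M) tau cS1.
have F2 := cfunctional_scale (box_cfunctional M) (- tau) cS2.
have F3 : box M (fun x => sph (fun w => psi x * h (x + tau *: w))) =
    box M (fun x => sph (fun w => h x * psi (x + (- tau) *: w))).
  rewrite (cfunctional_sph (box_cfunctional M) c1) (cfunctional_sph (box_cfunctional M) c2).
  apply: sph_eq => w w1 /=.
  rewrite -(@box_translate (fun x => psi x * h (x + tau *: w)) n M (- tau *: w)).
  - congr box; apply/funext => x; rewrite [RHS]mulrC; congr (_ * h _).
    by rewrite scaleNr addrNK.
  - by cont.
  - by move=> x i nx; rewrite (psi0 x i)// mul0r.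
  - move=> i; rewrite coordZ normrM normrN; apply: le_trans tM.
    by rewrite ler_piMr//; exact: coord_sphere.
rewrite E1 E2; apply: (etrans F1); apply/esym; apply: (etrans (congr1 -%R F2)).
have G (a b c : R) : b = c -> - (- a * c) = a * b.
  by move=> ->; rewrite mulNr opprK.
exact: (G _ _ _ F3).
Qed.

End box.

Opaque oint sph box.

(** * Duhamel integrals of sources that are C^1 in space *)

Section duhamel.
Context {R : realType}.
Local Notation space := (R * R * R)%type.
Implicit Types (F : R * space -> R).

Definition slice F (t : R) : space -> R := fun x => F (t, x).

(* C^1 in space only, jointly continuous: time derivatives of the source are
   never needed. *)
Definition regular F (dF : 'I_3 -> R * space -> R) : Prop :=
  [/\ continuous F, forall i, continuous (dF i) &
      forall t i x, is_derive x (unit_vec i) (slice F t) (dF i (t, x))].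

Lemma regular_C1 F dF t : regular F dF -> C1 (slice F t) (fun i => slice (dF i) t).
Proof.
move=> [cF cdF dFE]; split=> [i x|i]; first exact: dFE.
by rewrite /slice; cont.
Qed.

(* Duhamel's solution of the wave equation with source F and zero data, and
   its time derivative. *)
Definition duh F (t : R) (x : space) : R :=
  oint 0 t (fun s => kir (t - s) (slice F s) x).

Definition duh' F dF (t : R) (x : space) : R :=
  oint 0 t (fun s => kir' (t - s) (slice F s) (fun i => slice (dF i) s) x).

Lemma kir_joint F : continuous F ->
  continuous (fun z : (R * R) * space => kir z.1.1 (slice F z.1.2) z.2).
Proof.
move=> cF; rewrite /kir /slice; apply: continuous_mul; first by cont.
by apply: (@sph_ray_continuous _ _ (fun z : ((R * R) * space) * space => F (z.1.1.2, z.2))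
  (fun z : (R * R) * space => z.1.1) (fun z => z.2)); cont.
Qed.

Lemma kir'_joint F dF : regular F dF ->
  continuous (fun z : (R * R) * space =>
    kir' z.1.1 (slice F z.1.2) (fun i => slice (dF i) z.1.2) z.2).
Proof.
move=> [cF cdF _]; rewrite /kir' /slice; apply: continuous_add.
  by apply: (@sph_ray_continuous _ _ (fun z : ((R * R) * space) * space => F (z.1.1.2, z.2))
    (fun z : (R * R) * space => z.1.1) (fun z => z.2)); cont.
apply: continuous_mul; first by cont.
apply: (@cfunctional_continuous _ _ _ (@sph_cfunctional R) _
  (fun z : ((R * R) * space) * space =>
    \sum_(i < 3) dF i (z.1.1.2, z.1.2 + z.1.1.1 *: z.2) * coord i z.2)).
apply: continuous_sum => i; have cco := @coord_continuous R.
by cont.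
Qed.

Lemma duh_continuous F : continuous F -> continuous (fun z : R * space => duh F z.1 z.2).
Proof.
move=> cF; apply: (@oint_continuous _ _ (fun _ => 0) (fun z => z.1)
  (fun z : (R * space) * R => kir (z.1.1 - z.2) (slice F z.2) z.1.2)); try by cont.
apply: (@continuous_compose _ _ _ _ (fun z : (R * space) * R =>
  ((z.1.1 - z.2, z.2), z.1.2)) (kir_joint cF)); cont.
Qed.

Lemma duh'_continuous F dF : regular F dF ->
  continuous (fun z : R * space => duh' F dF z.1 z.2).
Proof.
move=> rF; apply: (@oint_continuous _ _ (fun _ => 0) (fun z => z.1)
  (fun z : (R * space) * R => kir' (z.1.1 - z.2) (slice F z.2)
    (fun i => slice (dF i) z.2) z.1.2)); try by cont.
apply: (@continuous_compose _ _ _ _ (fun z : (R * space) * R =>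
  ((z.1.1 - z.2, z.2), z.1.2)) (kir'_joint rF)); cont.
Qed.

Lemma duh_time F dF (t : R) (x : space) : regular F dF ->
  is_derive t 1 (fun t => duh F t x) (duh' F dF t x).
Proof.
move=> rF; case: (rF) => cF _ _.
have := @oint_leibniz R (fun t s => kir (t - s) (slice F s) x)
  (fun t s => kir' (t - s) (slice F s) (fun i => slice (dF i) s) x) t _ _ _.
rewrite subrr kir0 add0r; apply.
- move=> u s; have dk := kir_derive x (u - s) (regular_C1 s rF).
  have ds : is_derive u 1 (fun u => u - s) 1 by der; ring.
  by rewrite -[kir' _ _ _ _]mulr1; exact: (@der_comp _ _ _ (fun u => u - s) u 1 _ _ dk ds).
- by apply: (@continuous_compose _ _ _ _ (fun z : R * R =>
    ((z.1 - z.2, z.2), x)) (kir_joint cF)); cont.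
- by apply: (@continuous_compose _ _ _ _ (fun z : R * R =>
    ((z.1 - z.2, z.2), x)) (kir'_joint rF)); cont.
Qed.

Lemma duh_space F dF t i x : regular F dF ->
  is_derive x (unit_vec i) (duh F t) (duh (dF i) t x).
Proof.
move=> [cF cdF dFE]; apply/is_derive_line0.
have dk (s a : R) (w : space) (tau : R) :
  is_derive a 1 (fun a => F (s, a *: unit_vec i + x + tau *: w))
    (dF i (s, a *: unit_vec i + x + tau *: w)).
  have := (is_derive_line (slice F s) (x + tau *: w) (unit_vec i) a _).1 (dFE s i _).
  by rewrite addrA /slice; under eq_fun do rewrite addrA.
have dkir (s a tau : R) : is_derive a 1 (fun a => kir tau (slice F s) (a *: unit_vec i + x))
    (kir tau (slice (dF i) s) (a *: unit_vec i + x)).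
  rewrite /kir.
  have H : is_derive a 1 (fun a => sph (fun w => slice F s (a *: unit_vec i + x + tau *: w)))
      (sph (fun w => slice (dF i) s (a *: unit_vec i + x + tau *: w))).
    apply: (cfunctional_is_derive sph_cfunctional
      (k := fun a w => slice F s (a *: unit_vec i + x + tau *: w))
      (k' := fun a w => slice (dF i) s (a *: unit_vec i + x + tau *: w))).
    - by move=> b; rewrite /slice; cont.
    - by rewrite /slice; cont.
  by der; ring.
have H := @cfunctional_is_derive R R (oint 0 t) (oint_cfunctional 0 t)
  (fun a s => kir (t - s) (slice F s) (a *: unit_vec i + x))
  (fun a s => kir (t - s) (slice (dF i) s) (a *: unit_vec i + x)) 0 _ _ _.
rewrite scale0r add0r in H; apply: H.
- move=> a; by apply: (@continuous_compose _ _ _ _ (fun s : R =>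
    ((t - s, s), a *: unit_vec i + x)) (kir_joint cF)); cont.
- by apply: (@continuous_compose _ _ _ _ (fun z : R * R =>
    ((t - z.2, z.2), z.1 *: unit_vec i + x)) (kir_joint (cdF i))); cont.
Qed.

Opaque kir kir'.

Section weak.
Variables (F : R * space -> R) (dF : 'I_3 -> R * space -> R).
Hypothesis rF : regular F dF.
Variables (psi : space -> R) (dpsi : 'I_3 -> space -> R) (ddpsi : 'I_3 -> 'I_3 -> space -> R).
Hypotheses (Cpsi : C1 psi dpsi) (Cdpsi : forall i, C1 (dpsi i) (ddpsi i)).
Variables (n N : R).
Hypotheses (nN : n <= N) (psi0 : vanish n psi).

Let lap (x : space) : R := \sum_(i < 3) ddpsi i i x.
Hypothesis lap0 : vanish n lap.

Let cpsi : continuous psi := C1_continuous Cpsi.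

Let cddpsi i j : continuous (ddpsi i j).
Proof. exact: (Cdpsi i).2. Qed.

Let clap : continuous lap.
Proof. by apply: continuous_sum => i; exact: cddpsi. Qed.

(** Since h is only C^1, [kir'] of h cannot be differentiated pointwise. By [box_kir_dual] the
    pairing with psi is moved onto psi, which has two derivatives; there [kir'_derive] gives the
    second derivative, and duality moves the result back to h. *)
Let box_kir'_derive (h : space -> R) dh (tau : R) : C1 h dh ->
  is_derive tau 1 (fun tau => box N (fun x => kir' tau h dh x * psi x))
    (box N (fun x => kir tau h x * lap x)).
Proof.
move=> Ch; have ch := C1_continuous Ch; have cdh := Ch.2.
have rh : regular (fun z : R * space => h z.2) (fun i z => dh i z.2).
  by split; [cont|by move=> i; cont|move=> t i x; exact: Ch.1].
have ckir : continuous (fun z : R * space => kir z.1 h z.2).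
  case: (rh) => ch' _ _.
  by apply: (@continuous_compose _ _ _ _ (fun z : R * space => ((z.1, 0), z.2)) (kir_joint ch')); cont.
have ckir' : continuous (fun z : R * space => kir' z.1 h dh z.2).
  by apply: (@continuous_compose _ _ _ _ (fun z : R * space => ((z.1, 0), z.2)) (kir'_joint rh)); cont.
have cpsi_kir' : continuous (fun z : R * space => kir' z.1 psi dpsi z.2).
  have rp : regular (fun z : R * space => psi z.2) (fun i z => dpsi i z.2).
    split; [cont| |by move=> t i x; exact: Cpsi.1].
    by move=> i; have := Cpsi.2 i => ?; cont.
  by apply: (@continuous_compose _ _ _ _ (fun z : R * space => ((z.1, 0), z.2)) (kir'_joint rp)); cont.
have cpsi_kir : continuous (fun z : R * space => kir z.1 psi z.2).
  have cp : continuous (fun z : R * space => psi z.2) by cont.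
  by apply: (@continuous_compose _ _ _ _ (fun z : R * space => ((z.1, 0), z.2)) (kir_joint cp)); cont.
have clap_kir : continuous (fun z : R * space => kir z.1 lap z.2).
  have cp : continuous (fun z : R * space => lap z.2) by cont.
  by apply: (@continuous_compose _ _ _ _ (fun z : R * space => ((z.1, 0), z.2)) (kir_joint cp)); cont.
have sl (k : R * space -> R) s : continuous k -> continuous (fun x => k (s, x)).
  by move=> ck; apply: (@continuous_compose _ _ _ k (fun x => (s, x))) => //; cont.
(* The larger box has room for spheres of radius up to |tau| + 1, so that the duality holds in a
   neighbourhood of tau and can be differentiated. *)
pose T : R := `|tau| + 1; pose M : R := N + T.
have nM : n <= M by rewrite (le_trans nN)// lerDl addr_ge0.
have TMn : T <= M - n by rewrite /M addrAC lerDr subr_ge0.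
have near_tau : \forall s \near tau, `|s| <= M - n.
  have : \forall s \near tau, `|s| < T.
    by apply: (@cvgr_lt _ _ _ _ (fun x : R => `|x|) `|tau| (cvg_norm cvg_id)); rewrite /T ltrDl.
  by apply: filterS => s /ltW sT; rewrite (le_trans sT)// /M; lra.
have ext (k l : space -> R) : continuous k -> continuous l -> vanish n l ->
    box N (fun x => k x * l x) = box M (fun x => k x * l x).
  move=> ck cl l0; apply: (@box_extend _ _ n) => //; first exact: continuous_mul.
  by move=> x i nx; rewrite (l0 x i)// mulr0.
have dual s : `|s| <= M - n -> box N (fun x => kir s h x * psi x) =
    - box M (fun x => h x * kir (- s) psi x).
  move=> sM; rewrite ext//; last exact: (sl _ s ckir).
  exact: (@box_kir_dual _ _ _ n).
have dual' s : `|s| <= M - n -> box N (fun x => kir s h x * lap x) =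
    - box M (fun x => h x * kir (- s) lap x).
  move=> sM; rewrite ext//; last exact: (sl _ s ckir).
  exact: (@box_kir_dual _ _ _ n).
have D1 (s : R) : is_derive s 1 (fun s => box N (fun x => kir s h x * psi x))
    (box N (fun x => kir' s h dh x * psi x)).
  apply: (cfunctional_is_derive (box_cfunctional N)
    (k := fun s x => kir s h x * psi x) (k' := fun s x => kir' s h dh x * psi x)).
  - by move=> t x; have dk := kir_derive x t Ch; der; ring.
  - by move=> t; apply: continuous_mul; [exact: (sl _ t ckir)|exact: cpsi].
  - by apply: continuous_mul; [exact: ckir'|cont].
have dneg (s : R) : is_derive s 1 (fun s : R => - s) (-1) by der.
have D2 (s : R) : is_derive s 1 (fun s => - box M (fun x => h x * kir (- s) psi x))
    (box M (fun x => h x * kir' (- s) psi dpsi x)).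
  have D : is_derive s 1 (fun s => box M (fun x => h x * kir (- s) psi x))
     (box M (fun x => - (h x * kir' (- s) psi dpsi x))).
    apply: (cfunctional_is_derive (box_cfunctional M)
      (k := fun s x => h x * kir (- s) psi x)
      (k' := fun s x => - (h x * kir' (- s) psi dpsi x))).
    - move=> t x; have dk := @der_comp _ _ _ (fun s => - s) t 1 _ _
        (kir_derive x (- t) Cpsi) (dneg t).
      by der; ring.
    - by move=> t; apply: continuous_mul; [exact: ch|exact: (sl _ (- t) cpsi_kir)].
    - apply: continuous_opp; apply: continuous_mul; first by cont.
      by apply: (@continuous_compose _ _ _ _ (fun z : R * space => (- z.1, z.2)) cpsi_kir'); cont.
  der; rewrite (cfunctional_opp (box_cfunctional M)) ?opprK//.
  by apply: continuous_mul; [exact: ch|exact: (sl _ (- s) cpsi_kir')].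
have D3 (s : R) : is_derive s 1 (fun s => box M (fun x => h x * kir' (- s) psi dpsi x))
    (- box M (fun x => h x * kir (- s) lap x)).
  have D : is_derive s 1 (fun s => box M (fun x => h x * kir' (- s) psi dpsi x))
     (box M (fun x => - (h x * kir (- s) lap x))).
    apply: (cfunctional_is_derive (box_cfunctional M)
      (k := fun s x => h x * kir' (- s) psi dpsi x)
      (k' := fun s x => - (h x * kir (- s) lap x))).
    - move=> t x; have dk := @der_comp _ _ _ (fun s => - s) t 1 _ _
        (kir'_derive Cpsi Cdpsi x (- t)) (dneg t).
      by der; rewrite /lap; ring.
    - by move=> t; apply: continuous_mul; [exact: ch|exact: (sl _ (- t) cpsi_kir')].
    - apply: continuous_opp; apply: continuous_mul; first by cont.
      by apply: (@continuous_compose _ _ _ _ (fun z : R * space => (- z.1, z.2)) clap_kir); cont.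
  apply: der_eq D _; rewrite (cfunctional_opp (box_cfunctional M))//.
  by apply: continuous_mul; [exact: ch|exact: (sl _ (- s) clap_kir)].
have tauM : `|tau| < M - n by apply: lt_le_trans TMn; rewrite ltrDl.
have E : \forall s \near tau, box M (fun x => h x * kir' (- s) psi dpsi x) =
    box N (fun x => kir' s h dh x * psi x).
  have : \forall s \near tau, `|s| < M - n.
    by apply: (@cvgr_lt _ _ _ _ (fun x : R => `|x|) `|tau| (cvg_norm cvg_id)).
  apply: filterS => s sM.
  have D4 : is_derive s 1 (fun s => - box M (fun x => h x * kir (- s) psi x))
      (box N (fun x => kir' s h dh x * psi x)).
    apply: (@near_eq_is_derive _ _ _ (fun s => box N (fun x => kir s h x * psi x))) (D1 s).
    have : \forall u \near s, `|u| < M - n.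
      by apply: (@cvgr_lt _ _ _ _ (fun x : R => `|x|) `|s| (cvg_norm cvg_id)).
    by apply: filterS => u /ltW uM; rewrite dual.
  exact: (is_derive_unique (D2 s) D4).
rewrite (dual' tau (ltW tauM)).
exact: (near_eq_is_derive E (D3 tau)).
Qed.

(** Leibniz' rule for the Duhamel integral paired with psi: the boundary term is the source because
    [kir'] at time 0 is the identity, and the integrand is differentiated by [box_kir'_derive]. *)
Lemma duh'_weak (t : R) :
  is_derive t 1 (fun t => box N (fun x => duh' F dF t x * psi x))
    (box N (fun x => F (t, x) * psi x) + box N (fun x => duh F t x * lap x)).
Proof.
have [cF cdF dFE] := rF.
have ck' : continuous (fun z : (R * R) * space => kir' (z.1.1 - z.1.2) (slice F z.1.2)
    (fun i => slice (dF i) z.1.2) z.2).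
  by apply: (@continuous_compose _ _ _ _ (fun z : (R * R) * space =>
   ((z.1.1 - z.1.2, z.1.2), z.2)) (kir'_joint rF)); cont.
have ck : continuous (fun z : (R * R) * space => kir (z.1.1 - z.1.2) (slice F z.1.2) z.2).
  by apply: (@continuous_compose _ _ _ _ (fun z : (R * R) * space =>
   ((z.1.1 - z.1.2, z.1.2), z.2)) (kir_joint cF)); cont.
pose D1 (t s : R) := box N (fun x => kir' (t - s) (slice F s) (fun i => slice (dF i) s) x * psi x).
pose D2 (t s : R) := box N (fun x => kir (t - s) (slice F s) x * lap x).
have cs' (u s : R) : continuous (fun x => kir' (u - s) (slice F s) (fun i => slice (dF i) s) x).
  by apply: (@continuous_compose _ _ _ _ (fun x : space => ((u, s), x)) ck'); cont.
have E1 u : box N (fun x => duh' F dF u x * psi x) = oint 0 u (D1 u).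
  have c1 : continuous (fun z : space * R =>
    psi z.1 * kir' (u - z.2) (slice F z.2) (fun i => slice (dF i) z.2) z.1).
    apply: continuous_mul; first by cont.
    by apply: (@continuous_compose _ _ _ _ (fun z : space * R => ((u, z.2), z.1)) ck'); cont.
  rewrite /D1 -[RHS](cfunctional_oint 0 u (box_cfunctional N)
    (k := fun z => kir' (u - z.2) (slice F z.2) (fun i => slice (dF i) z.2) z.1 * psi z.1)).
    congr box; apply/funext => x; rewrite /duh' mulrC.
    rewrite -(cfunctional_scale (oint_cfunctional 0 u)).
      by congr oint; apply/funext => s; rewrite mulrC.
    by apply: (@continuous_compose _ _ _ _ (fun s : R => ((u, s), x)) ck'); cont.
  by under eq_fun do rewrite mulrC.
have E2 : box N (fun x => duh F t x * lap x) = oint 0 t (D2 t).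
  have c1 : continuous (fun z : space * R =>
    kir (t - z.2) (slice F z.2) z.1 * lap z.1).
    apply: continuous_mul; last by cont.
    by apply: (@continuous_compose _ _ _ _ (fun z : space * R => ((t, z.2), z.1)) ck); cont.
  rewrite /D2 -[RHS](cfunctional_oint 0 t (box_cfunctional N) c1).
  congr box; apply/funext => x; rewrite /duh mulrC.
  rewrite -(cfunctional_scale (oint_cfunctional 0 t)).
    by congr oint; apply/funext => s; rewrite mulrC.
  by apply: (@continuous_compose _ _ _ _ (fun s : R => ((t, s), x)) ck); cont.
under eq_fun do rewrite E1.
rewrite E2.
have -> : box N (fun x => F (t, x) * psi x) = D1 t t.
  by rewrite /D1 subrr; congr box; apply/funext => x; rewrite kir'0.
apply: oint_leibniz.
- move=> u s; rewrite /D1 /D2.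
  have ds : is_derive u 1 (fun u => u - s) 1 by der; ring.
  have := @der_comp _ _ _ (fun u => u - s) u 1 _ _
    (box_kir'_derive (u - s) (regular_C1 s rF)) ds.
  by rewrite mulr1.
- apply: (@cfunctional_continuous _ _ _ (box_cfunctional N) _
    (fun z : (R * R) * space => kir' (z.1.1 - z.1.2) (slice F z.1.2)
    (fun i => slice (dF i) z.1.2) z.2 * psi z.2)).
  by cont.
- apply: (@cfunctional_continuous _ _ _ (box_cfunctional N) _
    (fun z : (R * R) * space => kir (z.1.1 - z.1.2) (slice F z.1.2) z.2 * lap z.2)).
  by cont.
Qed.

End weak.
End duhamel.

Transparent oint sph box kir kir'.

(** * Spherical means of radial functions *)
Section powers.
Context {R : realType}.

Lemma continuous_powR_comp (T : topologicalType) (f : T -> R) (a : R) :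
  continuous f -> (forall x, 0 < f x) -> continuous (fun x => f x `^ a).
Proof.
move=> cf f0 x.
have cp : {for f x, continuous (fun y : R => y `^ a)}.
  have [dv _] := is_derive1_powR a (f0 x).
  by apply/differentiable_continuous/derivable1_diffP.
exact: (@continuous_comp _ _ _ f (fun y : R => y `^ a) x (cf x) cp).
Qed.

Lemma der_powR (V : normedModType R) (f : V -> R) x v (a b : R) : 0 < f x ->
  is_derive x v f b -> is_derive x v (fun x => f x `^ a) (a * f x `^ (a - 1) * b).
Proof. by move=> f0 df; exact: (der_comp (is_derive1_powR a f0) df). Qed.

Lemma der_sqrt (V : normedModType R) (f : V -> R) x v (b : R) : 0 < f x ->
  is_derive x v f b -> is_derive x v (fun x => Num.sqrt (f x)) ((2 * Num.sqrt (f x))^-1 * b).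
Proof. by move=> f0 df; exact: (der_comp (is_derive1_sqrt f0) df). Qed.

Lemma der_inv (V : normedModType R) (f : V -> R) x v (b : R) : f x != 0 ->
  is_derive x v f b -> is_derive x v (fun x => (f x)^-1) (- (f x) ^- 2 * b).
Proof.
move=> f0 /is_derive_line0 df; apply/is_derive_line0.
apply: der_eq; first by apply: is_deriveV df; rewrite scale0r add0r.
by rewrite /= scale0r add0r.
Qed.

Lemma le_powR_base (a b r : R) : 0 <= a -> a <= b -> 0 <= r -> a `^ r <= b `^ r.
Proof.
move=> a0 ab r0; apply: ge0_ler_powR => //; rewrite nnegrE//.
exact: le_trans ab.
Qed.

Lemma le_powRN_base (a b r : R) : 0 < a -> a <= b -> 0 <= r ->
  b `^ (- r) <= a `^ (- r).
Proof.
move=> a0 ab r0; rewrite !powRN lef_pV2 ?posrE ?powR_gt0//; last exact: lt_le_trans ab.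
by apply: le_powR_base => //; exact: ltW.
Qed.

End powers.

(** * A smooth increasing profile with an explicit derivative *)

Section profile.
Context {R : realType}.

(** The Japanese bracket, a smooth substitute for |b|. *)
Definition jap (b : R) : R := Num.sqrt (1 + b ^+ 2).

Lemma sq1_gt0 (b : R) : 0 < 1 + b ^+ 2.
Proof. by rewrite ltr_pwDl// sqr_ge0. Qed.

Lemma jap_gt0 b : 0 < jap b.
Proof. by rewrite sqrtr_gt0 sq1_gt0. Qed.

Lemma jap_sqr b : jap b ^+ 2 = 1 + b ^+ 2.
Proof. by rewrite sqr_sqrtr// ltW// sq1_gt0. Qed.

Lemma jap_gt_norm b : `|b| < jap b.
Proof.
rewrite -(@ltr_pXn2r _ 2)// ?nnegrE ?(ltW (jap_gt0 _))//.
by rewrite jap_sqr real_normK ?num_real// ltrDr.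
Qed.

Lemma jap_le b : jap b <= 1 + `|b|.
Proof.
rewrite -(@ler_pXn2r _ 2)// ?nnegrE ?(ltW (jap_gt0 _))//.
rewrite jap_sqr -(real_normK (num_real b)); have := normr_ge0 b; nra.
Qed.

Lemma jap_even b : jap (- b) = jap b.
Proof. by rewrite /jap sqrrN. Qed.

Lemma jap_continuous : continuous jap.
Proof. by rewrite /jap; cont. Qed.

Lemma der_jap (b : R) : is_derive b 1 jap (b / jap b).
Proof.
have ds : is_derive b 1 (fun b => 1 + b ^+ 2) (2 * b) by der; ring.
have D : is_derive b 1 jap _ := @der_sqrt R _ (fun b : R => 1 + b ^+ 2) b 1 _ (sq1_gt0 b) ds.
apply: der_eq D _.
by rewrite -/(jap b); field; rewrite gt_eqF// jap_gt0.
Qed.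

(** A smooth increasing function which tends to 1 at -oo and grows like 2 b at +oo: its negative
    powers are bounded everywhere and decay on the right only. *)
Definition ramp (b : R) : R := 1 + (b + jap b).

Lemma ramp_gt1 b : 1 < ramp b.
Proof.
rewrite ltrDl; have := jap_gt_norm b; have := ler_norm (- b); rewrite normrN; lra.
Qed.

Variable d : R.
Hypothesis d0 : 0 < d.

(* A bounded increasing function whose derivative [gee] decays like b^(-1-d)
   at +oo. *)
Definition Gee (b : R) : R := - ramp b `^ (- d).
Definition gee (b : R) : R := d * ramp b `^ (- d - 1) * (1 + b / jap b).
Definition gee' (b : R) : R :=
  d * ((- d - 1) * ramp b `^ (- d - 1 - 1) * (1 + b / jap b)) * (1 + b / jap b) +
  d * ramp b `^ (- d - 1) * ((jap b)^-1 - b ^+ 2 / jap b ^+ 3).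

Let jap0 b : jap b != 0. Proof. by rewrite gt_eqF// jap_gt0. Qed.
Let ramp0 b : 0 < ramp b. Proof. exact: lt_trans (ramp_gt1 b). Qed.

Lemma der_ramp (b : R) : is_derive b 1 ramp (1 + b / jap b).
Proof. by have dj := der_jap b; rewrite /ramp; der; ring. Qed.

Lemma der_Gee (b : R) : is_derive b 1 Gee (gee b).
Proof.
have dr := der_powR (- d) (ramp0 b) (der_ramp b).
by rewrite /Gee; der; rewrite /gee; ring.
Qed.

Lemma der_gee (b : R) : is_derive b 1 gee (gee' b).
Proof.
have dr := der_powR (- d - 1) (ramp0 b) (der_ramp b).
have dj := der_inv (jap0 b) (der_jap b).
rewrite /gee; der; rewrite /gee'; field.
exact: jap0.
Qed.

Lemma ramp_continuous : continuous ramp.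
Proof. by have cj := jap_continuous; rewrite /ramp; cont. Qed.

Lemma japV_continuous : continuous (fun b => (jap b)^-1).
Proof. by apply: continuous_inv; [exact: jap_continuous|exact: jap0]. Qed.

Lemma gee_continuous : continuous gee.
Proof. exact: is_derive_continuous der_gee. Qed.

Lemma Gee_continuous : continuous Gee.
Proof. exact: is_derive_continuous der_Gee. Qed.

Lemma gee'_continuous : continuous gee'.
Proof.
have cj := japV_continuous.
have c1 := @continuous_powR_comp _ _ _ (- d - 1) ramp_continuous ramp0.
have c2 := @continuous_powR_comp _ _ _ (- d - 1 - 1) ramp_continuous ramp0.
have -> : gee' = (fun b =>   d * ((- d - 1) * ramp b `^ (- d - 1 - 1) * (1 + b * (jap b)^-1)) * (1 + b * (jap b)^-1) +
  d * ramp b `^ (- d - 1) * ((jap b)^-1 - b ^+ 2 * (jap b)^-1 ^+ 3)).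
  by apply/funext => b; rewrite /gee' exprVn.
by cont.
Qed.

Lemma jap_ratio b : -1 <= b / jap b <= 1.
Proof.
rewrite ler_pdivlMr ?jap_gt0// ler_pdivrMr ?jap_gt0// mul1r mulN1r.
by rewrite -ler_norml ltW// jap_gt_norm.
Qed.

Lemma gee_ge0 b : 0 <= gee b.
Proof.
rewrite /gee !mulr_ge0 ?powR_ge0 ?(ltW d0)//.
by have /andP[] := jap_ratio b; lra.
Qed.

Lemma Gee_bound b : -1 <= Gee b <= 0.
Proof.
rewrite /Gee oppr_le0 powR_ge0 andbT lerN2.
have := le_powRN_base ltr01 (ltW (ramp_gt1 b)) (ltW d0).
by rewrite powR1.
Qed.

Lemma Gee_osc a b : Gee a - Gee b <= 1.
Proof. by have /andP[] := Gee_bound a; have /andP[] := Gee_bound b; lra. Qed.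

Lemma gee_lower b : -2 <= b -> (4 + b) `^ (- (d + 1)) <= 10 * 2 `^ (d + 1) / d * gee b.
Proof.
move=> b2; have b4 : 0 < 4 + b by lra.
(* The worst case is b = -2, where the right-hand side is 1 - 2/sqrt 5, slightly more than 1/10. *)
have H1 : 10^-1 <= 1 + b / jap b.
  have [b0|b0] := leP 0 b.
    have : 0 <= b / jap b by rewrite divr_ge0// ltW// jap_gt0.
    lra.
  have : - (9 / 10) <= b / jap b.
    rewrite ler_pdivlMr ?jap_gt0// mulNr lerNl.
    rewrite -(@ler_pXn2r _ 2)// ?nnegrE ?mulr_ge0 ?(ltW (jap_gt0 _))//; last by lra.
    rewrite exprMn jap_sqr; nra.
  lra.
have H2 : ramp b <= 2 * (4 + b).
  rewrite /ramp; have := jap_le b; have [b0|b0] := leP 0 b.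
    by rewrite ger0_norm//; lra.
  by rewrite ltr0_norm//; lra.
have H3 : (2 * (4 + b)) `^ (- (d + 1)) <= ramp b `^ (- d - 1).
  rewrite -opprD; apply: le_powRN_base; [exact: ramp0|exact: H2|].
  by rewrite addr_ge0// ltW.
have P2 : 0 < 2 `^ (d + 1) :> R by rewrite powR_gt0.
have P4 : 0 < (4 + b) `^ (- (d + 1)) by rewrite powR_gt0.
rewrite powRM ?(ltW b4)// powRN in H3.
have -> : 10 * 2 `^ (d + 1) / d * gee b =
    2 `^ (d + 1) * ramp b `^ (- d - 1) * (10 * (1 + b / jap b)).
  by rewrite /gee; field; rewrite jap0 gt_eqF.
have : (4 + b) `^ (- (d + 1)) <= 2 `^ (d + 1) * ramp b `^ (- d - 1).
  by rewrite -ler_pdivrMl.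
have : 1 <= 10 * (1 + b / jap b) by lra.
move: (2 `^ _ * _) (10 * _) => u v v1 u1.
apply: (le_trans u1); rewrite ler_peMr//.
by apply: le_trans u1; exact: ltW.
Qed.

End profile.

Section radial.
Context {R : realType}.
Local Notation space := (R * R * R)%type.

Lemma C1_comp (f : space -> R) df (h : R -> R) (h' : space -> R) : C1 f df ->
  (forall x, is_derive (f x) 1 h (h' x)) -> continuous h' ->
  C1 (fun x => h (f x)) (fun i x => h' x * df i x).
Proof.
move=> [f1 f2] dh ch'; split=> [i x|i]; last by cont.
exact: der_comp.
Qed.

Lemma sqn_ge0 (x : space) : 0 <= sqn x.
Proof. by rewrite /sqn !addr_ge0// sqr_ge0. Qed.

Lemma sqnE (x : space) : sqn x = coord i0 x ^+ 2 + coord i1 x ^+ 2 + coord i2 x ^+ 2.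
Proof. by []. Qed.

Lemma C1_sqn : C1 (sqn : space -> R) (fun i x => 2 * coord i x).
Proof.
have c := @C1_coord R.
have H := C1_add (C1_add (C1_mul (c i0) (c i0)) (C1_mul (c i1) (c i1)))
  (C1_mul (c i2) (c i2)).
have E : (fun x : space => coord i0 x * coord i0 x + coord i1 x * coord i1 x +
  coord i2 x * coord i2 x) = sqn by apply/funext => x; rewrite sqnE !expr2.
rewrite E in H; case: H => H1 H2; split=> [i x|i].
  apply: der_eq (H1 i x) _; move: i {H1 H2}; apply: ord3P => /=; rewrite ?mulr0n ?mulr1n; ring.
by have cc := @coord_continuous R; cont.
Qed.

(* m is radial: its gradient is a multiple of the position vector *)
Definition C1_radial (m M : space -> R) : Prop :=
  continuous M /\ C1 m (fun i x => M x * coord i x).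

Section rotation_invariance.
Variables (m M : space -> R) (tau : R).
Hypothesis Cm : C1_radial m M.

(** When the centre moves along a rotation of the plane (i, j), the derivative of the mean is,
    because the gradient of m is radial, exactly the mean of the rotation derivative of w -> m(c +
    tau w), which vanishes by [sph_rotation]. *)
Lemma sph_rotate (i j : 'I_3) (c : R -> space) (a b : R) :
  (i, j) \in [:: (i0, i1); (i0, i2); (i1, i2)] ->
  (forall (t : R) k, is_derive t 1 (fun t => coord k (c t))
    (if k == i then coord j (c t) else if k == j then - coord i (c t) else 0)) ->
  continuous c ->
  sph (fun w => m (c a + tau *: w)) = sph (fun w => m (c b + tau *: w)).
Proof.
move=> ij dc cc; case: Cm => cM Cm1; have cm := C1_continuous Cm1.
have cco := @coord_continuous R.
pose dA (t : R) (w : space) : R := M (c t + tau *: w) *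
   (coord i (c t + tau *: w) * coord j (c t) - coord j (c t + tau *: w) * coord i (c t)).
have dm (t : R) w : is_derive t 1 (fun t => m (c t + tau *: w)) (dA t w).
  apply: der_eq (@C1_curve _ m _ (fun t => c t + tau *: w) (fun k =>
     if k == i then coord j (c t) else if k == j then - coord i (c t) else 0) t Cm1 _) _.
    move=> k; have dct := dc t k.
    have -> : (fun t => coord k (c t + tau *: w)) = (fun t => coord k (c t) + coord k (tau *: w)).
      by apply/funext => u; rewrite coordD.
    by der; ring.
  rewrite sum3 /dA; move: ij; rewrite !inE => /or3P[]/eqP[-> ->]/=; ring.
have cdA : continuous (fun z : R * space => dA z.1 z.2) by rewrite /dA; cont.
have D (t : R) : is_derive t 1 (fun t => sph (fun w => m (c t + tau *: w))) 0.
  have D1 : is_derive t 1 (fun t => sph (fun w => m (c t + tau *: w))) (sph (dA t)).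
    apply: (cfunctional_is_derive sph_cfunctional
      (k := fun t w => m (c t + tau *: w)) (k' := dA)) => //.
    by move=> u; cont.
  apply: der_eq D1 _.
  have := sph_rotation (C1_affine (c t) tau Cm1) ij => /=.
  have cdt : continuous (dA t).
    by apply: (@continuous_compose _ _ _ _ (fun w : space => (t, w)) cdA); cont.
  move=> R0; rewrite -[RHS]R0; apply: sph_eq => w _; rewrite /dA !coordD !coordZ.
  by ring.
exact: (is_derive_0_is_cst a b D).
Qed.

Lemma polar_angle (a b : R) : exists t,
  a = Num.sqrt (a ^+ 2 + b ^+ 2) * sin t /\ b = Num.sqrt (a ^+ 2 + b ^+ 2) * cos t.
Proof.
set r := Num.sqrt _.
have s0 : 0 <= a ^+ 2 + b ^+ 2 by rewrite addr_ge0// sqr_ge0.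
have rE : r ^+ 2 = a ^+ 2 + b ^+ 2 by rewrite sqr_sqrtr.
have r0 : 0 <= r by exact: sqrtr_ge0.
have [rz|rp] := eqVneq r 0.
  move: rE; rewrite rz expr0n => /esym/eqP; rewrite paddr_eq0 ?sqr_ge0//.
  rewrite !sqrf_eq0 => /andP[/eqP -> /eqP ->].
  by exists 0; rewrite !mul0r.
have {rp}r0 : 0 < r by rewrite lt_def rp.
have br : -1 <= b / r <= 1.
  rewrite ler_pdivlMr// ler_pdivrMr// mul1r mulN1r -ler_norml.
  rewrite -(@ler_pXn2r _ 2)// ?nnegrE ?(ltW r0)//.
  by rewrite real_normK ?num_real// rE lerDr sqr_ge0.
have cE : cos (acos (b / r)) = b / r by rewrite acosK// in_itv.
have sE : sin (acos (b / r)) ^+ 2 = (a / r) ^+ 2.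
  have := cos2Dsin2 (acos (b / r)); rewrite cE => H.
  have -> : sin (acos (b / r)) ^+ 2 = 1 - (b / r) ^+ 2 by rewrite -H; ring.
  rewrite !expr_div_n rE; field; rewrite -rE.
  by rewrite expf_neq0// gt_eqF.
move/eqP: sE; rewrite eqf_sqr => /orP[]/eqP sE.
  exists (acos (b / r)); rewrite sE cE.
  by split; rewrite mulrCA divff ?mulr1// gt_eqF.
exists (- acos (b / r)); rewrite sinN cosN sE cE opprK.
by split; rewrite mulrCA divff ?mulr1// gt_eqF.
Qed.

(** Two plane rotations bring x to the third axis. This is the axis from which the polar angle of
    [om] is measured, so that the mean becomes an integral in that angle alone by [sph_zonal]. *)
Lemma sph_axis (x : space) :
  sph (fun w => m (x + tau *: w)) =
  sph (fun w => m ((0, 0, Num.sqrt (sqn x)) + tau *: w)).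
Proof.
case: x => [[x1 x2] x3].
have [t [E1 E2]] := polar_angle x1 x2; set r := Num.sqrt _ in E1 E2.
have E3 := @sph_rotate i0 i1 (fun t => (r * sin t, r * cos t, x3)) t (pi / 2).
rewrite sin_pihalf cos_pihalf mulr0 mulr1 -E1 -E2 in E3.
have {}E3 := E3 isT.
have {E3} : sph (fun w => m ((x1, x2, x3) + tau *: w)) =
    sph (fun w => m ((r, 0, x3) + tau *: w)).
  apply: E3; last by cont.
  move=> s; apply: ord3P; rewrite /coord/=; der; ring.
move=> ->.
have [u [F1 F2]] := polar_angle r x3; set r' := Num.sqrt _ in F1 F2.
have F3 := @sph_rotate i0 i2 (fun t => (r' * sin t, 0, r' * cos t)) u 0.
rewrite sin0 cos0 mulr0 mulr1 -F1 -F2 in F3.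
have {}F3 := F3 isT.
have {F3} : sph (fun w => m ((r, 0, x3) + tau *: w)) =
    sph (fun w => m ((0, 0, r') + tau *: w)).
  apply: F3; last by cont.
  move=> s; apply: ord3P; rewrite /coord/=; der; ring.
move=> ->.
suff -> : r' = Num.sqrt (sqn (x1, x2, x3)) by [].
by rewrite /r' sqr_sqrtr ?addr_ge0 ?sqr_ge0.
Qed.

End rotation_invariance.

Lemma sph_zonal (k : space -> R) (h : R -> R) : continuous h ->
  (forall a b, k (om a b) = h a) ->
  sph k = 2^-1 * oint 0 pi (fun a => sin a * h a).
Proof.
move=> ch kE; rewrite /sph.
have -> : (fun a => oint 0 (2 * pi) (fun b => sin a * k (om a b))) =
    (fun a => (2 * pi) * (sin a * h a)).
  by apply/funext => a; under eq_fun do rewrite kE; rewrite oint_cst subr0 mulrC.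
rewrite (cfunctional_scale (oint_cfunctional 0 pi)); last by cont.
rewrite mulrA; congr (_ * _).
have : pi != 0 :> R by rewrite gt_eqF// pi_gt0.
by move: (pi : R) => P P0; field.
Qed.

End radial.

(** * John's weighted estimate *)
Section euclidean.
Context {R : realType}.
Local Notation space := (R * R * R)%type.

Lemma C1_ext (f : space -> R) df df' : C1 f df -> (forall i x, df i x = df' i x) -> C1 f df'.
Proof.
by move=> H E; have <- : df = df' by apply/funext => i; apply/funext => x; exact: E.
Qed.

Lemma enorm_sqr (x : space) : enorm x ^+ 2 = sqn x.
Proof. by rewrite sqr_sqrtr// sqn_ge0. Qed.

Lemma enorm_ge0 (x : space) : 0 <= enorm x.
Proof. exact: sqrtr_ge0. Qed.

Definition dot (x w : space) : R := x.1.1 * w.1.1 + x.1.2 * w.1.2 + x.2 * w.2.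

Lemma dot_le (x w : space) : sqn w = 1 -> `|dot x w| <= enorm x.
Proof.
move=> w1; rewrite -(@ler_pXn2r _ 2)// ?nnegrE ?enorm_ge0//.
rewrite real_normK ?num_real// enorm_sqr -[leRHS]mulr1 -w1 -subr_ge0.
have -> : sqn x * sqn w - dot x w ^+ 2 = (x.1.1 * w.1.2 - x.1.2 * w.1.1) ^+ 2 +
  (x.1.1 * w.2 - x.2 * w.1.1) ^+ 2 + (x.1.2 * w.2 - x.2 * w.1.2) ^+ 2.
  by rewrite /sqn /dot; ring.
by rewrite !addr_ge0// sqr_ge0.
Qed.

Lemma sqn_ray (x w : space) (tau : R) : sqn w = 1 ->
  sqn (x + tau *: w) = sqn x + tau ^+ 2 + 2 * tau * dot x w.
Proof.
move=> w1; have -> : tau ^+ 2 = tau ^+ 2 * sqn w by rewrite w1 mulr1.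
have -> : sqn (x + tau *: w) = (x.1.1 + tau * w.1.1) ^+ 2 +
  (x.1.2 + tau * w.1.2) ^+ 2 + (x.2 + tau * w.2) ^+ 2 by [].
by rewrite /sqn /dot; ring.
Qed.

Lemma enorm_ray_ge (x w : space) (tau : R) : sqn w = 1 -> 0 <= tau ->
  `|enorm x - tau| <= enorm (x + tau *: w).
Proof.
move=> w1 t0; rewrite -(@ler_pXn2r _ 2)// ?nnegrE ?enorm_ge0//.
rewrite real_normK ?num_real// enorm_sqr sqn_ray// -enorm_sqr.
have := dot_le x w1; rewrite ler_norml => /andP[d1 _].
have : 0 <= tau * (dot x w + enorm x) by apply: mulr_ge0 => //; lra.
by rewrite sqrrB; lra.
Qed.

(** Unlike [enorm] it is smooth at the origin, as the rotation argument requires, and it exceeds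
    [enorm] by at most 1. *)
Definition japx (x : space) : R := Num.sqrt (1 + sqn x).

Lemma japxE x : japx x = jap (enorm x).
Proof. by rewrite /jap enorm_sqr. Qed.

Lemma japx_gt0 x : 0 < japx x.
Proof. by rewrite japxE jap_gt0. Qed.

Lemma japx_neq0 x : japx x != 0.
Proof. by rewrite gt_eqF// japx_gt0. Qed.

Lemma japx_ge_enorm x : enorm x <= japx x.
Proof. by rewrite japxE; apply: le_trans (ler_norm _) _; exact/ltW/jap_gt_norm. Qed.

Lemma japx_le x : japx x <= 1 + enorm x.
Proof. by rewrite japxE (le_trans (jap_le _))// ger0_norm// enorm_ge0. Qed.

Lemma sqn_continuous : continuous (sqn : space -> R).
Proof. exact: C1_continuous C1_sqn. Qed.

Lemma enorm_continuous : continuous (enorm : space -> R).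
Proof. by have cs := sqn_continuous; rewrite /enorm; cont. Qed.

Lemma japx_continuous : continuous japx.
Proof. by have cs := sqn_continuous; rewrite /japx; cont. Qed.

Lemma japxV_continuous : continuous (fun x => (japx x)^-1).
Proof. by apply: continuous_inv; [exact: japx_continuous|exact: japx_neq0]. Qed.

Lemma C1_japx : C1 japx (fun i x => (japx x)^-1 * coord i x).
Proof.
have cV := japxV_continuous.
have H : C1 japx (fun i x => (2 * japx x)^-1 * (2 * coord i x)).
  apply: (@C1_comp _ sqn _ (fun y => Num.sqrt (1 + y))) => //.
  - exact: C1_sqn.
  - move=> x; have p1 : 0 < 1 + sqn x by rewrite ltr_pwDl// sqn_ge0.
    have d1 : is_derive (sqn x) 1 (fun y : R => 1 + y) 1 by der; ring.
    by have := @der_sqrt _ _ (fun y : R => 1 + y) _ _ _ p1 d1; rewrite mulr1.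
  - have -> : (fun x => (2 * japx x)^-1) = (fun x => 2^-1 * (japx x)^-1).
      by apply/funext => x; rewrite invfM.
    by cont.
by apply: C1_ext H _ => i x; field; exact: japx_neq0.
Qed.

Lemma sph_abs_le (k l : space -> R) : continuous k -> continuous l ->
  (forall w, sqn w = 1 -> `|k w| <= l w) -> `|sph k| <= sph l.
Proof.
move=> ck cl kl; rewrite ler_norml -(cfunctional_opp (@sph_cfunctional R))//.
apply/andP; split; apply: sph_le => //; try exact: continuous_opp.
  by move=> w /kl; rewrite ler_norml => /andP[].
by move=> w /kl; rewrite ler_norml => /andP[].
Qed.

Lemma oint_abs_le (k l : R -> R) (a b : R) : continuous k -> continuous l ->
  a <= b -> (forall x, a <= x <= b -> `|k x| <= l x) -> `|oint a b k| <= oint a b l.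
Proof.
move=> ck cl ab kl; rewrite ler_norml -(cfunctional_opp (oint_cfunctional a b))//.
apply/andP; split; apply: oint_le => //; try exact: continuous_opp.
  by move=> w /kl; rewrite ler_norml => /andP[].
by move=> w /kl; rewrite ler_norml => /andP[].
Qed.

End euclidean.

(** * Spherical means in closed form *)

Section spherical_mean_of_profile.
Context {R : realType}.
Local Notation space := (R * R * R)%type.
Variable d : R.
Hypothesis d0 : 0 < d.

(** The factor 1/japx is the one that turns the integrand of the spherical mean into an exact
    derivative in the polar angle. *)
Definition mm (s : R) (y : space) : R := gee d (s - japx y) * (japx y)^-1.

Lemma mm_radial s : exists M, C1_radial (mm s) M.
Proof.
pose h' (x : space) : R := - gee' d (s - japx x) * (japx x)^-1 -
  gee d (s - japx x) * (japx x)^-1 ^+ 2.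
have cV := japxV_continuous (R := R); have cj := japx_continuous (R := R).
have cg := @gee_continuous R d; have cg' := @gee'_continuous R d.
have ch' : continuous h' by rewrite /h'; cont.
exists (fun x => h' x * (japx x)^-1); split; first by cont.
have H : C1 (mm s) (fun i x => h' x * ((japx x)^-1 * coord i x)).
  apply: (@C1_comp _ japx _ (fun l => gee d (s - l) * l^-1)) => //.
  - exact: C1_japx.
  - move=> x.
    have ds : is_derive (japx x) 1 (fun l : R => s - l) (-1) by der; ring.
    have dg := @der_comp _ _ _ (fun l : R => s - l) _ _ _ _ (der_gee d (s - japx x)) ds.
    have di := @der_inv _ _ (fun l : R => l) _ _ _ (japx_neq0 x) (der_id _).
    by der; rewrite /h' exprVn; ring.
by apply: C1_ext H _ => i x; rewrite mulrA.
Qed.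

Lemma mm_continuous s : continuous (mm s).
Proof. by have [M [_ H]] := mm_radial s; exact: C1_continuous H. Qed.

Lemma mm_ge0 s y : 0 <= mm s y.
Proof. by rewrite /mm mulr_ge0 ?gee_ge0// invr_ge0 ltW// japx_gt0. Qed.

(** With the centre on the axis at height r, [japx] at polar angle a equals lam(a) = (1 + r^2 +
    tau^2 + 2 r tau cos a)^(1/2), and lam' = - r tau sin a / lam. Hence r tau sin a gee(s - lam)/lam
    is the derivative of Gee(s - lam); at a = pi and a = 0, lam is jap(r - tau) and jap(r + tau). *)
Lemma sph_mm (s tau : R) (x : space) :
  enorm x * tau * sph (fun w => mm s (x + tau *: w)) =
  2^-1 * (Gee d (s - jap (enorm x - tau)) - Gee d (s - jap (enorm x + tau))).
Proof.
have [M HM] := mm_radial s; rewrite (sph_axis tau HM).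
rewrite -/(enorm x); set r := enorm x.
pose v (a : R) : R := 1 + (r ^+ 2 + tau ^+ 2 + 2 * r * tau * cos a).
have v0 a : 0 < v a.
  rewrite /v ltr_pwDl//.
  have -> : r ^+ 2 + tau ^+ 2 + 2 * r * tau * cos a =
    (r + tau * cos a) ^+ 2 + tau ^+ 2 * (1 - cos a ^+ 2) by ring.
  have c1 : 0 <= 1 - cos a ^+ 2 by rewrite -(cos2Dsin2 a) addrAC subrr add0r sqr_ge0.
  by apply: addr_ge0; [exact: sqr_ge0|exact: mulr_ge0 (sqr_ge0 _) c1].
pose lam (a : R) : R := Num.sqrt (v a).
have lam0 a : lam a != 0 by rewrite gt_eqF// sqrtr_gt0.
have cv : continuous v by rewrite /v; cont.
have clam : continuous lam by rewrite /lam; cont.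
have clamV : continuous (fun a => (lam a)^-1) by exact: continuous_inv.
have cg := @gee_continuous R d.
have ch : continuous (fun a => gee d (s - lam a) * (lam a)^-1) by cont.
rewrite (sph_zonal ch); last first.
  move=> a b; have E : japx ((0, 0, r) + tau *: om a b) = lam a.
    rewrite /japx sqn_ray ?sqn_om// /lam /v; congr (Num.sqrt (_ + _)).
    by rewrite /sqn /dot /om /=; ring.
  by rewrite /mm E.
rewrite mulrCA; congr (_ * _).
rewrite -(cfunctional_scale (oint_cfunctional 0 pi)); last by cont.
have dJ (a : R) : is_derive a 1 (fun a => Gee d (s - lam a))
    (r * tau * (sin a * (gee d (s - lam a) * (lam a)^-1))).
  have dv : is_derive a 1 v (2 * r * tau * (- sin a)) by rewrite /v; der; ring.
  have dl := der_sqrt (v0 a) dv.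
  have dsl : is_derive a 1 (fun a => s - lam a)
     (- ((2 * Num.sqrt (v a))^-1 * (2 * r * tau * (- sin a)))).
    by rewrite /lam; der; ring.
  apply: der_eq (@der_comp _ _ _ (fun a => s - lam a) _ _ _ _ (der_Gee d (s - lam a)) dsl) _.
  by rewrite -/(lam a); field; exact: lam0.
have cJ : continuous (fun a => r * tau * (sin a * (gee d (s - lam a) * (lam a)^-1))) by cont.
rewrite (oint_FTC2 0 pi cJ dJ); congr (Gee d (s - _) - Gee d (s - _)).
  by rewrite /lam /v cospi /jap; congr (Num.sqrt (_ + _)); ring.
by rewrite /lam /v cos0 /jap; congr (Num.sqrt (_ + _)); ring.
Qed.

(** For tau = t - s and r = |x| the two terms of [sph_mm] are [Phi (t - r) s] and [Phi (t + r) s],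
    because [jap] is even. *)
Definition Phi (T s : R) : R := Gee d (s - jap (T - s)).

Lemma Phi_continuous : continuous (fun z : R * R => Phi z.1 z.2).
Proof.
have cj := jap_continuous (R := R); have cG := @Gee_continuous R d.
by rewrite /Phi; cont.
Qed.

Lemma Phi_slice T : continuous (Phi T).
Proof.
by apply: (@continuous_compose _ _ _ _ (fun s : R => (T, s)) Phi_continuous); cont.
Qed.

Lemma slope_bound (a b z r : R) : a - b = z * (2 * r) -> -1 <= z -> 0 <= r ->
  b - a <= 2 * r.
Proof.
move=> E z1 r0; have : 0 <= (z + 1) * (2 * r) by apply: mulr_ge0; lra.
by lra.
Qed.

(* The density g j of -d_T Phi is at most g (1 + j) = d_s Phi, whose integral
   is bounded. *)
Lemma oint_Phi_diff (s0 t r : R) : s0 <= t -> 0 <= r ->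
  oint s0 t (fun s => Phi (t - r) s - Phi (t + r) s) <= 2 * r.
Proof.
move=> st r0.
have cj := jap_continuous (R := R); have cg := @gee_continuous R d.
have cjV := japV_continuous (R := R).
have cP := Phi_slice.
rewrite (cfunctional_sub (oint_cfunctional s0 t))//.
pose Q (T : R) := oint s0 t (Phi T).
pose k' (T s : R) : R := - (gee d (s - jap (T - s)) * ((T - s) * (jap (T - s))^-1)).
pose l (T s : R) : R := gee d (s - jap (T - s)) * (1 + (T - s) * (jap (T - s))^-1).
have cjT : continuous (fun z : R * R => z.1 - z.2) by cont.
have cjj := continuous_compose cj cjT.
have cjjV := continuous_compose cjV cjT.
have ck' : continuous (fun z : R * R => k' z.1 z.2).
  by rewrite /k'; cont.
have cl : continuous (fun z : R * R => l z.1 z.2) by rewrite /l; cont.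
have sl (f : R -> R -> R) T : continuous (fun z : R * R => f z.1 z.2) -> continuous (f T).
  by move=> cf; apply: (@continuous_compose _ _ _ _ (fun s : R => (T, s)) cf); cont.
have dT (T s : R) : is_derive T 1 (fun T => Phi T s) (k' T s).
  have d1 : is_derive T 1 (fun T => T - s) 1 by der; ring.
  have d2 := @der_comp _ _ _ (fun T => T - s) _ _ _ _ (der_jap (T - s)) d1.
  have d3 : is_derive T 1 (fun T => s - jap (T - s)) (- ((T - s) / jap (T - s))).
    by der; ring.
  apply: der_eq (@der_comp _ _ _ (fun T => s - jap (T - s)) _ _ _ _ (der_Gee d (s - jap (T - s))) d3) _.
  by rewrite /k'; ring.
have ds (T s : R) : is_derive s 1 (Phi T) (l T s).
  have d1 : is_derive s 1 (fun s => T - s) (-1) by der; ring.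
  have d2 := @der_comp _ _ _ (fun s => T - s) _ _ _ _ (der_jap (T - s)) d1.
  have d3 : is_derive s 1 (fun s => s - jap (T - s)) (1 + (T - s) / jap (T - s)).
    by der; ring.
  exact: (@der_comp _ _ _ (fun s => s - jap (T - s)) _ _ _ _ (der_Gee d (s - jap (T - s))) d3).
have dQ (T : R) : is_derive T 1 Q (oint s0 t (k' T)).
  exact: (cfunctional_is_derive (oint_cfunctional s0 t) (k := Phi) (k' := k') T dT cP ck').
have Q1 T : -1 <= oint s0 t (k' T).
  have E : oint s0 t (fun s => - l T s) = - (Phi T t - Phi T s0).
    rewrite (cfunctional_opp (oint_cfunctional s0 t)); last exact: sl.
    by rewrite (oint_FTC2 s0 t (sl _ T cl) (ds T)).
  have H : oint s0 t (fun s => - l T s) <= oint s0 t (k' T).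
    apply: oint_le => //; [by apply: continuous_opp; exact: sl|exact: sl|].
    move=> s _; rewrite /l /k' lerN2 ler_wpM2l ?gee_ge0// lerDr//.
  apply: le_trans H; rewrite E lerN2; exact: Gee_osc.
have [c _ cE] := mean_value (t - r) (t + r) dQ.
have := Q1 c; rewrite -/(Q _) -/(Q _).
have : t + r - (t - r) = 2 * r by ring.
move: cE => /[swap] ->; move: (oint s0 t (k' c)) => z zE z1.
exact: slope_bound zE z1 r0.
Qed.

End spherical_mean_of_profile.

Section john.
Context {R : realType}.
Local Notation space := (R * R * R)%type.
Variable p : R.
Hypotheses (p1 : 3 / 2 < p) (pk : 1 < p * (2 * p - 3)).

Definition qexp : R := 2 * p - 3.
Local Notation q := qexp.
Local Notation kap := (p * q).
Local Notation d := (kap - 1).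

(* The second factor measures the distance to the light cone. *)
Definition weight (t : R) (x : space) : R :=
  if enorm x <= 1 + t then (1 + t)^-1 * (4 + t - japx x) `^ (- q) else 0.

Definition source_weight (s : R) (y : space) : R :=
  (1 + s) `^ (1 - p) * weight s y `^ p.

Let q0 : 0 < q. Proof. by rewrite /qexp; have := p1; lra. Qed.
Let d0 : 0 < d. Proof. by rewrite /qexp subr_gt0. Qed.
Let p0 : 0 < p. Proof. by have := p1; lra. Qed.

Lemma cone_base (t : R) (x : space) : 0 <= t -> enorm x <= 1 + t -> 2 <= 4 + t - japx x.
Proof. by move=> t0 xt; have := japx_le x; lra. Qed.

Lemma weight_ge0 (t : R) (x : space) : 0 <= t -> 0 <= weight t x.
Proof.
move=> t0; rewrite /weight; case: ifP => // _.
by rewrite mulr_ge0 ?powR_ge0// invr_ge0; lra.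
Qed.

Lemma source_weight_ge0 (t : R) (x : space) : 0 <= source_weight t x.
Proof. by rewrite mulr_ge0 ?powR_ge0. Qed.

Let K0 : R := 2 * (10 * 2 `^ kap / d).

(** In the cone the powers of 1 + s combine to the exponent 1 - 2p = - q - 2. One factor (1 + s)^-1
    is traded for 2/japx, since japx y <= 2 + s there, and the remaining factor is dominated by
    [gee] through [gee_lower]; these two bounds make up [K0]. *)
Lemma source_weight_le s y : 0 <= s ->
  source_weight s y <= K0 * (1 + s) `^ (- q - 1) * mm d s y.
Proof.
move=> s0; have s1 : 0 < 1 + s by lra.
have K00 : 0 <= K0.
  by rewrite /K0 !mulr_ge0// ?powR_ge0// invr_ge0 ltW.
rewrite /source_weight /weight; case: ifP => ys; last first.
  rewrite powR0 ?mulr0; last by rewrite gt_eqF.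
  apply: mulr_ge0; last by apply: mm_ge0.
  by apply: mulr_ge0 => //; exact: powR_ge0.
have b2 := cone_base s0 ys; have b0 : 0 < 4 + s - japx y by lra.
rewrite powRM ?invr_ge0 ?powR_ge0 ?(ltW s1)//.
rewrite -powRrM.
have -> : - q * p = - (d + 1) by rewrite /qexp; ring.
have := @gee_lower _ d d0 (s - japx y).
have -> : 4 + (s - japx y) = 4 + s - japx y by ring.
have -> : d + 1 = kap by ring.
move=> /(_ _) H; have {}H := H ltac:(lra).
rewrite -[(1 + s)^-1]powR_inv1 ?(ltW s1)// -powRrM mulN1r mulrA -powRD; last first.
  by rewrite (gt_eqF s1) implybT.
have -> : 1 - p - p = (- q - 1) + (-1) by rewrite /qexp; ring.
rewrite powRD; last by rewrite (gt_eqF s1) implybT.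
rewrite powR_inv1 ?(ltW s1)// /mm /K0.
have Hj : (1 + s)^-1 <= 2 * (japx y)^-1.
  rewrite ler_pdivlMr ?japx_gt0// mulrC ler_pdivrMr//.
  by have := japx_le y; lra.
have P1 := powR_gt0 (- q - 1) s1.
have P2 : 0 <= (4 + s - japx y) `^ (- kap) by exact: powR_ge0.
have -> : 2 * (10 * 2 `^ kap / d) * (1 + s) `^ (- q - 1) * (gee d (s - japx y) / japx y) =
  (1 + s) `^ (- q - 1) * (2 * (japx y)^-1) * (10 * 2 `^ kap / d * gee d (s - japx y)) by ring.
apply: ler_pM => //.
  by rewrite mulr_ge0 ?(ltW P1)// invr_ge0 ltW.
by rewrite ler_wpM2l// ltW.
Qed.

(** Finite speed of propagation: if |x| > 1 + t, every sphere of radius t - s about x lies outside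
    the ball of radius 1 + s. *)
Lemma duh_outside (F : R * space -> R) (t : R) (x : space) : 0 <= t ->
  (forall s y, 0 <= s -> 1 + s < enorm y -> F (s, y) = 0) ->
  1 + t < enorm x -> duh F t x = 0.
Proof.
move=> t0 F0 xt; apply: oint_eq0 => s /andP[s0 s1].
rewrite add0r subr0; set u := t * s.
have u0 : 0 <= u by exact: mulr_ge0.
have ut : u <= t by rewrite /u ler_piMr.
rewrite /kir (@sph_eq _ _ (fun _ => 0)) ?sph_cst ?mulr0// => w w1.
apply: F0 => //; have tu : 0 <= t - u by lra.
have := enorm_ray_ge x w1 tu; have := ler_norm (enorm x - (t - u)); lra.
Qed.

(** The absolute value makes the integrand continuous on the whole line; on the interval of
    integration it is s itself. *)
Lemma time_weight_integral (s0 t : R) : 0 <= s0 -> s0 <= t ->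
  oint s0 t (fun s => (1 + `|s|) `^ (- q - 1)) <= (1 + s0) `^ (- q) / q.
Proof.
move=> s00 s0t.
have c1 : continuous (fun s : R => 1 + `|s|).
  apply: continuous_add; first exact: continuous_cst.
  exact: (continuous_norm (@continuous_id _)).
have p1' (s : R) : 0 < 1 + `|s| by rewrite ltr_pwDl.
have cu := @continuous_powR_comp _ _ _ (- q - 1) c1 p1'.
rewrite oint_Rintegral//.
suff dK s : s0 <= s <= t -> is_derive s 1 (fun s => - (1 + s) `^ (- q) / q)
    ((1 + `|s|) `^ (- q - 1)).
  rewrite (FTC2_segment s0t cu dK) !mulNr opprK addrC lerBlDr lerDl.
  by rewrite divr_ge0 ?powR_ge0// ltW.
move=> /andP[s0s _]; have s1 : 0 < 1 + s by lra.
have d1 : is_derive s 1 (fun s : R => 1 + s) 1 by der; ring.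
have d2 := @der_powR _ _ (fun s : R => 1 + s) s 1 (- q) _ s1 d1.
der; rewrite ger0_norm; last by lra.
have : q != 0 by rewrite gt_eqF.
by move: (_ `^ _) => z q1; field.
Qed.

Let K0_ge0 : 0 <= K0.
Proof. by rewrite /K0 !mulr_ge0// ?powR_ge0// invr_ge0 ltW. Qed.

Let K0q_ge0 : 0 <= K0 / (2 * q).
Proof. by apply: divr_ge0 => //; apply: mulr_ge0 => //; exact: ltW. Qed.

Section bound.
Variables (F : R * space -> R) (A : R).
Hypotheses (cF : continuous F) (A0 : 0 <= A).
Hypothesis FA : forall s y, 0 <= s -> `|F (s, y)| <= A * source_weight s y.

Let F0 s y : 0 <= s -> 1 + s < enorm y -> F (s, y) = 0.
Proof.
move=> s0 ys; have := FA y s0; have yn : (enorm y <= 1 + s) = false by rewrite leNgt ys.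
rewrite /source_weight /weight yn /=; rewrite powR0 ?(gt_eqF p0)// !mulr0 normr_le0.
by move/eqP.
Qed.

Let kir_bound (s tau : R) (x : space) : 0 <= s -> 0 <= tau -> 0 < enorm x ->
  `|kir tau (slice F s) x| <= A * K0 * (1 + s) `^ (- q - 1) * ((2 * enorm x)^-1 *
    (Gee d (s - jap (enorm x - tau)) - Gee d (s - jap (enorm x + tau)))).
Proof.
move=> s0 tau0 x0.
have E : (2 * enorm x)^-1 * (Gee d (s - jap (enorm x - tau)) - Gee d (s - jap (enorm x + tau)))
  = tau * sph (fun w => mm d s (x + tau *: w)).
  have := sph_mm d s tau x; move: (Gee _ _ - _) (sph _) => g S E.
  have -> : g = 2 * (enorm x * tau * S) by rewrite E mulrA divff ?mul1r.
  by field; rewrite gt_eqF.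
rewrite E /kir normrM ger0_norm// mulrCA ler_wpM2l//.
have cm : continuous (mm d s) by exact: mm_continuous.
rewrite -(cfunctional_scale (@sph_cfunctional R)); last by cont.
apply: sph_abs_le.
- by rewrite /slice; cont.
- by cont.
- move=> w w1; apply: le_trans (FA _ s0) _.
  apply: le_trans (ler_wpM2l A0 (source_weight_le _ s0)) _.
  by rewrite le_eqVlt; apply/orP; left; apply/eqP; ring.
Qed.

(** Before this time the backward sphere of radius t - s about x does not meet the cone |y| <= 1 +
    s: on it |y| >= t - s - |x| >= s + 2. *)
Let s0 (t : R) (x : space) : R := Num.max 0 ((t - enorm x - 2) / 2).

Let s0_le t x : 0 <= t -> s0 t x <= t.
Proof. by move=> t0; rewrite /s0 ge_max t0/=; have := enorm_ge0 x; lra. Qed.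

Let s0_ge0 t x : 0 <= s0 t x.
Proof. by rewrite /s0 le_max lexx. Qed.

Let duh_bound_aux (t : R) (x : space) : 0 <= t -> 0 < enorm x ->
  `|duh F t x| <= A * K0 * (2 * enorm x)^-1 *
    oint (s0 t x) t (fun s => (1 + `|s|) `^ (- q - 1) *
      (Phi d (t - enorm x) s - Phi d (t + enorm x) s)).
Proof.
move=> t0 x0; set r := enorm x; set a := s0 t x.
have a0 : 0 <= a by exact: s0_ge0.
have ckir : continuous (fun s => kir (t - s) (slice F s) x).
  by apply: (@continuous_compose _ _ _ _ (fun s : R => ((t - s, s), x)) (kir_joint cF)); cont.
have -> : duh F t x = oint a t (fun s => kir (t - s) (slice F s) x).
  rewrite /duh -(oint_chasles 0 a t ckir).
  have [az|az] := eqVneq a 0; first by rewrite az oint_point add0r.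
  rewrite oint_eq0 ?add0r// => s /andP[s0' s1].
  rewrite add0r subr0; set u := a * s.
  have u0 : 0 <= u by exact: mulr_ge0.
  have ua : u <= a by rewrite /u ler_piMr.
  have aE : a = (t - r - 2) / 2.
    move: az; rewrite /a /s0 -/r; case: (leP 0 ((t - r - 2) / 2)) => //.
    by rewrite eqxx.
  have ta := s0_le x t0.
  rewrite /kir (@sph_eq _ _ (fun _ => 0)) ?sph_cst ?mulr0// => w w1.
  have tu : 0 <= t - u by rewrite subr_ge0 (le_trans ua).
  apply: F0 => //; have := enorm_ray_ge x w1 tu.
  have := ler_norm (- (enorm x - (t - u))); rewrite normrN -/r.
  by move: ua; rewrite aE; lra.
have c1 : continuous (fun s : R => 1 + `|s|).
  apply: continuous_add; first exact: continuous_cst.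
  exact: (continuous_norm (@continuous_id _)).
have p1' (s : R) : 0 < 1 + `|s| by rewrite ltr_pwDl.
have cu := @continuous_powR_comp _ _ _ (- q - 1) c1 p1'.
have cP := @Phi_slice R d.
rewrite -(cfunctional_scale (oint_cfunctional a t)); last by cont.
apply: oint_abs_le => //; [by cont|exact: s0_le|move=> s /andP[as' st]].
have s00 : 0 <= s by lra.
have ts : 0 <= t - s by lra.
apply: le_trans (kir_bound s00 ts x0) _.
rewrite ger0_norm// -/r /Phi.
have -> : jap (r - (t - s)) = jap (t - r - s).
  by rewrite -jap_even; congr jap; ring.
have -> : r + (t - s) = t + r - s by ring.
by move: (Gee _ _ - _) (_ `^ _) => g z; rewrite le_eqVlt; apply/orP; left; apply/eqP; ring.
Qed.

Let diff_ge0 (s tau : R) (x : space) : 0 <= tau ->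
  0 <= Gee d (s - jap (enorm x - tau)) - Gee d (s - jap (enorm x + tau)).
Proof.
move=> tau0; have := sph_mm d s tau x.
have cm : continuous (mm d s) by exact: mm_continuous.
have : 0 <= sph (fun w => mm d s (x + tau *: w)).
  have := @sph_le _ (fun _ => 0) (fun w => mm d s (x + tau *: w)).
  rewrite sph_cst; apply; [exact: continuous_cst|by cont|].
  by move=> w _; apply: mm_ge0.
move: (sph _) (Gee _ _ - _) => S g S0 E.
have -> : g = 2 * (enorm x * tau * S) by rewrite E mulrA divff ?mul1r.
by rewrite !mulr_ge0// enorm_ge0.
Qed.

Let sigma (t : R) (x : space) : R := 1 + s0 t x.

Let sigma_gt0 t x : 0 < sigma t x.
Proof. by rewrite /sigma ltr_pwDl// s0_ge0. Qed.

(** The first bound relates the earliest effective source time to the distance to the light cone.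
    The second one says that |x| or [sigma] is at least (1 + t)/4. Both are sharpest where the two
    branches of [s0] meet, at t - |x| = 2. *)
Let sigma_cone t x : 0 <= t -> 4 + t - japx x <= 6 * sigma t x /\
  1 + t <= enorm x + 3 * sigma t x.
Proof.
move=> t0; have := japx_ge_enorm x; rewrite /sigma /s0.
have := enorm_ge0 x; case: (leP 0 ((t - enorm x - 2) / 2)) => H H1 H2; split; lra.
Qed.

Let diff_le (t : R) (x : space) (s : R) : s <= t ->
  0 <= Phi d (t - enorm x) s - Phi d (t + enorm x) s <= 1.
Proof.
move=> st; rewrite Gee_osc// andbT /Phi.
have -> : jap (t - enorm x - s) = jap (enorm x - (t - s)).
  by rewrite -jap_even; congr jap; ring.
have -> : t + enorm x - s = enorm x + (t - s) by ring.
by apply: diff_ge0; rewrite subr_ge0.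
Qed.

(** Two bounds for one integral. Taking the time weight out at its largest value and using
    [oint_Phi_diff] cancels the factor 1/|x| and gives sigma^(-q-1). Bounding the difference of
    [Phi] by 1 and integrating the time weight gives sigma^(-q)/|x|. Since sigma or |x| is at least
    (1 + t)/4, the better of the two supplies the decay (1 + t)^-1. *)
Let duh_bound_pos (t : R) (x : space) : 0 <= t -> 0 < enorm x ->
  `|duh F t x| <= A * (K0 + K0 / (2 * q)) * 4 * (1 + t)^-1 * sigma t x `^ (- q).
Proof.
move=> t0 x0; have H := duh_bound_aux t0 x0.
have s0t := s0_le x t0; have s00 := s0_ge0 t x.
have c1 : continuous (fun s : R => 1 + `|s|).
  apply: continuous_add; first exact: continuous_cst.
  exact: (continuous_norm (@continuous_id _)).
have p1' (s : R) : 0 < 1 + `|s| by rewrite ltr_pwDl.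
have cu := @continuous_powR_comp _ _ _ (- q - 1) c1 p1'.
have cP := @Phi_slice R d.
have sg := sigma_gt0 t x.
have [_ tr] := sigma_cone x t0.
set Z := sigma t x `^ (- q).
have Z0 : 0 <= Z by exact: powR_ge0.
have Zs : sigma t x `^ (- q - 1) = Z * (sigma t x)^-1.
  by rewrite powRD ?(gt_eqF sg) ?implybT// powR_inv1// ltW.
have I1 : `|duh F t x| <= A * K0 * (Z * (sigma t x)^-1).
  apply: le_trans H _.
  have B : oint (s0 t x) t (fun s => (1 + `|s|) `^ (- q - 1) *
      (Phi d (t - enorm x) s - Phi d (t + enorm x) s)) <=
      (Z * (sigma t x)^-1) * (2 * enorm x).
    apply: (@le_trans _ _ (oint (s0 t x) t (fun s => (Z * (sigma t x)^-1) *
      (Phi d (t - enorm x) s - Phi d (t + enorm x) s)))).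
      apply: oint_le => //; [by cont|by cont|move=> s /andP[s0s st]].
      apply: ler_wpM2r; first by have /andP[] := diff_le x st.
      rewrite -Zs -opprD; apply: le_powRN_base => //.
        by rewrite /sigma lerD2l; apply: le_trans s0s (ler_norm _).
      by rewrite addr_ge0// ltW.
    rewrite (cfunctional_scale (oint_cfunctional _ _)); last by cont.
    rewrite ler_wpM2l//; first by rewrite mulr_ge0// invr_ge0 ltW.
    by apply: oint_Phi_diff => //; exact: ltW.
  have P : 0 <= A * K0 * (2 * enorm x)^-1.
    apply: mulr_ge0; first exact: mulr_ge0.
    by rewrite invr_ge0 mulr_ge0// ltW.
  apply: le_trans (ler_wpM2l P B) _; rewrite le_eqVlt; apply/orP; left; apply/eqP.
  by move: (Z * _) => z; field; rewrite gt_eqF.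
have I2 : `|duh F t x| <= A * (K0 / (2 * q)) * (Z * (enorm x)^-1).
  apply: le_trans H _.
  have B : oint (s0 t x) t (fun s => (1 + `|s|) `^ (- q - 1) *
      (Phi d (t - enorm x) s - Phi d (t + enorm x) s)) <= Z / q.
    apply: le_trans (time_weight_integral s00 s0t).
    apply: oint_le => //; [by cont|move=> s /andP[s0s st]].
    by rewrite ler_piMr ?powR_ge0//; have /andP[] := diff_le x st.
  have P : 0 <= A * K0 * (2 * enorm x)^-1.
    apply: mulr_ge0; first exact: mulr_ge0.
    by rewrite invr_ge0 mulr_ge0// ltW.
  apply: le_trans (ler_wpM2l P B) _; rewrite le_eqVlt; apply/orP; left; apply/eqP.
  by field; rewrite !gt_eqF.
have t1 : 0 < 1 + t by lra.
have K1 : 0 <= A * K0 by exact: mulr_ge0.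
have K2 : 0 <= A * (K0 / (2 * q)) by apply: mulr_ge0.
have inv4 y : 0 < y -> 1 + t <= 4 * y -> y^-1 <= 4 * (1 + t)^-1.
  by move=> y0 y4; rewrite ler_pdivlMr// mulrC ler_pdivrMr.
have [rs|sr] := leP (enorm x) (sigma t x).
  have V : (sigma t x)^-1 <= 4 * (1 + t)^-1 by apply: inv4 => //; lra.
  apply: le_trans I1 _.
  apply: (@le_trans _ _ (A * K0 * (Z * (4 * (1 + t)^-1)))).
    by rewrite ler_wpM2l// ler_wpM2l.
  rewrite -subr_ge0; have -> : A * (K0 + K0 / (2 * q)) * 4 * (1 + t)^-1 * Z -
     A * K0 * (Z * (4 * (1 + t)^-1)) = A * (K0 / (2 * q)) * (Z * (4 * (1 + t)^-1)) by ring.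
  by rewrite mulr_ge0// mulr_ge0// mulr_ge0// invr_ge0 ltW.
have V : (enorm x)^-1 <= 4 * (1 + t)^-1 by apply: inv4 => //; lra.
apply: le_trans I2 _.
apply: (@le_trans _ _ (A * (K0 / (2 * q)) * (Z * (4 * (1 + t)^-1)))).
  by rewrite ler_wpM2l// ler_wpM2l.
rewrite -subr_ge0; have -> : A * (K0 + K0 / (2 * q)) * 4 * (1 + t)^-1 * Z -
   A * (K0 / (2 * q)) * (Z * (4 * (1 + t)^-1)) = A * K0 * (Z * (4 * (1 + t)^-1)) by ring.
by rewrite mulr_ge0// mulr_ge0// mulr_ge0// invr_ge0 ltW.
Qed.

Let sigma_continuous t : continuous (sigma t).
Proof.
by have ce := enorm_continuous (R := R); rewrite /sigma /s0; cont.
Qed.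

(* At the origin the radial formula degenerates; the bound extends by
   continuity. *)
Let duh_bound (t : R) (x : space) : 0 <= t ->
  `|duh F t x| <= A * (K0 + K0 / (2 * q)) * 4 * (1 + t)^-1 * sigma t x `^ (- q).
Proof.
move=> t0; have [x0|x0] := ltP 0 (enorm x); first exact: duh_bound_pos.
pose u (y : space) := A * (K0 + K0 / (2 * q)) * 4 * (1 + t)^-1 * sigma t y `^ (- q) -
  `|duh F t y|.
have cs := @continuous_powR_comp _ _ _ (- q) (@sigma_continuous t) (sigma_gt0 t).
have cd : continuous (fun y => duh F t y).
  by apply: (@continuous_compose _ _ _ _ (fun y : space => (t, y)) (duh_continuous cF)); cont.
have cu : continuous u by rewrite /u; cont.
have cl : continuous (fun h : R => u (h *: unit_vec i0 + x)).
  by apply: (continuous_compose cu); cont.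
rewrite -subr_ge0 -/(u x) leNgt; apply/negP => ux.
have /cvgr_lt/(_ 0) : u (h *: unit_vec i0 + x) @[h --> (0 : R)] --> u (0 *: unit_vec i0 + x) by exact: cl.
rewrite scale0r add0r => /(_ ux) [e /= e0 He].
have e2 : 0 < e / 2 by rewrite divr_gt0.
have H : u ((e / 2) *: unit_vec i0 + x) < 0.
  by apply: He; rewrite /= sub0r normrN (ger0_norm (ltW e2)); lra.
move: H; apply/negP; rewrite -leNgt /u subr_ge0; apply: duh_bound_pos => //.
have xz : x = 0.
  have e00 : enorm x = 0 by apply/eqP; rewrite eq_le x0 enorm_ge0.
  have : sqn x = 0 by rewrite -enorm_sqr e00 expr0n.
  rewrite /sqn => /eqP; rewrite !paddr_eq0 ?addr_ge0 ?sqr_ge0// !sqrf_eq0.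
  move=> /andP[/andP[/eqP X1 /eqP X2] /eqP X3].
  by rewrite [LHS]surjective_pairing [x.1]surjective_pairing X1 X2 X3.
rewrite xz addr0 sqrtr_gt0 /unit_vec/= /GRing.scale/= !mulr1 !mulr0 expr0n !addr0.
by rewrite exprn_gt0.
Qed.

(** The sum collects the two bounds of [duh_bound_pos], 4 comes from the comparison of sigma or |x|
    with 1 + t, and 6^q from replacing sigma by the distance to the light cone. *)
Definition john_constant : R := (K0 + K0 / (2 * q)) * 4 * 6 `^ q.

Lemma john (t : R) (x : space) : 0 <= t ->
  `|duh F t x| <= john_constant * A * weight t x.
Proof.
move=> t0; rewrite /weight; case: ifP => [xt|/negbT]; last first.
  by rewrite -ltNge => xt; rewrite (duh_outside t0 F0 xt) normr0 mulr0.
have b2 := cone_base t0 xt; have b0 : 0 < 4 + t - japx x by lra.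
apply: le_trans (duh_bound x t0) _; rewrite /john_constant.
have [s6 _] := sigma_cone x t0.
have sg := sigma_gt0 t x.
have Z : sigma t x `^ (- q) <= 6 `^ q * (4 + t - japx x) `^ (- q).
  have := le_powRN_base b0 s6 (ltW q0).
  by rewrite powRM ?(ltW sg)// [6 `^ (- q)]powRN ler_pdivrMl.
have t1 : 0 < 1 + t by lra.
have P : 0 <= A * (K0 + K0 / (2 * q)) * 4 * (1 + t)^-1.
  apply: mulr_ge0; last by rewrite invr_ge0 ltW.
  by apply: mulr_ge0 => //; apply: mulr_ge0 => //; exact: addr_ge0.
apply: le_trans (ler_wpM2l P Z) _.
by rewrite le_eqVlt; apply/orP; left; apply/eqP; ring.
Qed.

End bound.
End john.

(** * Powers and geometric limits *)
Section powers_difference.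
Context {R : realType}.

Lemma powR_convex (c x y : R) : 1 <= c -> 0 <= y -> y <= x ->
  x `^ c - y `^ c <= c * x `^ (c - 1) * (x - y).
Proof.
move=> c1 y0 yx; have c0 : 0 < c by lra.
have [yz|yz] := eqVneq y 0.
  rewrite yz powR0 ?(gt_eqF c0)// !subr0 -mulrA [x `^ _ * x]mulrC mulr_powRB1//.
    by rewrite ler_peMl// powR_ge0.
  exact: le_trans yx.
have {yz}y0 : 0 < y by rewrite lt_def yz.
have dpow z : y <= z -> is_derive z 1 (fun z => z `^ c) (c * z `^ (c - 1)).
  by move=> yz; apply: is_derive1_powR; exact: lt_le_trans yz.
have [z zyx ->] := @MVT_segment R (fun z => z `^ c) (fun z => c * z `^ (c - 1)) y x yx
    ltac:(by move=> z; rewrite in_itv/= => /andP[/ltW yz _]; exact: dpow)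
    ltac:(by apply: derivable_within_continuous => z; rewrite in_itv/= => /andP[yz _]; case: (dpow z yz)).
move: zyx; rewrite in_itv/= => /andP[yz zx].
rewrite ler_wpM2r ?subr_ge0// ler_wpM2l ?(ltW c0)//.
by apply: le_powR_base => //; lra.
Qed.

Variable p : R.
Hypothesis p1 : 3 / 2 < p.

Lemma abs_powR_diff (a b M : R) : `|a| <= M -> `|b| <= M ->
  `| `|a| `^ p - `|b| `^ p | <= p * M `^ (p - 1) * `|a - b|.
Proof.
wlog ab : a b / `|b| <= `|a|.
  move=> H aM bM; have [ba|/ltW ba] := leP `|b| `|a|; first exact: H.
  by rewrite distrC [`|a - b|]distrC; exact: H.
move=> aM bM; have := p1 => p1'.
rewrite ger0_norm; last by rewrite subr_ge0 le_powR_base//; lra.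
apply: le_trans (@powR_convex p `|a| `|b| _ _ ab) _ => //; first by lra.
apply: ler_pM.
- by rewrite mulr_ge0 ?powR_ge0//; lra.
- by rewrite subr_ge0.
- by rewrite ler_wpM2l//; [lra|apply: le_powR_base => //; lra].
- exact: lerB_dist.
Qed.

(** The derivative of |y|^p divided by p. *)
Definition rho (y : R) : R := Num.sg y * `|y| `^ (p - 1).

Lemma norm_rho y : `|rho y| = `|y| `^ (p - 1).
Proof.
rewrite /rho normrM [X in _ * X]ger0_norm ?powR_ge0// normr_sg.
have [->|] := eqVneq y 0; last by rewrite mul1r.
by rewrite normr0 powR0 ?mulr0// gt_eqF//; have := p1; lra.
Qed.

Lemma powR_half_sub (x y : R) : 0 <= y -> y <= x ->
  x `^ 2^-1 - y `^ 2^-1 <= (x - y) `^ 2^-1.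
Proof.
move=> y0 yx; have x0 : 0 <= x by lra.
rewrite !powR12_sqrt ?subr_ge0// lerBlDr.
rewrite -(@ler_pXn2r _ 2)// ?nnegrE ?addr_ge0 ?sqrtr_ge0//.
rewrite sqrrD !sqr_sqrtr ?subr_ge0//.
have : 0 <= Num.sqrt (x - y) * Num.sqrt y by rewrite mulr_ge0 ?sqrtr_ge0.
by rewrite mulr2n; lra.
Qed.

(** Written as a power of the square root, z^(p-1) has exponent 2(p-1) >= 1, so convexity applies;
    the difference of square roots is at most the square root of the difference. The condition on
    the exponent is where p > 3/2 enters. *)
Lemma powR_half_holder (x y M : R) : 0 <= y -> y <= x -> x <= M ->
  x `^ (p - 1) - y `^ (p - 1) <= 2 * p * M `^ (p - 3 / 2) * (x - y) `^ 2^-1.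
Proof.
move=> y0 yx xM; have p1' := p1; have x0 : 0 <= x by lra.
have E z : z `^ (p - 1) = (z `^ 2^-1) `^ (2 * (p - 1)).
  by rewrite -powRrM; congr (_ `^ _); field.
rewrite !E.
have s : y `^ 2^-1 <= x `^ 2^-1 by apply: le_powR_base.
apply: le_trans (@powR_convex (2 * (p - 1)) _ _ _ (powR_ge0 _ _) s) _; first by lra.
rewrite -powRrM.
have -> : 2^-1 * (2 * (p - 1) - 1) = p - 3 / 2 by field.
apply: ler_pM.
- by rewrite mulr_ge0 ?powR_ge0//; lra.
- by rewrite subr_ge0.
- apply: ler_pM; [lra|exact: powR_ge0|lra|].
  by apply: le_powR_base => //; lra.
- exact: powR_half_sub.
Qed.

Lemma rhoN y : rho (- y) = - rho y.
Proof. by rewrite /rho sgrN normrN mulNr. Qed.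

Lemma rho_ge0E y : 0 <= y -> rho y = y `^ (p - 1).
Proof.
rewrite le_eqVlt => /orP[/eqP <-|y0]; last first.
  by rewrite /rho gtr0_sg// mul1r gtr0_norm.
rewrite /rho sgr0 mul0r powR0// gt_eqF//; have := p1; lra.
Qed.

(* 1/2-Hoelder, with the homogeneity of rho kept in the constant *)
Lemma rho_holder (a b M : R) : `|a| <= M -> `|b| <= M ->
  `|rho a - rho b| <= 2 * p * M `^ (p - 3 / 2) * `|a - b| `^ 2^-1.
Proof.
have p1' := p1.
wlog ab : a b / b <= a.
  move=> H aM bM; have [ba|/ltW ba] := leP b a; first exact: H.
  by rewrite distrC [`|a - b|]distrC; exact: H.
(* As [rho] is odd, (a, b) may be exchanged with (-b, -a); then a is nonnegative and dominates
   |b|. *)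
wlog a0 : a b ab / 0 <= a + b.
  move=> H aM bM; have [s0|s0] := leP 0 (a + b); first exact: H.
  have := H (- b) (- a); rewrite !rhoN !normrN.
  have -> : - rho b - - rho a = rho a - rho b by ring.
  have -> : - b - - a = a - b by ring.
  by apply => //; lra.
move=> aM bM; have a00 : 0 <= a by lra.
have M0 : 0 <= M by apply: le_trans aM.
have ab0 : 0 <= a - b by lra.
rewrite (ger0_norm ab0) (rho_ge0E a00); rewrite (ger0_norm a00) in aM.
have [b0|b0] := leP 0 b.
  rewrite (rho_ge0E b0) ger0_norm; last by rewrite subr_ge0 le_powR_base//; lra.
  exact: powR_half_holder.
have nb0 : 0 <= - b by lra.
have -> : rho b = - ((- b) `^ (p - 1)) by rewrite -(rho_ge0E nb0) rhoN opprK.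
rewrite opprK ger0_norm ?addr_ge0 ?powR_ge0//.
(* For opposite signs there is no cancellation to use: a and -b are each at most a - b, so half a
   power of either can be spent on a - b. *)
have H z : 0 <= z -> z <= M -> z <= a - b -> z `^ (p - 1) <= M `^ (p - 3 / 2) * (a - b) `^ 2^-1.
  move=> z0 zM zab; have -> : p - 1 = (p - 3 / 2) + 2^-1 by field.
  rewrite powRD; last by apply/implyP => /eqP; lra.
  by apply: ler_pM; rewrite ?powR_ge0//; apply: le_powR_base => //; lra.
have Ha := H a a00 aM ltac:(lra).
have Hb := H (- b) nb0 ltac:(lra) ltac:(lra).
have P : 0 <= M `^ (p - 3 / 2) * (a - b) `^ 2^-1 by rewrite mulr_ge0 ?powR_ge0.
rewrite -mulrA; move: (M `^ _ * _) Ha Hb P => z Ha Hb P.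
by nra.
Qed.

Lemma rho_continuous : continuous rho.
Proof.
move=> a; pose M := `|a| + 1.
have cs : continuous (fun b : R => 2 * p * M `^ (p - 3 / 2) * Num.sqrt `|a - b|) by cont.
apply/cvgrPdist_le => e e0.
have := cs a; rewrite /continuous_at subrr normr0 sqrtr0 mulr0 => /cvgrPdist_le/(_ e e0).
move=> H1.
have H2 : \forall b \near a, `|b| < M.
  by apply: (@cvgr_lt _ _ _ _ (fun x : R => `|x|) `|a| (cvg_norm cvg_id)); rewrite /M ltrDl.
near=> b.
have bM : `|b| <= M by apply/ltW; near: b.
have aM : `|a| <= M by rewrite /M lerDl.
apply: le_trans (rho_holder aM bM) _; rewrite powR12_sqrt//.
have : `|0 - 2 * p * M `^ (p - 3 / 2) * Num.sqrt `|a - b| | <= e by near: b.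
by rewrite sub0r normrN; apply: le_trans; exact: ler_norm.
Unshelve. all: by end_near. Qed.

Lemma der_abs_powR (y : R) : is_derive y 1 (fun y => `|y| `^ p) (p * rho y).
Proof.
have p1' := p1.
have [y0|y0|->] := ltgtP y 0.
- have d1 : is_derive y 1 (fun y : R => - y) (-1) by der.
  have ny : 0 < - y by lra.
  have d2 := @der_powR _ _ (fun y : R => - y) _ _ p _ ny d1.
  have E : \forall z \near y, (- z) `^ p = `|z| `^ p.
    near=> z; rewrite ltr0_norm//; near: z; exact: lt_nbhsl.
  apply: der_eq (near_eq_is_derive E d2) _.
  by rewrite -[y in RHS]opprK rhoN (rho_ge0E (ltW ny)); ring.
- have d2 := is_derive1_powR p y0.
  have E : \forall z \near y, z `^ p = `|z| `^ p.
    near=> z; rewrite gtr0_norm//; near: z; exact: lt_nbhsr.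
  apply: der_eq (near_eq_is_derive E d2) _.
  by rewrite (rho_ge0E (ltW y0)).
- rewrite (rho_ge0E (lexx 0)) powR0 ?mulr0; last by rewrite gt_eqF//; lra.
  apply/is_deriveP => e e0.
  have := @rho_continuous 0; rewrite /continuous_at (rho_ge0E (lexx 0)).
  rewrite powR0; last by rewrite gt_eqF//; lra.
  move/cvgrPdist_le => /(_ e e0) [d /= d0 Hd].
  exists d => //= h hd h0; rewrite [h *: 1]mulr1 addr0 normr0 powR0 ?subr0; last first.
    by rewrite gt_eqF//; lra.
  have := Hd h hd; rewrite sub0r normrN norm_rho => H.
  rewrite normrM normfV [`| `|h| `^ p|]ger0_norm ?powR_ge0//.
  have -> : `|h| `^ p = `|h| * `|h| `^ (p - 1) by rewrite mulr_powRB1//; lra.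
  by rewrite mulKf// normr_eq0.
Unshelve. all: by end_near. Qed.

Lemma abs_powR_continuous : continuous (fun y : R => `|y| `^ p).
Proof. exact: is_derive_continuous der_abs_powR. Qed.

End powers_difference.

(** * Limits of geometrically convergent sequences *)

Section geometric_limit.
Context {R : realType}.

Lemma half_pow_small (C x : R) : (forall n, x <= C * 2^-1 ^+ n) -> x <= 0.
Proof.
move=> H; rewrite leNgt; apply/negP => x0.
have C0 : 0 < C by have := H 0%N; rewrite expr0 mulr1; exact: lt_le_trans.
have : (fun n : nat => C * 2^-1 ^+ n) @ \oo --> C * 0.
  apply: cvgMr; apply: cvg_expr; rewrite ger0_norm//; lra.
rewrite mulr0 => /cvgr_lt/(_ x x0) [N _ HN].
by have := HN N (leqnn N); have := H N; rewrite /= leNgt => /negP.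
Qed.

(** With r_n = 2 B 2^-n w, the sum of the tail, the intervals [f_n - r_n, f_n + r_n] are nested, and
    the limit is the supremum of their lower ends. Keeping w in the error preserves the decay of the
    weight; w <= 1 makes the convergence uniform. *)
Lemma geometric_limit (T : topologicalType) (f : nat -> T -> R) (w : T -> R) (B : R) :
  0 <= B -> (forall x, 0 <= w x <= 1) ->
  (forall n x, `|f n.+1 x - f n x| <= B * 2^-1 ^+ n * w x) ->
  (forall n, continuous (f n)) ->
  exists g : T -> R, continuous g /\
    forall n x, `|g x - f n x| <= 2 * B * 2^-1 ^+ n * w x.
Proof.
move=> B0 w01 Hf cf.
pose r n x : R := 2 * B * 2^-1 ^+ n * w x.
have rS n x : r n x - r n.+1 x = B * 2^-1 ^+ n * w x by rewrite /r exprS; field.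
have r0 n x : 0 <= r n x.
  have /andP[wx _] := w01 x.
  by rewrite /r !mulr_ge0// exprn_ge0.
have up n x : f n x - r n x <= f n.+1 x - r n.+1 x.
  by have := Hf n x; rewrite -rS ler_norml => /andP[]; lra.
have dn n x : f n.+1 x + r n.+1 x <= f n x + r n x.
  by have := Hf n x; rewrite -rS ler_norml => /andP[]; lra.
have upk n k x : f n x - r n x <= f (n + k)%N x - r (n + k)%N x.
  elim: k => [|k ih]; first by rewrite addn0.
  by rewrite addnS; apply: le_trans ih (up _ _).
have dnk n k x : f (n + k)%N x + r (n + k)%N x <= f n x + r n x.
  elim: k => [|k ih]; first by rewrite addn0.
  by rewrite addnS; apply: le_trans (dn _ _) ih.
have ud n m x : f n x - r n x <= f m x + r m x.
  have [nm|/ltnW mn] := leqP n m.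
    by rewrite -(subnKC nm); have := upk n (m - n)%N x; have := r0 (n + (m - n))%N x; lra.
  by rewrite -(subnKC mn); have := dnk m (n - m)%N x; have := r0 (m + (n - m))%N x; lra.
pose g x := sup [set f n x - r n x | n in setT].
have Hg n x : `|g x - f n x| <= r n x.
  have hs : has_sup [set f n x - r n x | n in setT].
    split; first by exists (f 0%N x - r 0%N x), 0%N.
    by exists (f 0%N x + r 0%N x) => _ [m _ <-]; exact: ud.
  rewrite ler_norml; apply/andP; split.
    by have : f n x - r n x <= g x; [apply: ub_le_sup; [exact: hs.2|exists n]|lra].
  have : g x <= f n x + r n x by apply: ge_sup; [exact: hs.1|move=> _ [m _ <-]; exact: ud].
  lra.
exists g; split; last by move=> n x; exact: Hg.
move=> x; apply/cvgrPdist_le => e e0.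
have [n Hn] : exists n, forall y, r n y <= e / 3.
  have [n Hn] : exists n, 2 * B * 2^-1 ^+ n < e / 3.
    have : (fun n : nat => 2 * B * 2^-1 ^+ n) @ \oo --> 2 * B * 0.
      by apply: cvgMr; apply: cvg_expr; rewrite ger0_norm//; lra.
    rewrite mulr0 => /cvgr_lt/(_ (e / 3)) [|N _ HN]; first by rewrite divr_gt0.
    by exists N; exact: (HN N (leqnn N)).
  exists n => y; have /andP[w0 w1] := w01 y; apply: le_trans (ltW Hn).
  by rewrite /r ler_piMr// !mulr_ge0// exprn_ge0.
have e3 : 0 < e / 3 by rewrite divr_gt0.
have /cvgrPdist_le/(_ _ e3) := cf n x; apply: filterS => y Hy.
have := Hg n x; have := Hg n y; have := Hn x; have := Hn y; move: Hy.
rewrite !ler_norml => /andP[? ?] ? ? /andP[? ?] /andP[? ?].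
by apply/andP; split; lra.
Qed.

(** The limit is taken in the integrated identity F(x + bv) - F(x) = int_0^b G(x + hv) dh, which is
    then differentiated at b = 0 by continuity of G. *)
Lemma limit_derive (V : normedModType R) (f g : nat -> V -> R) (F G : V -> R) (v : V) (B : R) :
  (forall n x, is_derive x v (f n) (g n x)) -> (forall n, continuous (g n)) ->
  continuous G ->
  (forall n x, `|F x - f n x| <= B * 2^-1 ^+ n) ->
  (forall n x, `|G x - g n x| <= B * 2^-1 ^+ n) ->
  forall x, is_derive x v F (G x).
Proof.
move=> df cg cG HF HG x.
have cl : continuous (fun h : R => h *: v + x) by cont.
have cGl := continuous_compose cG cl.
have E (b : R) : F (b *: v + x) - F x = oint 0 b (fun h => G (h *: v + x)).
  apply/eqP; rewrite -subr_eq0 -normr_eq0 eq_le normr_ge0 andbT.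
  apply: (@half_pow_small (2 * B + B * `|b|)) => n.
  have cgl := continuous_compose (cg n) cl.
  have En : f n (b *: v + x) - f n x = oint 0 b (fun h => g n (h *: v + x)).
    have dfl (h : R) : is_derive h 1 (fun h => f n (h *: v + x)) (g n (h *: v + x)).
      exact: ((is_derive_line (f n) x v h _).1 (df n _)).
    by rewrite (oint_FTC2 0 b cgl dfl) scale0r add0r.
  have D : `|oint 0 b (fun h => G (h *: v + x)) - oint 0 b (fun h => g n (h *: v + x))|
      <= B * 2^-1 ^+ n * `|b|.
    rewrite -(cfunctional_sub (oint_cfunctional 0 b))//.
    have cd : continuous (fun h : R => G (h *: v + x) - g n (h *: v + x)) by cont.
    have [b0|/ltW b0] := leP 0 b.
      by rewrite [X in _ * X]ger0_norm// -[X in _ * X]subr0; apply: oint_norm_le => // h _; exact: HG.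
    have := oint_chasles b 0 b cd; rewrite oint_point => /eqP; rewrite addrC addr_eq0 => /eqP ->.
    rewrite normrN [`|b|]ler0_norm// -[- b]add0r.
    by apply: oint_norm_le => // h _; exact: HG.
  have H1 := HF n (b *: v + x); have H2 := HF n x.
  have -> : F (b *: v + x) - F x - oint 0 b (fun h => G (h *: v + x)) =
    (F (b *: v + x) - f n (b *: v + x)) - (F x - f n x) -
    (oint 0 b (fun h => G (h *: v + x)) - oint 0 b (fun h => g n (h *: v + x))).
    by rewrite -En; ring.
  apply: le_trans (ler_normB _ _) _; apply: le_trans (lerD (ler_normB _ _) (lexx _)) _.
  by move: H1 H2 D; set z := 2^-1 ^+ n; move: `|_| `|_| `|_| => a1 a2 a3; lra.
apply/is_derive_line0.
have -> : (fun h => F (h *: v + x)) = (fun h => F x + oint 0 h (fun h => G (h *: v + x))).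
  by apply/funext => b; rewrite -E [F x + _]addrC subrK.
have := oint_is_derive 0 0 cGl; rewrite scale0r add0r => dO.
by der; ring.
Qed.

End geometric_limit.

(** * The fixed point *)
Section fixed_point.
Context {R : realType}.
Local Notation space := (R * R * R)%type.
Local Notation st := (R * space)%type.
Variable p : R.
Hypotheses (p1 : 3 / 2 < p) (pk : 1 < p * (2 * p - 3)).

(** Time is frozen at 0 for t < 0, so that the iteration takes place among continuous functions on
    the whole of R x R^3 and the bounds hold there without a sign condition. *)
Definition pos (z : st) : st := (Num.max z.1 0, z.2).

Definition wt (z : st) : R := weight p (Num.max z.1 0) z.2.
Definition swt (z : st) : R := source_weight p (Num.max z.1 0) z.2.
Definition damp (z : st) : R := (1 + Num.max z.1 0) `^ (1 - p).

Let max0 (t : R) : 0 <= Num.max t 0. Proof. by rewrite le_max lexx orbT. Qed.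
Let max_id (t : R) : 0 <= t -> Num.max t 0 = t. Proof. by move=> t0; apply/max_idPl. Qed.
Let p0 : 0 < p. Proof. by have := p1; lra. Qed.

Lemma wt_ge0 z : 0 <= wt z.
Proof. exact: weight_ge0. Qed.

Lemma wt_le1 z : wt z <= 1.
Proof.
rewrite /wt /weight; case: ifP => // zx; have b2 := cone_base (max0 _) zx.
rewrite -[leRHS]mulr1; apply: ler_pM; rewrite ?powR_ge0 ?invr_ge0 ?addr_ge0//.
  by rewrite invf_le1 ?ltr_pwDl// lerDl.
rewrite -[leRHS](_ : 1 `^ (- qexp p) = 1); last by rewrite powR1.
by apply: le_powRN_base => //; [lra|rewrite /qexp; have := p1; lra].
Qed.

Lemma wt01 z : 0 <= wt z <= 1.
Proof. by rewrite wt_ge0 wt_le1. Qed.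

Lemma swtE z : swt z = damp z * wt z `^ p.
Proof. by []. Qed.

Lemma damp_gt0 z : 0 < damp z.
Proof. by rewrite powR_gt0// ltr_pwDl. Qed.

Lemma damp_continuous : continuous damp.
Proof.
apply: continuous_powR_comp; first by cont.
by move=> z; rewrite ltr_pwDl.
Qed.

Lemma pos_continuous : continuous pos.
Proof. by rewrite /pos; cont. Qed.

Definition duhz (F : st -> R) (z : st) : R := duh F (Num.max z.1 0) z.2.

Lemma duhz_continuous (F : st -> R) : continuous F -> continuous (duhz F).
Proof.
move=> cF; apply: (@continuous_compose _ _ _ _ (fun z : st => (Num.max z.1 0, z.2))
  (duh_continuous cF)); cont.
Qed.

Lemma duhz_le (F : st -> R) (A : R) z : continuous F -> 0 <= A ->
  (forall z, 0 <= z.1 -> `|F z| <= A * swt z) ->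
  `|duhz F z| <= john_constant p * A * wt z.
Proof.
move=> cF A0 HF; apply: (john p1 pk cF A0) => // s y s0.
by have := HF (s, y) s0; rewrite /swt /= max_id.
Qed.

Lemma duhz_sub (F G : st -> R) z : continuous F -> continuous G ->
  duhz F z - duhz G z = duhz (fun z => F z - G z) z.
Proof.
move=> cF cG; rewrite /duhz /duh.
have ck (H : st -> R) : continuous H -> continuous (fun s => kir (Num.max z.1 0 - s) (slice H s) z.2).
  by move=> cH; apply: (@continuous_compose _ _ _ _ (fun s : R =>
    ((Num.max z.1 0 - s, s), z.2)) (kir_joint cH)); cont.
rewrite -(cfunctional_sub (oint_cfunctional _ _)); [|exact: ck..].
congr oint; apply/funext => s; rewrite /kir -mulrBr; congr (_ * _).
by rewrite -(cfunctional_sub (@sph_cfunctional R))//; rewrite /slice; cont.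
Qed.

Variables (a G : st -> R) (da dG : 'I_3 -> st -> R).
Hypotheses (ra : regular a da) (rG : regular G dG).
Variables (Ca CG : R).
Hypotheses (Ca0 : 0 <= Ca) (CG0 : 0 <= CG).
Hypothesis aC : forall z, 0 <= z.1 -> `|a z| <= Ca * wt z.
Hypothesis daC : forall i z, 0 <= z.1 -> `|da i z| <= Ca * wt z.
Hypothesis GC : forall z, 0 <= z.1 -> `|G z| <= CG * swt z.
Hypothesis dGC : forall i z, 0 <= z.1 -> `|dG i z| <= CG * swt z.

Local Notation J := (john_constant p).
Variables (eps A : R).
Hypotheses (eps0 : 0 <= eps) (A0 : 0 < A).
(** The explicit part uses at most half of A, and by [small2] the nonlinear part adds at most A/8.
    The same 1/8 bounds the contraction factor: 1/4 is needed for the functions, and the spare room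
    absorbs the second term in the difference of gradients. *)
Hypothesis small1 : eps * (Ca + J * CG) <= A / 2.
Hypothesis small2 : J * p * A `^ (p - 1) <= 1 / 8.

Definition src (w : st -> R) (z : st) : R := eps * G z + damp z * `|w z| `^ p.
Definition dsrc (w : st -> R) (v : 'I_3 -> st -> R) (i : 'I_3) (z : st) : R :=
  eps * dG i z + damp z * (p * rho p (w z) * v i z).

Definition next (w : st -> R) (z : st) : R := eps * a (pos z) + duhz (src w) z.
Definition dnext (w : st -> R) (v : 'I_3 -> st -> R) (i : 'I_3) (z : st) : R :=
  eps * da i (pos z) + duhz (dsrc w v i) z.

Let invariant (w : st -> R) (v : 'I_3 -> st -> R) : Prop :=
  [/\ regular w v, forall z, `|w z| <= A * wt z & forall i z, `|v i z| <= A * wt z].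

Lemma john_constant_ge0 : 0 <= J.
Proof.
rewrite /john_constant !mulr_ge0 ?powR_ge0//.
have q0 : 0 < qexp p by rewrite /qexp; have := p1; lra.
have d0 : 0 < p * qexp p - 1 by rewrite /qexp subr_gt0.
have H : 0 <= 10 * 2 `^ (p * qexp p) / (p * qexp p - 1).
  by rewrite divr_ge0 ?(ltW d0)// mulr_ge0// powR_ge0.
have H2 := mulr_ge0 (ler0n R 2) H.
apply: addr_ge0 => //; apply: divr_ge0 => //; apply: mulr_ge0 => //; exact: ltW.
Qed.

Let J0 := john_constant_ge0.

Let wt_powR z : wt z `^ (p - 1) * wt z = wt z `^ p.
Proof. by rewrite mulrC mulr_powRB1// wt_ge0. Qed.

Let A_powR : A `^ (p - 1) * A = A `^ p.
Proof. by rewrite mulrC mulr_powRB1// ltW. Qed.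

Lemma src_regular w v : regular w v -> regular (src w) (dsrc w v).
Proof.
move=> [cw cv dw]; have [cG cdG dGE] := rG.
have cr := @rho_continuous R p p1; have cd := damp_continuous.
have cp := abs_powR_continuous p1.
have cwp := continuous_compose cp cw.
split.
- by rewrite /src; cont.
- by move=> i; rewrite /dsrc; cont.
- move=> t i x; rewrite /dsrc.
  have d1 := dGE t i x.
  have d2 := @der_comp _ _ _ (slice w t) _ _ _ _ (der_abs_powR p1 (w (t, x))) (dw t i x).
  have d3 : is_derive x (unit_vec i) (fun x : space => damp (t, x)) 0.
    exact: (@der_cst R _ x (unit_vec i) ((1 + Num.max t 0) `^ (1 - p))).
  by rewrite /slice /src; rewrite /slice in d1 d2; der; ring.
Qed.

Let rho_le (w W : R) : 0 <= W -> `|w| <= A * W -> `|rho p w| <= A `^ (p - 1) * W `^ (p - 1).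
Proof.
move=> W0 wW; rewrite norm_rho// -powRM ?(ltW A0)//.
by apply: le_powR_base => //; have := p1; lra.
Qed.

Let rho_v_le (w W v e : R) : 0 <= W -> `|w| <= A * W -> `|v| <= e * W ->
  0 <= e -> W `^ (p - 1) * W = W `^ p ->
  `|p * rho p w * v| <= p * A `^ (p - 1) * e * W `^ p.
Proof.
move=> W0 wW vW e0 WE; rewrite -WE normrM [`|p * _|]normrM (gtr0_norm p0).
have := rho_le W0 wW; move: `|rho p w| (A `^ _) (W `^ _) (normr_ge0 (rho p w)) => r x y r0 rxy.
have -> : p * x * e * (y * W) = p * (x * y) * (e * W) by ring.
by apply: ler_pM; rewrite ?mulr_ge0 ?(ltW p0)// ler_wpM2l// ltW.
Qed.

Lemma src_le w v z : invariant w v -> 0 <= z.1 ->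
  `|src w z| <= (eps * CG + A `^ p) * swt z.
Proof.
move=> [_ wA _] z0; rewrite /src mulrDl; apply: le_trans (ler_normD _ _) (lerD _ _).
  by rewrite normrM (ger0_norm eps0) -mulrA ler_wpM2l// GC.
rewrite normrM (gtr0_norm (damp_gt0 z)) swtE mulrCA ler_wpM2l ?(ltW (damp_gt0 z))//.
rewrite ger0_norm ?powR_ge0// -powRM ?(ltW A0) ?wt_ge0//.
by apply: le_powR_base => //; exact: ltW.
Qed.

Lemma dsrc_le w v i z : invariant w v -> 0 <= z.1 ->
  `|dsrc w v i z| <= (eps * CG + p * A `^ p) * swt z.
Proof.
move=> [_ wA vA] z0; rewrite /dsrc mulrDl; apply: le_trans (ler_normD _ _) (lerD _ _).
  by rewrite normrM (ger0_norm eps0) -mulrA ler_wpM2l// dGC.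
rewrite normrM (gtr0_norm (damp_gt0 z)) swtE [leRHS]mulrCA.
apply: ler_wpM2l; first exact: ltW (damp_gt0 z).
apply: le_trans (rho_v_le (wt_ge0 z) (wA z) (vA i z) (ltW A0) (wt_powR z)) _.
by rewrite -!mulrA [A `^ _ * (A * _)]mulrA A_powR.
Qed.

Let small_A : eps * Ca + J * (eps * CG + p * A `^ p) <= A.
Proof.
have := small1; have := ler_wpM2r (ltW A0) small2.
have -> : J * p * A `^ (p - 1) * A = J * (p * A `^ p) by rewrite -A_powR; ring.
by have := A0; lra.
Qed.

Let next_invariant w v : invariant w v -> invariant (next w) (dnext w v).
Proof.
move=> Hwv; have [rw wA vA] := Hwv; have rs := src_regular rw.
have [cs cds dsE] := rs; have [ca cda daE] := ra.
have cpos := pos_continuous.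
have CGp : 0 <= eps * CG + p * A `^ p.
  by rewrite addr_ge0 ?mulr_ge0 ?powR_ge0// ltW.
have CGp' : 0 <= eps * CG + A `^ p by rewrite addr_ge0 ?mulr_ge0 ?powR_ge0.
have le' : eps * CG + A `^ p <= eps * CG + p * A `^ p.
  by rewrite lerD2l ler_peMl ?powR_ge0//; have := p1; lra.
split.
- split.
  + by have cz := duhz_continuous cs; rewrite /next; cont.
  + by move=> i; have cz := duhz_continuous (cds i); rewrite /dnext; cont.
  + move=> t i x; rewrite /slice /next /dnext /duhz /pos /=.
    have d1 := daE (Num.max t 0) i x; have d2 := duh_space (Num.max t 0) i x rs.
    by rewrite /slice in d1; der; ring.
- move=> z; apply: le_trans (ler_normD _ _) _.
  have H1 : `|eps * a (pos z)| <= eps * Ca * wt z.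
    rewrite normrM (ger0_norm eps0) -mulrA ler_wpM2l//.
    by have := aC (z := pos z) (max0 _); rewrite /wt /= max_id.
  have H2 : `|duhz (src w) z| <= J * (eps * CG + A `^ p) * wt z.
    by apply: duhz_le => // z' z0; exact: (src_le Hwv z0).
  apply: le_trans (lerD H1 H2) _; rewrite -mulrDl ler_wpM2r ?wt_ge0//.
  apply: le_trans small_A; rewrite lerD2l ler_wpM2l//.
- move=> i z; apply: le_trans (ler_normD _ _) _.
  have H1 : `|eps * da i (pos z)| <= eps * Ca * wt z.
    rewrite normrM (ger0_norm eps0) -mulrA ler_wpM2l//.
    by have := daC i (z := pos z) (max0 _); rewrite /wt /= max_id.
  have H2 : `|duhz (dsrc w v i) z| <= J * (eps * CG + p * A `^ p) * wt z.
    by apply: duhz_le => // z' z0; exact: (dsrc_le i Hwv z0).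
  by apply: le_trans (lerD H1 H2) _; rewrite -mulrDl ler_wpM2r ?wt_ge0.
Qed.

Let abs_diff (w w' : st -> R) (D : R) z : `|w z| <= A * wt z -> `|w' z| <= A * wt z ->
  `|w z - w' z| <= D * wt z ->
  `|damp z * `|w z| `^ p - damp z * `|w' z| `^ p| <= p * A `^ (p - 1) * D * swt z.
Proof.
move=> wA w'A wD; rewrite -mulrBr normrM (gtr0_norm (damp_gt0 z)) swtE.
rewrite mulrCA ler_wpM2l ?(ltW (damp_gt0 z))//.
apply: le_trans (abs_powR_diff p1 wA w'A) _.
rewrite powRM ?(ltW A0) ?wt_ge0// -wt_powR.
have P : 0 <= p * (A `^ (p - 1) * wt z `^ (p - 1)) by rewrite !mulr_ge0 ?powR_ge0// ltW.
apply: le_trans (ler_wpM2l P wD) _.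
by rewrite le_eqVlt; apply/orP; left; apply/eqP; ring.
Qed.

Let next_diff w v w' v' (D : R) : invariant w v -> invariant w' v' -> 0 <= D ->
  (forall z, `|w z - w' z| <= D * wt z) ->
  forall z, `|next w z - next w' z| <= D / 8 * wt z.
Proof.
move=> Hw Hw' D0 wD z; have [rw wA _] := Hw; have [rw' w'A _] := Hw'.
have [cs _ _] := src_regular rw; have [cs' _ _] := src_regular rw'.
have -> : next w z - next w' z = duhz (fun z => src w z - src w' z) z.
  by rewrite -(duhz_sub z cs cs') /next opprD addrACA subrr add0r.
have P0 : 0 <= p * A `^ (p - 1) * D by rewrite !mulr_ge0 ?powR_ge0// ltW.
apply: le_trans (@duhz_le _ (p * A `^ (p - 1) * D) _ _ P0 _) _.
- by apply: continuous_add => //; exact: continuous_opp.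
- move=> z' _; have -> : src w z' - src w' z' =
    damp z' * `|w z'| `^ p - damp z' * `|w' z'| `^ p by rewrite /src; ring.
  exact: abs_diff.
rewrite ler_wpM2r ?wt_ge0//.
have := ler_wpM2r D0 small2.
have -> : J * p * A `^ (p - 1) * D = J * (p * A `^ (p - 1) * D) by ring.
by lra.
Qed.

(** Uses rho(w) v - rho(w') v' = rho(w) (v - v') + (rho(w) - rho(w')) v'. In the second term
    [rho_holder] takes the square root of a difference of order 4^-n, hence the rate 2^-n. The
    weights match because W^(p-3/2) W^(1/2) W = W^p, and with the constant 4p both terms receive the
    same bound. *)
Let dnext_diff w v w' v' (n : nat) : invariant w v -> invariant w' v' ->
  (forall z, `|w z - w' z| <= 2 * A * 4^-1 ^+ n * wt z) ->
  (forall i z, `|v i z - v' i z| <= 4 * p * A * 2^-1 ^+ n * wt z) ->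
  forall i z, `|dnext w v i z - dnext w' v' i z| <= 4 * p * A * 2^-1 ^+ n.+1 * wt z.
Proof.
move=> Hw Hw' wD vD i z; have [rw wA vA] := Hw; have [rw' w'A v'A] := Hw'.
have [_ cs _] := src_regular rw; have [_ cs' _] := src_regular rw'.
have -> : dnext w v i z - dnext w' v' i z = duhz (fun z => dsrc w v i z - dsrc w' v' i z) z.
  by rewrite -(duhz_sub z (cs i) (cs' i)) /dnext opprD addrACA subrr add0r.
pose e : R := 2^-1 ^+ n.
have e0 : 0 <= e by rewrite exprn_ge0.
pose D : R := p * A `^ (p - 1) * (4 * p * A * e + 4 * p * A * e).
have D0 : 0 <= D.
  have pA : 0 <= p * A by rewrite mulr_ge0 ?ltW.
  by rewrite /D mulr_ge0 ?addr_ge0 ?mulr_ge0 ?powR_ge0// ltW.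
apply: le_trans (@duhz_le _ D _ _ D0 _) _.
- by apply: continuous_add => //; exact: continuous_opp.
- move=> z' _; have -> : dsrc w v i z' - dsrc w' v' i z' =
    damp z' * (p * rho p (w z') * (v i z' - v' i z') +
    p * (rho p (w z') - rho p (w' z')) * v' i z') by rewrite /dsrc; ring.
  rewrite normrM (gtr0_norm (damp_gt0 z')) swtE [leRHS]mulrCA.
  apply: ler_wpM2l; first exact: ltW (damp_gt0 z').
  have W0 := wt_ge0 z'; set W := wt z' in W0 *.
  have WE : W `^ (p - 1) * W = W `^ p by exact: wt_powR.
  apply: le_trans (ler_normD _ _) _.
  have -> : D * W `^ p = p * A `^ (p - 1) * (4 * p * A * e) * W `^ p +
    p * A `^ (p - 1) * (4 * p * A * e) * W `^ p by rewrite /D; ring.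
  apply: lerD.
    have E0 : 0 <= 4 * p * A * e by rewrite !mulr_ge0// ltW.
    exact: rho_v_le W0 (wA z') (vD i z') E0 WE.
  have pD (X : R) : X `^ (p - 1) = X `^ (p - 3 / 2) * X `^ 2^-1.
    rewrite -powRD; last by apply/implyP => /eqP; have := p1; lra.
    by congr (_ `^ _); field.
  have H : `|rho p (w z') - rho p (w' z')| <= 4 * p * A `^ (p - 1) * e * W `^ (p - 1).
    apply: le_trans (rho_holder p1 (wA z') (w'A z')) _.
    have H2 : `|w z' - w' z'| `^ 2^-1 <= 2 * (A `^ 2^-1 * W `^ 2^-1) * e.
      apply: (@le_trans _ _ ((2 * A * 4^-1 ^+ n * W) `^ 2^-1)).
        by apply: le_powR_base => //; exact: wD.
      have -> : 2 * A * 4^-1 ^+ n * W = 2 * (A * W) * (e * e).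
        have -> : 4^-1 = 2^-1 * 2^-1 :> R by field.
        by rewrite exprMn -/e; ring.
      have AW0 : 0 <= A * W by exact: mulr_ge0 (ltW A0) W0.
      rewrite (powR12_sqrt (ltW A0)) (powR12_sqrt W0).
      rewrite powR12_sqrt; last exact: mulr_ge0 (mulr_ge0 (ler0n _ 2) AW0) (mulr_ge0 e0 e0).
      rewrite sqrtrM; last exact: mulr_ge0 (ler0n _ 2) AW0.
      rewrite -expr2 sqrtr_sqr (ger0_norm e0) ler_wpM2r//.
      rewrite sqrtrM// sqrtrM ?(ltW A0)// ler_wpM2r ?mulr_ge0 ?sqrtr_ge0//.
      rewrite -(@ler_pXn2r _ 2)// ?nnegrE ?sqrtr_ge0// sqr_sqrtr//.
      by rewrite expr2; lra.
    have P : 0 <= 2 * p * (A * W) `^ (p - 3 / 2) by rewrite !mulr_ge0 ?powR_ge0// ltW.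
    apply: le_trans (ler_wpM2l P H2) _.
    rewrite powRM ?(ltW A0)// !pD.
    by rewrite le_eqVlt; apply/orP; left; apply/eqP; ring.
  rewrite !normrM (gtr0_norm p0) -WE.
  have P1 : 0 <= `|rho p (w z') - rho p (w' z')| by exact: normr_ge0.
  apply: (@le_trans _ _ (p * (4 * p * A `^ (p - 1) * e * W `^ (p - 1)) * (A * W))).
    exact: ler_pM (mulr_ge0 (ltW p0) P1) (normr_ge0 _) (ler_wpM2l (ltW p0) H) (v'A i z').
  by rewrite le_eqVlt; apply/orP; left; apply/eqP; ring.
rewrite ler_wpM2r ?wt_ge0//.
have X0 : 0 <= 4 * p * A * e + 4 * p * A * e.
  by rewrite addr_ge0// !mulr_ge0// ltW.
have := ler_wpM2r X0 small2.
have -> : J * p * A `^ (p - 1) * (4 * p * A * e + 4 * p * A * e) = J * D by rewrite /D; ring.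
rewrite exprS -/e => H; apply: le_trans H _.
have : 0 <= p * A * e by rewrite !mulr_ge0// ltW.
have -> : 1 / 8 * (4 * p * A * e + 4 * p * A * e) = p * A * e by field.
have -> : 4 * p * A * (2^-1 * e) = 2 * (p * A * e) by field.
lra.
Qed.

Let it (n : nat) : (st -> R) * ('I_3 -> st -> R) :=
  iter n (fun s => (next s.1, dnext s.1 s.2))
    (fun z => eps * a (pos z), fun i z => eps * da i (pos z)).

Let it_invariant n : invariant (it n).1 (it n).2.
Proof.
elim: n => [|n ih]; last exact: next_invariant.
have [ca cda daE] := ra; have cpos := pos_continuous.
have eC : eps * Ca <= A.
  have := small1; have : 0 <= eps * (J * CG) by apply: mulr_ge0 => //; exact: mulr_ge0.
  by have := A0; lra.
split.
- split; rewrite /=; [by cont|by move=> i; cont|].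
  move=> t i x; rewrite /slice /pos /=; have d1 := daE (Num.max t 0) i x.
  by rewrite /slice in d1; der; ring.
- move=> z /=; rewrite normrM (ger0_norm eps0).
  apply: (@le_trans _ _ (eps * Ca * wt z)); last by rewrite ler_wpM2r// wt_ge0.
  rewrite -mulrA ler_wpM2l//.
  by have := aC (z := pos z) (max0 _); rewrite /wt /= max_id.
- move=> i z /=; rewrite normrM (ger0_norm eps0).
  apply: (@le_trans _ _ (eps * Ca * wt z)); last by rewrite ler_wpM2r// wt_ge0.
  rewrite -mulrA ler_wpM2l//.
  by have := daC i (z := pos z) (max0 _); rewrite /wt /= max_id.
Qed.

Let it_diff n : (forall z, `|(it n.+1).1 z - (it n).1 z| <= 2 * A * 4^-1 ^+ n * wt z) /\
  (forall i z, `|(it n.+1).2 i z - (it n).2 i z| <= 4 * p * A * 2^-1 ^+ n * wt z).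
Proof.
elim: n => [|n [ih1 ih2]].
  have [_ H1 H2] := it_invariant 1; have [_ H3 H4] := it_invariant 0.
  rewrite !expr0 !mulr1; split => [z|i z].
    by apply: le_trans (ler_normB _ _) _; have := H1 z; have := H3 z; lra.
  apply: le_trans (ler_normB _ _) _; have := H2 i z; have := H4 i z.
  have : 0 <= (4 * p - 2) * (A * wt z).
    by rewrite !mulr_ge0 ?wt_ge0 ?(ltW A0)//; have := p1; lra.
  by lra.
split=> [z|i z].
  have D0 : 0 <= 2 * A * 4^-1 ^+ n by rewrite !mulr_ge0 ?exprn_ge0// ltW.
  apply: le_trans (next_diff (it_invariant n.+1) (it_invariant n) D0 ih1 z) _.
  rewrite ler_wpM2r ?wt_ge0// exprS; move: D0; set e := 4^-1 ^+ n.
  have -> : 2 * A * (4^-1 * e) = (2 * A * e) / 4 by field.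
  by move=> D0; lra.
exact: (dnext_diff (it_invariant n.+1) (it_invariant n) ih1 ih2).
Qed.

Lemma fixed_point : exists (w : st -> R) (v : 'I_3 -> st -> R),
  [/\ regular w v, forall z, `|w z| <= A * wt z &
      forall z, w z = eps * a (pos z) + duhz (src w) z].
Proof.
pose B : R := 4 * p * A.
have B0 : 0 <= B by rewrite /B !mulr_ge0// ltW.
have h1 n z : `|(it n.+1).1 z - (it n).1 z| <= B * 2^-1 ^+ n * wt z.
  apply: le_trans ((it_diff n).1 z) _; rewrite ler_wpM2r ?wt_ge0//.
  apply: ler_pM; rewrite ?mulr_ge0 ?exprn_ge0 ?(ltW A0)//.
    by rewrite /B; have := p1; have := A0; nra.
  by apply: lerXn2r; rewrite ?nnegrE//; lra.
have c1 n : continuous (it n).1 by have [[]] := it_invariant n.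
have c2 n i : continuous ((it n).2 i) by have [[]] := it_invariant n.
have [w [cw Hw]] := geometric_limit B0 wt01 h1 c1.
have Hv i := geometric_limit B0 wt01 (fun n => (it_diff n).2 i) (c2^~ i).
have [v Hv'] := choice Hv.
have cv i : continuous (v i) by case: (Hv' i).
have drop (C x : R) n z : 0 <= C -> x <= C * 2^-1 ^+ n * wt z -> x <= C * 2^-1 ^+ n.
  move=> C0 /le_trans; apply; rewrite ler_piMr ?wt_le1// mulr_ge0// exprn_ge0//.
have B20 : 0 <= 2 * B by rewrite mulr_ge0.
have rw : regular w v.
  split=> // t i x.
  apply: (@limit_derive _ _ (fun n => slice (it n).1 t) (fun n => slice ((it n).2 i) t)
    (slice w t) (slice (v i) t) (unit_vec i) (2 * B)).
  - by move=> n y; have [[_ _ H] _ _] := it_invariant n; exact: H.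
  - by move=> n; rewrite /slice; have := c2 n i => ?; cont.
  - by rewrite /slice; cont.
  - by move=> n y; apply: drop (Hw n (t, y)).
  - by move=> n y; apply: drop ((Hv' i).2 n (t, y)).
have wA z : `|w z| <= A * wt z.
  rewrite -subr_le0; apply: (@half_pow_small _ (2 * B)) => n.
  have [_ H _] := it_invariant n; have := drop _ _ _ _ B20 (Hw n z).
  have := H z; have := ler_normD (w z - (it n).1 z) ((it n).1 z); rewrite subrK.
  by lra.
have vA i z : `|v i z| <= A * wt z.
  rewrite -subr_le0; apply: (@half_pow_small _ (2 * B)) => n.
  have [_ _ H] := it_invariant n; have := drop _ _ _ _ B20 ((Hv' i).2 n z).
  have := H i z; have := ler_normD (v i z - (it n).2 i z) ((it n).2 i z); rewrite subrK.
  by lra.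
exists w, v; split=> // z.
apply/eqP; rewrite -subr_eq0 -normr_eq0 eq_le normr_ge0 andbT.
(* Both w and its image lie within a multiple of 2^-n of the iterate n + 1, the image by the
   contraction estimate. *)
apply: (@half_pow_small _ (2 * B + 2 * B)) => n.
have E0 : 0 <= 2 * B * 2^-1 ^+ n by rewrite mulr_ge0// exprn_ge0.
have I : invariant w v by split.
have H1 := next_diff I (it_invariant n) E0 (Hw n) z.
have H2 := Hw n.+1 z.
have {}H1 : `|next w z - next (it n).1 z| <= 2 * B * 2^-1 ^+ n.
  apply: le_trans H1 _; rewrite -[leRHS]mulr1; apply: ler_pM; rewrite ?wt_ge0 ?wt_le1//.
    by rewrite divr_ge0.
  by move: E0; move: (_ * _ ^+ _) => y; lra.
have {}H2 := drop _ _ _ _ B20 H2.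
have -> : w z - (eps * a (pos z) + duhz (src w) z) =
  (w z - (it n.+1).1 z) - (next w z - next (it n).1 z).
  rewrite -/(next w z) [(it n.+1).1 z]/(next (it n).1 z) -/(next (it n).1 z).
  by move: (next w z) (next _ z) (w z) => x1 x2 x3; ring.
apply: le_trans (ler_normB _ _) _; rewrite mulrDl; apply: lerD => //.
apply: le_trans H2 _; rewrite exprS mulrCA ler_piMl//.
lra.
Qed.

End fixed_point.

(** * Lebesgue integrals over R^3 *)

Section measure_space.
Context {R : realType}.
Local Notation mu := (@lebesgue_measure R).
Local Notation space := (R * R * R)%type.

(* Caratheodory: such a k is the limit of the functions equal to k at the grid
   point left of the second variable. *)
Lemma measurable_caratheodory d (T : measurableType d) (k : T * measurableTypeR R -> R) :
  (forall x, continuous (fun y : R => k (x, y))) ->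
  (forall y, measurable_fun setT (fun x => k (x, y))) ->
  measurable_fun [set: T * measurableTypeR R] k.
Proof.
move=> ck mk.
pose grid (n : nat) (y : R) : R := (Num.floor (n.+1%:R * y))%:~R / n.+1%:R.
have gridP n y : grid n y <= y < grid n y + n.+1%:R^-1.
  have n0 : 0 < n.+1%:R :> R by rewrite ltr0n.
  rewrite /grid ler_pdivrMr// -[X in _ + X]mul1r -mulrDl ltr_pdivlMr//.
  rewrite [y * _]mulrC; have := floor_itv (n.+1%:R * y).
  by rewrite intrD.
apply: (@measurable_fun_cvg _ _ _ setT (fun n z => k (z.1, grid n z.2))) => [n|z _].
- move=> _ B mB; rewrite setTI.
  have -> : (fun z : T * measurableTypeR R => k (z.1, grid n z.2)) @^-1` B =
    \bigcup_(m : int) (((fun x => k (x, m%:~R / n.+1%:R)) @^-1` B) `*`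
      [set y : measurableTypeR R | Num.floor (n.+1%:R * y) == m]).
    apply/seteqP; split => [z Bz|z [m _ [/= Bm /eqP mE]]]; last by rewrite /= /grid mE.
    by exists (Num.floor (n.+1%:R * z.2)) => //; split => /=.
  apply: countable_bigcupT_measurable => [|m]; first exact: countableP.
  apply: measurableX.
    by rewrite -[X in measurable X]setTI; exact: mk.
  have n0 : 0 < n.+1%:R :> R by rewrite ltr0n.
  have -> : [set y : measurableTypeR R | Num.floor (n.+1%:R * y) == m] =
      `[m%:~R / n.+1%:R, (m + 1)%:~R / n.+1%:R[%classic.
    apply/seteqP; split => y /=; rewrite in_itv /= ler_pdivrMr// ltr_pdivlMr// [y * _]mulrC.
      by move=> /eqP <-; exact: floor_itv.
    by move=> H; apply/eqP; exact: floor_def.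
  exact: measurable_itv.
- apply: (@cvg_comp _ _ _ (fun n => grid n z.2) (fun y => k (z.1, y)) _ (nbhs z.2)).
    apply/cvgrPdist_le => e e0; near=> n.
    have /andP[H1 H2] := gridP n z.2.
    rewrite ger0_norm ?subr_ge0//; apply: (@le_trans _ _ n.+1%:R^-1).
      by rewrite lerBlDl ltW.
    by apply/ltW; near: n; exact: near_infty_natSinv_lt (PosNum e0).
  by case: z => a b; exact: ck.
Unshelve. all: by end_near. Qed.

Lemma space_measurable (k : space -> R) : continuous k ->
  measurable_fun [set: mspace R] k.
Proof.
move=> ck; apply: measurable_caratheodory => [x|y].
  by move=> y; apply: (@continuous_compose _ _ _ k (fun y => (x, y)) ck); cont.
apply: (@measurable_caratheodory _ _ (fun x => k (x, y))) => [a|b].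
  by move=> b; apply: (@continuous_compose _ _ _ k (fun b => (a, b, y)) ck); cont.
by apply: continuous_measurable_fun => a;
  apply: (@continuous_compose _ _ _ k (fun a => (a, b, y)) ck); cont.
Qed.

Lemma spacetime_measurable (k : R * space -> R) : continuous k ->
  measurable_fun [set: mspacetime R] k.
Proof.
move=> ck.
(* [measurable_caratheodory] takes the real variable last, so time and space are swapped. *)
have m1 : measurable_fun [set: mspace R * measurableTypeR R] (fun z => k (z.2, z.1)).
  apply: (@measurable_caratheodory _ _ (fun z => k (z.2, z.1))) => [x|y].
    by move=> y; apply: (@continuous_compose _ _ _ k (fun y => (y, x)) ck); cont.
  by apply: space_measurable => x; apply: (@continuous_compose _ _ _ k (fun x => (y, x)) ck); cont.
have := measurableT_comp m1 (@measurable_swap _ _ _ _).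
by apply: eq_measurable_fun => -[].
Qed.

Let integral_line (k : R -> R) (n : R) : continuous k ->
  (forall x, n <= `|x| -> k x = 0) -> 0 <= n ->
  (\int[mu]_x (k x)%:E)%E = (oint (- n) n k)%:E.
Proof.
move=> ck k0 n0; have nn : - n <= n by lra.
rewrite (oint_Rintegral ck nn) /Rintegral fineK; last first.
  by apply: integrable_fin_num => //; exact: continuous_integrable.
rewrite [RHS]integral_mkcond; apply: eq_integral => x _.
rewrite patchE; case: ifPn => //; rewrite notin_setE /= in_itv /= => H.
rewrite k0// leNgt; apply/negP => H2; apply: H; apply/andP.
by move: H2; rewrite ltr_norml => /andP[a b]; split; exact: ltW.
Qed.

Let fubini_line d (T : measurableType d) (m1 : {sigma_finite_measure set T -> \bar R})
    (k : T * measurableTypeR R -> R) (n : R) : 0 <= n ->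
  (forall z, continuous (fun c : R => k (z, c))) ->
  (forall z c, n <= `|c| -> k (z, c) = 0) ->
  (m1 \x mu)%E.-integrable [set: T * measurableTypeR R] (EFin \o k) ->
  (\int[m1 \x mu]_z (k z)%:E = \int[m1]_z (oint (- n) n (fun c => k (z, c)))%:E)%E.
Proof.
move=> n0 ck k0 ik; rewrite -(integral12_prod_meas1 ik) /fubini_F.
by apply: eq_integral => z _; apply: integral_line => // c; exact: k0.
Qed.

Let integrable_of_vanish d (T : measurableType d) (m : {measure set T -> \bar R})
    (k : T -> R) (B : set T) (M : R) : measurable B -> (m B < +oo)%E ->
  measurable_fun setT k -> (forall x, ~ B x -> k x = 0) -> (forall x, B x -> `|k x| <= M) ->
  m.-integrable setT (EFin \o k).
Proof.
move=> mB Bfin mk k0 kM.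
have -> : EFin \o k = (EFin \o k) \_ B.
  apply/funext => x; rewrite patchE; case: ifPn => //; rewrite notin_setE => /k0 /= -> //.
apply/(integrable_mkcond _ mB); apply: measurable_bounded_integrable => //.
  exact: measurable_funTS.
by exists M; split; [exact: num_real|move=> y My x Bx; exact: le_trans (kM x Bx) (ltW My)].
Qed.

Let mu1 : {sigma_finite_measure set (measurableTypeR R) -> \bar R} := mu.
Let sigma_finite_square :
  sigma_finite [set: measurableTypeR R * measurableTypeR R] (mu1 \x mu1)%E.
Proof.
by case: (lebesgue_integral_fubini.measure_function_Measure_isSigmaFinite__to__measure_function_isSigmaFinite mu1 mu1).
Qed.

(* The library does not register its proof that a product of sigma-finite
   measures is sigma-finite as a canonical structure. *)
Let mu2 : {sigma_finite_measure set (measurableTypeR R * measurableTypeR R)%type -> \bar R} :=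
  HB.pack_for {sigma_finite_measure set (measurableTypeR R * measurableTypeR R)%type -> \bar R}
    (mu1 \x mu1)%E (@Measure_isSigmaFinite.Build _ (measurableTypeR R * measurableTypeR R)%type
      R (mu1 \x mu1)%E sigma_finite_square).

Definition cube (n : R) : set (mspace R) :=
  (`[- n, n]%classic `*` `[- n, n]%classic) `*` `[- n, n]%classic.

Let square_measure (n : R) : 0 <= n ->
  (mu \x mu)%E (`[- n, n]%classic `*` `[- n, n]%classic) = ((2 * n) * (2 * n))%:E.
Proof.
move=> n0; rewrite product_measure1E; [|exact: measurable_itv..].
rewrite /= lebesgue_measure_itv /= lte_fin; case: ltP => H.
  by rewrite -EFinB -EFinM; congr EFin; ring.
have -> : n = 0 by lra.
by rewrite mul0e !mulr0.
Qed.

Lemma cube_measure (n : R) : 0 <= n -> (leb3 (cube n) = ((2 * n) * (2 * n) * (2 * n))%:E)%E.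
Proof.
move=> n0; apply: etrans (product_measure1E _ _ _ _) _.
- by apply: measurableX; exact: measurable_itv.
- exact: measurable_itv.
rewrite [RHS]EFinM; congr (_ * _)%E; first exact: square_measure.
rewrite /= lebesgue_measure_itv /= lte_fin; case: ltP => H.
  by rewrite -EFinB; congr EFin; ring.
have -> : n = 0 by lra.
by rewrite !mulr0.
Qed.

Lemma measurable_cube n : measurable (cube n).
Proof. by apply: measurableX; [apply: measurableX|]; exact: measurable_itv. Qed.

Lemma compact_cube n : compact (cube n : set space).
Proof. by apply: compact_setX; [apply: compact_setX|]; exact: segment_compact. Qed.

Lemma continuous_cube_bound (k : space -> R) (n : R) : continuous k ->
  exists M, forall x, cube n x -> `|k x| <= M.
Proof.
move=> ck; have /compact_bounded[M [_ HM]] := continuous_compact (continuous_subspaceT ck) (@compact_cube n).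
by exists (M + 1) => x Kx; apply: (HM (M + 1)); [lra|exists x].
Qed.

(** The bridge from Lebesgue integrals to [box]: Fubini splits off the last coordinate of the
    iterated product twice, and each integral over the line reduces to [-n, n]. Integrability holds
    because a continuous function is bounded on the cube, of finite measure. *)
Lemma integral_vanish (k : space -> R) (n : R) : continuous k -> vanish n k -> 0 <= n ->
  (\int[leb3]_x (k x)%:E)%E = (box n k)%:E.
Proof.
move=> ck k0 n0.
have off m (x : space) i : ~ `|coord i x| <= m -> m <= `|coord i x|.
  by move=> H; rewrite leNgt; apply/negP => /ltW.
have kc (x : space) : ~ cube n x -> k x = 0.
  move=> H; apply: contra_notP H => kx.
  have H i : - n <= coord i x <= n.
    rewrite -ler_norml; apply: contra_notP kx => /off; exact: k0.
  by split; [split|]; rewrite /= in_itv /=; [exact: (H i0)|exact: (H i1)|exact: (H i2)].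
have [M HM] := continuous_cube_bound n ck.
have c3 a b : continuous (fun c => k (a, b, c)).
  by apply: (@continuous_compose _ _ _ k (fun c => (a, b, c)) ck); cont.
have c2 : continuous (fun z : R * R => oint (- n) n (fun c => k (z, c))).
  exact: (cfunctional_continuous (oint_cfunctional _ _) ck).
have c2' a : continuous (fun b => oint (- n) n (fun c => k (a, b, c))).
  by apply: (@continuous_compose _ _ _ _ (fun b : R => (a, b)) c2); cont.
have c1 : continuous (fun a => oint (- n) n (fun b => oint (- n) n (fun c => k (a, b, c)))).
  exact: (cfunctional_continuous (oint_cfunctional _ _) c2).
have v3 a b c : n <= `|c| -> k (a, b, c) = 0 by move=> H; apply: (k0 _ i2).
have v2 a b : n <= `|b| -> oint (- n) n (fun c => k (a, b, c)) = 0.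
  by move=> H; apply: oint_eq0 => s _; exact: (k0 (a, b, _) i1).
have v1 a : n <= `|a| -> oint (- n) n (fun b => oint (- n) n (fun c => k (a, b, c))) = 0.
  by move=> H; apply: oint_eq0 => s _; apply: oint_eq0 => u _; exact: (k0 (a, _, _) i0).
have c3' (z : R * R) : continuous (fun c : R => k (z, c)) by case: z; exact: c3.
have v3' (z : R * R) c : n <= `|c| -> k (z, c) = 0 by case: z => a b; exact: v3.
have i3 : (mu2 \x mu)%E.-integrable [set: mspace R] (EFin \o k).
  apply: (integrable_of_vanish (measurable_cube n) _ (space_measurable ck) kc HM).
  by rewrite cube_measure// ltry.
have F1 := @fubini_line _ _ mu2 k n n0 c3' v3' i3.
apply: etrans F1 _.
have [M2 HM2] : exists M, forall z : R * R, (`[- n, n]%classic `*` `[- n, n]%classic) z ->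
    `|oint (- n) n (fun c => k (z, c))| <= M.
  have cK : compact (`[- n, n]%classic `*` `[- n, n]%classic : set (R * R)).
    by apply: compact_setX; exact: segment_compact.
  have /compact_bounded[M' [_ HM']] := continuous_compact (continuous_subspaceT c2) cK.
  by exists (M' + 1) => x Kx; apply: (HM' (M' + 1)); [lra|exists x].
have i2 : (mu1 \x mu)%E.-integrable [set: measurableTypeR R * measurableTypeR R]
    (EFin \o (fun z => oint (- n) n (fun c => k (z, c)))).
  apply: (@integrable_of_vanish _ _ (mu1 \x mu)%E _ (`[- n, n]%classic `*` `[- n, n]%classic) M2) HM2.
  - by apply: measurableX; exact: measurable_itv.
  - by have := square_measure n0 => /= ->; exact: ltry.
  - apply: (@measurable_caratheodory _ _ (fun z => oint (- n) n (fun c => k (z, c)))) => [a|b].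
      exact: c2'.
    apply: continuous_measurable_fun => a.
    by apply: (@continuous_compose _ _ _ _ (fun a : R => (a, b)) c2); cont.
  - move=> [a b] H; apply: contra_notP H => H.
    split; rewrite /= in_itv /= -ler_norml; apply: contra_notP H => H.
      apply: oint_eq0 => s _; apply: (k0 (a, b, _) i0); exact: (off _ (a, b, a) i0).
    by apply: v2; exact: (off _ (a, b, a) i1).
rewrite (@fubini_line _ _ mu1 (fun z => oint (- n) n (fun c => k (z, c))) n n0 c2' v2 i2); exact: integral_line c1 v1 n0.
Qed.

Lemma Rintegral_vanish (k : space -> R) (n : R) : continuous k -> vanish n k -> 0 <= n ->
  \int[leb3]_x k x = box n k.
Proof. by move=> ck k0 n0; rewrite /Rintegral (integral_vanish ck k0 n0). Qed.

Lemma Lnorm_vanish (k : space -> R) (n : R) : continuous k -> vanish n k -> 0 <= n ->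
  Lnorm leb3 2%:E (EFin \o k) = (Num.sqrt (box n (fun x => k x ^+ 2)))%:E.
Proof.
move=> ck k0 n0; rewrite unlock /=.
have c2 : continuous (fun x => k x ^+ 2) by cont.
have v2 : vanish n (fun x => k x ^+ 2).
  by move=> x i H; rewrite (k0 x i H) expr0n.
have E : (\int[leb3]_x `|(k x)%:E| `^ 2)%E = (box n (fun x => k x ^+ 2))%:E.
  rewrite -(integral_vanish c2 v2 n0); apply: eq_integral => x _.
  by rewrite /= powR_mulrn// real_normK// num_real.
have B0 : 0 <= box n (fun x => k x ^+ 2).
  rewrite -lee_fin -E; apply: integral_ge0 => x _; exact: poweR_ge0.
by rewrite E poweR_EFin powR12_sqrt.
Qed.

Lemma L2_vanish (k : space -> R) (n : R) : continuous k -> vanish n k -> 0 <= n -> L2 k.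
Proof.
move=> ck k0 n0; rewrite /L2 inE /=; apply/andP; split.
  by rewrite inE; exact: space_measurable.
by rewrite inE /finLfun /= /finite_norm (Lnorm_vanish ck k0 n0) ltry.
Qed.

End measure_space.

(** * Test functions and energy spaces *)

Section support.
Context {R : realType}.

Lemma derive_notin_supp (V : normedModType R) (f : V -> R) (v z : V) : ~ supp f z ->
  is_derive z v f 0.
Proof.
move=> nz; have nf : \forall y \near z, 0 = f y.
  have : nbhs z (~` supp f) by apply: open_nbhs_nbhs; split=> //; apply: closed_openC; exact: closed_closure.
  apply: filterS => y Hy; apply/esym; apply: contra_notP Hy => /eqP fy.
  exact: subset_closure.
exact: (near_eq_is_derive nf (der_cst z v (0 : R))).
Qed.

Lemma notin_supp (V : normedModType R) (f : V -> R) (z : V) : ~ supp f z -> f z = 0.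
Proof. by move=> nz; apply: contra_notP nz => /eqP fz; exact: subset_closure. Qed.

Lemma supp_derive (V : normedModType R) (f : V -> R) (v : V) :
  supp ('D_v f) `<=` supp f.
Proof.
rewrite [X in _ `<=` X](closure_id (supp f)).1; last exact: closed_closure.
apply: closure_subset => z /= Dz; apply: contrapT => nz; move: Dz.
by have [_ ->] := derive_notin_supp v nz; rewrite eqxx.
Qed.

Lemma Cc_infty_derive (V : normedModType R) (f : V -> R) (v : V) :
  Cc_infty f -> Cc_infty ('D_v f).
Proof.
move=> [Cf cf]; split=> [k|]; first by have [_ /(_ v)[_]] := Cf k.+1.
by apply: subclosed_compact cf (@supp_derive _ f v); exact: closed_closure.
Qed.

Lemma Cc_infty_continuous (V : normedModType R) (f : V -> R) : Cc_infty f -> continuous f.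
Proof. by move=> [/(_ 0)]. Qed.

Lemma Cc_infty_is_derive (V : normedModType R) (f : V -> R) (v z : V) :
  Cc_infty f -> is_derive z v f ('D_v f z).
Proof. by move=> [/(_ 1)[_ /(_ v)[H _]] _]; split. Qed.

Lemma Cc_infty_bounded_support (V : normedModType R) (f : V -> R) : Cc_infty f ->
  exists2 n : R, 0 <= n & forall z, n <= `|z| -> f z = 0.
Proof.
move=> [_ /compact_bounded[M [_ HM]]]; exists (`|M| + 2); first exact: addr_ge0.
move=> z nz; apply: notin_supp => Hz.
have := HM (`|M| + 1) _ z Hz; have := ler_norm M; rewrite /= => a b.
have : M < `|M| + 1 by lra.
by move=> /b; lra.
Qed.

Lemma coord_norm_le (x : R * R * R) i : `|coord i x| <= `|x|.
Proof.
case: x => [[a b] c]; rewrite !prod_normE /= !le_max.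
by move: i; apply: ord3P; rewrite /coord/= lexx ?orbT.
Qed.

Lemma test_slice_vanish (f : R * (R * R * R) -> R) : Cc_infty f ->
  exists2 n : R, 0 <= n & forall t, vanish n (slice f t).
Proof.
move=> /Cc_infty_bounded_support[n n0 H]; exists n => // t x i nx; apply: H.
by rewrite prod_normE /= le_max (le_trans nx (coord_norm_le x i)) orbT.
Qed.

Lemma test_slice_C1 (f : R * (R * R * R) -> R) t : Cc_infty f ->
  C1 (slice f t) (fun i => slice ('D_(0, unit_vec i) f) t).
Proof.
move=> Cf; split=> [i x|i].
  have := Cc_infty_is_derive (0, unit_vec i) (t, x) Cf.
  move=> /is_derive_line0 H; apply/is_derive_line0.
  have E (h : R) : h *: ((0, unit_vec i) : R * (R * R * R)) + (t, x) =
    (t, h *: unit_vec i + x) by congr pair; rewrite /= scaler0 add0r.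
  by under eq_fun do rewrite /slice -E.
by apply: (@continuous_compose _ _ _ _ (fun x => (t, x)) (Cc_infty_continuous (Cc_infty_derive _ Cf))); cont.
Qed.

Lemma test_time_derive (f : R * (R * R * R) -> R) (t : R) x : Cc_infty f ->
  is_derive t 1 (fun t => f (t, x)) ('D_(1, 0) f (t, x)).
Proof.
move=> Cf; have := @Cc_infty_is_derive (R * (R * R * R))%type f (1, 0) (t, x) Cf.
move=> /is_derive_line0 H; apply/is_derive_line0.
have E (h : R) : h *: ((1, 0) : R * (R * R * R)) + (t, x) =
  (h *: 1 + t, x) by congr pair; rewrite /= scaler0 add0r.
by under eq_fun do rewrite -E.
Qed.

Lemma test_space_C1 (f : R * R * R -> R) : Cc_infty f -> C1 f (fun i => 'D_(unit_vec i) f).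
Proof.
move=> Cf; split=> [i x|i]; first exact: Cc_infty_is_derive.
exact: Cc_infty_continuous (Cc_infty_derive _ Cf).
Qed.

End support.

(** * Integration by parts over cubes *)

Section parts.
Context {R : realType}.
Local Notation space := (R * R * R)%type.

Lemma vanish_le (n N : R) (k : space -> R) : vanish n k -> n <= N -> vanish N k.
Proof. by move=> H nN x i Nx; apply: (H x i); exact: le_trans Nx. Qed.

(** The margin 1 makes f vanish in a whole neighbourhood of the point, hence also its derivative. *)
Lemma vanish_derive (n : R) (f : space -> R) df i : C1 f df -> vanish n f ->
  vanish (n + 1) (df i).
Proof.
move=> [d _] f0 x j nx; apply: (is_derive_unique (d i x)).
have nf : \forall y \near x, 0 = f y.
  have c : {for x, continuous (fun y => `|coord j y|)}.
    by apply: continuous_norm; exact: coord_continuous.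
  have nx1 : n < `|coord j x| by lra.
  by apply: filterS (@cvgr_gt _ _ _ _ _ _ c _ nx1) => y /ltW /f0 ->.
exact: (near_eq_is_derive nf (der_cst x (unit_vec i) (0 : R))).
Qed.

(** The left-hand side is the derivative at h = 0 of the integral of f translated by h along the
    i-th axis. That integral is constant for |h| < 1, since the support stays in the box. *)
Lemma box_divergence (n N : R) (f : space -> R) df i : C1 f df -> vanish n f -> n + 1 <= N ->
  box N (df i) = 0.
Proof.
move=> Cf f0 nN; have cf := C1_continuous Cf; have [d cd] := Cf.
have D : is_derive (0 : R) 1 (fun h => box N (fun x => f (h *: unit_vec i + x)))
    (box N (fun x => df i (0 *: unit_vec i + x))).
  apply: (cfunctional_is_derive (box_cfunctional N)
    (k := fun h x => f (h *: unit_vec i + x)) (k' := fun h x => df i (h *: unit_vec i + x))).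
  - by move=> t x; exact: ((is_derive_line f x (unit_vec i) t _).1 (d i _)).
  - by move=> t; cont.
  - by have := cd i => ?; cont.
have E : (fun x => df i (0 *: unit_vec i + x)) = df i.
  by apply/funext => x; rewrite scale0r add0r.
rewrite E in D; apply: (is_derive_unique D).
have nf : \forall h \near (0 : R), box N f = box N (fun x => f (h *: unit_vec i + x)).
  have : \forall h \near (0 : R), `|h| < 1.
    apply: (@cvgr_lt _ _ _ _ (fun h : R => `|h|) `|0 : R| (cvg_norm cvg_id)).
    by rewrite normr0.
  apply: filterS => h h1.
  under [in RHS]eq_fun do rewrite addrC.
  rewrite (box_translate cf f0)// => j; rewrite coordZ coord_unit_vec normrM.
  apply: (@le_trans _ _ `|h|); last by lra.
  by rewrite ler_piMr//; case: eqP => _; rewrite ?normr1 ?normr0.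
exact: (near_eq_is_derive nf (der_cst (0 : R) 1 (box N f))).
Qed.

Lemma box_by_parts (n N : R) (f g : space -> R) df dg i : C1 f df -> C1 g dg ->
  vanish n f -> n + 1 <= N ->
  box N (fun x => f x * dg i x) = - box N (fun x => df i x * g x).
Proof.
move=> Cf Cg f0 nN; have cf := C1_continuous Cf; have cg := C1_continuous Cg.
have cdf := Cf.2 i; have cdg := Cg.2 i.
have v : vanish n (fun x => f x * g x) by move=> x j H; rewrite (f0 x j)// mul0r.
have := box_divergence i (C1_mul Cf Cg) v nN.
rewrite (cfunctional_add (box_cfunctional N)); [|by cont..].
by move=> /eqP; rewrite addr_eq0 => /eqP ->; rewrite opprK.
Qed.

Lemma C1_weak_partial (n : R) (f : space -> R) df i : C1 f df -> vanish n f -> 0 <= n ->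
  weak_partial i f (df i).
Proof.
move=> Cf f0 n0 psi Cpsi; have Cp := test_space_C1 Cpsi.
have cf := C1_continuous Cf; have cp := C1_continuous Cp.
have cdf := Cf.2 i; have cdp := Cp.2 i.
have n1 : 0 <= n + 1 by rewrite addr_ge0.
rewrite (@Rintegral_vanish _ _ (n + 1))//; last 2 first.
- by cont.
- by move=> x j H; rewrite (f0 x j) ?mul0r//; lra.
rewrite (@Rintegral_vanish _ _ (n + 1))//; last 2 first.
- by cont.
- by move=> x j H; rewrite (vanish_derive i Cf f0 H) mul0r.
exact: (box_by_parts i Cf Cp f0).
Qed.

End parts.

(** * Continuity and differentiability in L^2 *)

Section energy_space.
Context {R : realType}.
Local Notation space := (R * R * R)%type.

(** The bound is 2 + t and not 1 + t because [vanish] demands zeros on the boundary of the cube,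
    while the closed ball of radius 1 + t may carry nonzero values. *)
Definition conical (U : R * space -> R) : Prop :=
  forall t : R, vanish (2 + Num.max t 0) (slice U t).

Lemma conical_near (U : R * space -> R) (t : R) : conical U ->
  \forall s \near t, vanish (3 + `|t|) (slice U s).
Proof.
move=> cU; have tt : t < `|t| + 1 by have := ler_norm t; lra.
have : \forall s \near t, s < `|t| + 1.
  by apply: (@cvgr_lt _ _ _ _ (fun x : R => x) t cvg_id).
apply: filterS => s st.
apply: vanish_le (cU s) _; have := normr_ge0 t.
by case: (lerP s 0); lra.
Qed.

(** Near t all supports lie in one cube, so the L^2 norm is the square root of a fixed [box], which
    is continuous in the parameter. *)
Lemma Lnorm_slice_cvg0 (Q : R * space -> R) (t N : R) : continuous Q -> 0 <= N ->
  (forall x, Q (t, x) = 0) -> (\forall s \near t, vanish N (slice Q s)) ->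
  Lnorm leb3 2%:E (EFin \o slice Q s) @[s --> t] --> 0%E.
Proof.
move=> cQ N0 Q0 QN; have cs s : continuous (slice Q s) by rewrite /slice; cont.
have E : \forall s \near t, (Num.sqrt (box N (fun x => Q (s, x) ^+ 2)))%:E =
    Lnorm leb3 2%:E (EFin \o slice Q s).
  by apply: filterS QN => s Qs; rewrite (Lnorm_vanish (cs s) Qs N0).
apply: cvg_trans (near_eq_cvg E) _; apply: cvg_EFin; first by near=> s.
have c : continuous (fun s => Num.sqrt (box N (fun x => Q (s, x) ^+ 2))).
  apply: continuous_sqrt_comp.
  by apply: (cfunctional_continuous (box_cfunctional N) (k := fun z => Q (z.1, z.2) ^+ 2)); cont.
have -> : 0 = Num.sqrt (box N (fun x => Q (t, x) ^+ 2)).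
  under eq_fun do rewrite Q0 expr0n.
  by rewrite (cfunctional0 (box_cfunctional N)) sqrtr0.
exact: c.
Unshelve. all: by end_near. Qed.

Lemma conical_C_L2 (U : R * space -> R) : continuous U -> conical U ->
  C_L2 (fun t x => U (t, x)).
Proof.
move=> cU kU; have cs t : continuous (slice U t) by rewrite /slice; cont.
have max0 (t : R) : 0 <= Num.max t 0 by rewrite le_max lexx orbT.
have m0 (t : R) : 0 <= 2 + Num.max t 0 by exact: addr_ge0 (ler0n _ 2) (max0 t).
split=> [t t0|t t0]; first exact: L2_vanish (cs t) (kU t) (m0 t).
have cQ : continuous (fun z : R * space => U z - U (t, z.2)) by cont.
have N0 : 0 <= 3 + `|t| by rewrite addr_ge0.
have vt := nbhs_singleton (conical_near t kU).
have := Lnorm_slice_cvg0 cQ N0 (fun x => subrr _) _.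
move=> H; apply: cvg_trans (H _) => //; last first.
  apply: filterS (conical_near t kU) => s vs x i H'.
  by rewrite /slice /= [U (s, x)](vs x i H') [U (t, x)](vt x i H') subrr.
by apply: cvg_app; exact: cvg_within.
Qed.

Lemma conical_time_derivative (U V : R * space -> R) : continuous U -> continuous V ->
  conical V -> (forall s t x, 0 <= s -> 0 <= t ->
    U (s, x) - U (t, x) = oint t s (fun r => V (r, x))) ->
  L2_time_derivative (fun t x => U (t, x)) (fun t x => V (t, x)).
Proof.
move=> cU cV kV UV t t0.
(* For s different from t this is the difference quotient minus V(t). As an average of V over the
   segment from t to s it is continuous also at s = t, where it vanishes. *)
pose Q (z : R * space) := int01 (fun h => V (t + (z.1 - t) * h, z.2)) - V (t, z.2).
have cQ : continuous Q.
  apply: continuous_add; last by apply: continuous_opp; cont.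
  apply: (cfunctional_continuous (@int01_cfunctional R)
    (k := fun z => V (t + (z.1.1 - t) * z.2, z.1.2))).
  by cont.
have int0 (k : R -> R) : (forall h, 0 <= h <= 1 -> k h = 0) -> int01 k = 0.
  move=> k0; have := @oint_eq0 _ k 0 1; rewrite /oint subr0 mul1r.
  under eq_fun do rewrite mul1r add0r.
  by apply=> h h01; rewrite mul1r add0r; exact: k0.
have Q0 x : Q (t, x) = 0.
  rewrite /Q /= subrr; under eq_fun do rewrite mul0r addr0.
  by have := oint_cst 0 1 (V (t, x)); rewrite /oint subr0 mul1r mulr1 => ->; rewrite subrr.
have N0 : 0 <= 3 + t by rewrite addr_ge0.
have QN : \forall s \near t, vanish (3 + t) (slice Q s).
  have tt : t < t + 1 by rewrite ltrDl.
  have : \forall s \near t, s < t + 1.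
    by apply: (@cvgr_lt _ _ _ _ (fun x : R => x) t cvg_id).
  apply: filterS => s st x i nx.
  have V0 (r : R) : r <= t + 1 -> V (r, x) = 0.
    move=> rt; apply: (kV r x i); apply: le_trans nx.
    by case: (lerP r 0); lra.
  rewrite /slice /Q V0 ?lerDl// subr0; apply: int0 => h /andP[h0 h1]; apply: V0.
  have [ts|/ltW ts] := leP t s.
    have : (s - t) * h <= (s - t) * 1 by rewrite ler_wpM2l// subr_ge0.
    by rewrite /=; lra.
  have : (s - t) * h <= 0 by rewrite mulr_le0_ge0// subr_le0.
  by rewrite /=; lra.
have H := Lnorm_slice_cvg0 cQ N0 Q0 QN.
have E : \forall s \near (within [set s | 0 <= s] t^'),
    Lnorm leb3 2%:E (EFin \o slice Q s) =
    L2_dist (fun x => (U (s, x) - U (t, x)) / (s - t)) (fun x => V (t, x)).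
  rewrite near_withinE near_withinE; near=> s => st s0; rewrite /L2_dist.
  congr Lnorm; apply/funext => x /=; rewrite UV// /oint mulrAC divff ?subr_eq0//.
  by rewrite mul1r.
apply: cvg_trans (near_eq_cvg E) _; apply: cvg_trans _ H.
by apply: cvg_app; apply: cvg_trans (cvg_within _) _; exact: cvg_within.
Unshelve. all: by end_near. Qed.

Lemma continuous_Lp_loc (p : R) (U : R * space -> R) : 3 / 2 < p -> continuous U ->
  Lp_loc p (fun t x => U (t, x)).
Proof.
move=> p1 cU; have mU := spacetime_measurable cU.
have cU' : continuous (fun z : R * space => `|U z| `^ p).
  exact: (continuous_compose (abs_powR_continuous p1) cU).
split=> [|T r].
  by apply: measurable_funTS; apply: eq_measurable_fun mU => -[].
have c1 : continuous (fun z : R * space => z.1) by cont.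
have c2 : continuous (fun z : R * space => enorm z.2).
  by have := @enorm_continuous R => ?; cont.
set D := [set z : mspacetime R | _].
have mD : measurable D.
  have -> : D = (fun z : mspacetime R => z.1) @^-1` `[0, T]%classic `&`
      (fun z : mspacetime R => enorm z.2) @^-1` `]-oo, r]%classic.
    apply/seteqP; split=> z; rewrite /D /= !in_itv /=; first by move=> /andP[].
    by move=> [-> ->].
  apply: measurableI; rewrite -[X in measurable X]setTI.
    by apply: (spacetime_measurable c1) => //; exact: measurable_itv.
  by apply: (spacetime_measurable c2) => //; exact: measurable_itv.
have DK : D `<=` `[0, T]%classic `*` cube `|r|.
  move=> z /= /andP[zT zr]; split; first by rewrite /= in_itv.
  have H i : - `|r| <= coord i z.2 <= `|r|.
    rewrite -ler_norml; apply: le_trans (le_trans zr (ler_norm r)).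
    rewrite -(@ler_pXn2r _ 2)// ?nnegrE ?enorm_ge0// real_normK ?num_real// enorm_sqr sqnE.
    by move: i; apply: ord3P; rewrite ?lerDl ?lerDr ?addr_ge0 ?sqr_ge0// -?addrA ?lerDl ?lerDr ?addr_ge0 ?sqr_ge0//; have := sqr_ge0 (coord i0 z.2); have := sqr_ge0 (coord i2 z.2); lra.
  by split; [split|]; rewrite /= in_itv /=; [exact: (H i0)|exact: (H i1)|exact: (H i2)].
have [M HM] : exists M, forall z, D z -> `| `|U z| `^ p| <= M.
  have cK : compact (`[0, T]%classic `*` cube `|r| : set (R * space)).
    by apply: compact_setX; [exact: segment_compact|exact: compact_cube].
  have /compact_bounded[M [_ HM]] := continuous_compact (continuous_subspaceT cU') cK.
  by exists (M + 1) => z /DK Kz; apply: (HM (M + 1)); [lra|exists z].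
have Dfin : (leb4 D < +oo)%E.
  apply: (@le_lt_trans _ _ (leb4 (`[0, T]%classic `*` cube `|r|))).
    by apply: le_measure => //; rewrite inE//; apply: measurableX; [exact: measurable_itv|exact: measurable_cube].
  have -> : leb4 (`[0%R, T]%classic `*` cube `|r|) =
      (@lebesgue_measure R `[0%R, T]%classic * leb3 (cube `|r|))%E.
    by apply: product_measure2E; [exact: measurable_itv|exact: measurable_cube].
  rewrite cube_measure//= lebesgue_measure_itv /= lte_fin.
  by case: ifPn => _; rewrite ?mul0e ?ltry// -EFinB -EFinM ltry.
have I : leb4.-integrable D (EFin \o (fun z => `|U z| `^ p)).
  apply: measurable_bounded_integrable => //.
    exact: measurable_funTS (spacetime_measurable cU').
  by exists M; split; [exact: num_real|move=> y My z Dz; exact: le_trans (HM z Dz) (ltW My)].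
have E : (fun z : mspacetime R => (`|U (z.1, z.2)| `^ p)%:E) = EFin \o (fun z => `|U z| `^ p).
  by apply/funext => -[].
by have := integrable_lty mD I; rewrite -E.
Qed.

End energy_space.

(** * From w = (1 + t) u back to u *)

Section energy_solution.
Context {R : realType}.
Local Notation space := (R * R * R)%type.
Local Notation st := (R * space)%type.

Definition cone_supported (F : st -> R) : Prop :=
  forall s y, 0 <= s -> 1 + s < enorm y -> F (s, y) = 0.

Lemma coord_le_enorm (x : space) i : `|coord i x| <= enorm x.
Proof.
rewrite -(@ler_pXn2r _ 2)// ?nnegrE ?enorm_ge0// real_normK ?num_real// enorm_sqr sqnE.
have := sqr_ge0 (coord i0 x); have := sqr_ge0 (coord i1 x); have := sqr_ge0 (coord i2 x).
by move: i; apply: ord3P; lra.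
Qed.

Let max0 (t : R) : 0 <= Num.max t 0. Proof. by rewrite le_max lexx orbT. Qed.
Let max_id (t : R) : 0 <= t -> Num.max t 0 = t. Proof. by move=> t0; apply/max_idPl. Qed.

Lemma cone_supported_conical (F U : st -> R) : cone_supported F ->
  (forall z, F (pos z) = 0 -> U z = 0) -> conical U.
Proof.
move=> F0 FU t x i nx; apply: FU; apply: F0; first exact: max0.
by have := le_trans nx (coord_le_enorm x i); rewrite /=; lra.
Qed.

Variable p : R.
Hypothesis p1 : 3 / 2 < p.
Variables (W Wt H : st -> R) (Wi : 'I_3 -> st -> R).
Hypotheses (cW : continuous W) (cWt : continuous Wt) (cH : continuous H).
Hypothesis cWi : forall i, continuous (Wi i).
Hypothesis dW : forall (t : R) x, is_derive t 1 (fun t => W (t, x)) (Wt (t, x)).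
Hypothesis dWi : forall t i x, is_derive x (unit_vec i) (slice W t) (Wi i (t, x)).
Hypotheses (kW : cone_supported W) (kWt : cone_supported Wt).
Hypothesis kWi : forall i, cone_supported (Wi i).
Hypothesis HW : forall t x, 0 <= t -> H (t, x) = (1 + t) `^ (1 - p) * `|W (t, x)| `^ p.
(** The equation W_tt - Lap W = H tested against functions of x alone; the dependence of test
    functions on time is brought in later by [is_derive_diagonal]. *)
Hypothesis weak : forall psi dpsi ddpsi (n N t : R), C1 psi dpsi ->
  (forall i, C1 (dpsi i) (ddpsi i)) -> vanish n psi -> n + 2 <= N ->
  is_derive t 1 (fun t => box N (fun x => Wt (t, x) * psi x))
    (box N (fun x => H (t, x) * psi x - \sum_(i < 3) Wi i (t, x) * dpsi i x)).

Let inv (z : st) : R := (1 + Num.max z.1 0)^-1.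
Definition undamped (z : st) : R := W (pos z) * inv z.
Let U := undamped.
Let Ut (z : st) : R := Wt (pos z) * inv z - W (pos z) * inv z ^+ 2.
Let G (i : 'I_3) (z : st) : R := Wi i (pos z) * inv z.

Let cinv : continuous inv.
Proof. by apply: continuous_inv => [|z]; [cont|rewrite lt0r_neq0// ltr_pwDl]. Qed.

Let cU : continuous U.
Proof. by have cp := @pos_continuous R; rewrite /U /undamped; cont. Qed.

Let cUt : continuous Ut.
Proof. by have cp := @pos_continuous R; rewrite /Ut; cont. Qed.

Let cG i : continuous (G i).
Proof. by have cp := @pos_continuous R; have ci := @cWi i; rewrite /G; cont. Qed.

Let kU : conical U.
Proof. by apply: (cone_supported_conical kW) => z; rewrite /U /undamped => ->; rewrite mul0r. Qed.

Let kUt : conical Ut.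
Proof.
have k : cone_supported (fun z => `|W z| + `|Wt z|).
  by move=> s y s0 sy; rewrite kW// kWt// normr0 addr0.
apply: (cone_supported_conical k) => z /eqP.
rewrite paddr_eq0// !normr_eq0 /Ut => /andP[/eqP -> /eqP ->].
by rewrite !mul0r subrr.
Qed.

Let kG i : conical (G i).
Proof. by apply: (cone_supported_conical (kWi i)) => z; rewrite /G => ->; rewrite mul0r. Qed.

Let UE t x : 0 <= t -> U (t, x) = W (t, x) * (1 + t)^-1.
Proof. by move=> t0; rewrite /U /undamped /pos /inv /= max_id. Qed.

Let UtE t x : 0 <= t -> Ut (t, x) = Wt (t, x) * (1 + t)^-1 - W (t, x) * (1 + t)^-1 ^+ 2.
Proof. by move=> t0; rewrite /Ut /pos /inv /= max_id. Qed.

Let GE i t x : 0 <= t -> G i (t, x) = Wi i (t, x) * (1 + t)^-1.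
Proof. by move=> t0; rewrite /G /pos /inv /= max_id. Qed.

Let dinv (t : R) : 0 <= t -> is_derive t 1 (fun t : R => (1 + t)^-1) (- (1 + t)^-1 ^+ 2).
Proof.
move=> t0; have nz : 1 + t != 0 by rewrite lt0r_neq0// ltr_pwDl.
have d1 : is_derive t 1 (fun t : R => 1 + t) 1 by der; rewrite add0r.
by apply: (der_eq (@der_inv R _ (fun t : R => 1 + t) t 1 1 nz d1)); rewrite exprVn mulr1.
Qed.

Let U_C1 t : C1 (slice U t) (fun i => slice (G i) t).
Proof.
split=> [i x|i].
  have := dWi (Num.max t 0) i x; rewrite /slice => d1.
  rewrite /U /undamped /G /pos /=.
  apply: (der_eq (@der_mul R _ (fun x => W (Num.max t 0, x)) (fun _ => inv (t, x)) _ _ _ _ d1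
    (der_cst _ _ _))).
  by rewrite mulr0 addr0.
by have ci := @cG i; rewrite /slice; cont.
Qed.

Let U_increment s t x : 0 <= s -> 0 <= t -> U (s, x) - U (t, x) = oint t s (fun r => Ut (r, x)).
Proof.
have c : continuous (fun r => Ut (r, x)) by cont.
have le a b : 0 <= a -> a <= b -> U (b, x) - U (a, x) = oint a b (fun r => Ut (r, x)).
  move=> a0 ab; rewrite (oint_Rintegral c ab).
  rewrite (UE x a0) (UE x (le_trans a0 ab)); apply/esym.
  apply: (@FTC2_segment _ (fun r => Ut (r, x)) (fun r => W (r, x) * (1 + r)^-1)) => // r /andP[ar _].
  have r0 := le_trans a0 ar; rewrite (UtE x r0).
  have d1 := dW r x; have d2 := dinv r0.
  by der; ring.
move=> s0 t0; have [ts|/ltW st] := leP t s; first exact: le.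
have := oint_chasles t s t c; rewrite oint_point -(le s t s0 st) => /eqP.
by rewrite addr_eq0 opprB => /eqP ->.
Qed.

Lemma box_time_continuous (N : R) (k : st -> R) : continuous k ->
  continuous (fun t => box N (fun x => k (t, x))).
Proof. exact: (cfunctional_continuous (box_cfunctional N)). Qed.

Let damped_derive (P Q : R -> R) (s a b : R) : 0 <= s ->
  is_derive s 1 P a -> is_derive s 1 Q b ->
  is_derive s 1 (fun s : R => (1 + s)^-1 * P s - (1 + s)^-1 ^+ 2 * Q s)
    ((1 + s)^-1 * a - (1 + s)^-1 ^+ 2 * P s - (1 + s)^-1 ^+ 2 * b + 2 * (1 + s)^-1 ^+ 3 * Q s).
Proof.
by move=> s0 d2 d3; have d1 := dinv s0; der; move: (1 + s)^-1 => c; ring.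
Qed.

Let three_step (a b c d e g h : R) : a - b = g -> g = h - e -> h = c - d ->
  a - b + d + e = c.
Proof. by move=> -> -> ->; ring. Qed.

(** The pointwise identity behind the change of unknown, with c = (1 + s)^-1, h the source, f and q
    the test function and its time derivative, w and v standing for W and its time derivative, and e
    the product of the gradients. The damping term accounts for the powers c^2 and c^3 created by
    differentiating c. *)
Let damped_balance (c h f q w v e : R) :
  c * h * f - (- ((v * c - w * c ^+ 2) * q) + c * e) - 2 * c * (v * c - w * c ^+ 2) * f =
  c * (h * f - e) + c * (v * q) + -2 * c ^+ 2 * (v * f) + 2 * c ^+ 3 * (w * f) +
  - c ^+ 2 * (w * q).
Proof. by ring. Qed.

(** The pairing of u_t with the test function is c P - c^2 Q, where c = (1 + s)^-1 and P, Q pair W_t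
    and W with it. Its derivative in s is found from the weak equation for W and integrated over
    [0, t]; [damped_balance] recognises the other terms of the damped equation. The initial velocity
    W_t - W is the derivative of W/(1 + t) at 0. *)
Lemma energy_solution : global_energy_solution p
  (fun x => W (0, x)) (fun x => Wt (0, x) - W (0, x)) (fun t x => undamped (t, x)).
Proof.
exists (fun t x => Ut (t, x)), (fun i t x => G i (t, x)); split.
- split; [exact: conical_C_L2|by move=> i; exact: conical_C_L2|].
  move=> i t t0.
  exact: (C1_weak_partial i (U_C1 t) (@kU t) (addr_ge0 (ler0n R 2) (max0 t))).
- split; [exact: conical_C_L2|exact: conical_C_L2|].
  by apply: conical_time_derivative => // s t x s0 t0; exact: U_increment.
- exact: continuous_Lp_loc.
- split; apply: aeW => x; first by rewrite -/(U _) UE// addr0 invr1 mulr1.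
  by rewrite UtE// addr0 invr1 expr1n !mulr1.
move=> phi Cphi t t0.
have [n n0 vn] := test_slice_vanish Cphi.
pose Pt := 'D_(1, 0) phi; pose Pi i := 'D_(0, unit_vec i) phi.
have CPt : Cc_infty Pt by exact: Cc_infty_derive.
have CPi i : Cc_infty (Pi i) by exact: Cc_infty_derive.
have [m m0 vm] := test_slice_vanish CPt.
have cphi := Cc_infty_continuous Cphi; have cPt := Cc_infty_continuous CPt.
have cPi i : continuous (Pi i) by exact: Cc_infty_continuous (CPi i).
(* One box for the test function, for its time derivative, supported within m, and for its space
   derivatives; the additional 2 is the margin asked by [weak]. *)
pose N : R := n + m + 2.
have N0 : 0 <= N by rewrite !addr_ge0.
have nN : n + 2 <= N by rewrite /N; lra.
have vphi s x i : N <= `|coord i x| -> phi (s, x) = 0.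
  by move=> H'; apply: (vn s x i); apply: le_trans H'; rewrite /N; lra.
have vPt s x i : N <= `|coord i x| -> Pt (s, x) = 0.
  by move=> H'; apply: (vm s x i); apply: le_trans H'; rewrite /N; lra.
have vPi j s x i : N <= `|coord i x| -> Pi j (s, x) = 0.
  move=> H'; apply: (vanish_derive j (test_slice_C1 s Cphi) (vn s) (x := x) (i := i)).
  by apply: le_trans H'; rewrite /N; lra.
pose B (k : st -> R) (s : R) := box N (fun x => k (s, x)).
have cB k : continuous k -> continuous (B k) by exact: box_time_continuous.
have IB (k : st -> R) s : continuous k -> (forall x i, N <= `|coord i x| -> k (s, x) = 0) ->
    \int[leb3]_x k (s, x) = B k s.
  move=> ck k0; apply: Rintegral_vanish => //.
  by apply: (@continuous_compose _ _ _ k (fun x : space => (s, x)) ck); cont.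
have cp := @pos_continuous R; have cUp := continuous_compose (abs_powR_continuous p1) cU.
pose k1 (z : st) := Ut z * phi z.
pose k2 (z : st) := - (Ut z * Pt z) + \sum_(i < 3) G i z * Pi i z.
pose k3 (z : st) := 2 * inv z * Ut z * phi z.
pose k4 (z : st) := `|U z| `^ p * phi z.
have ck1 : continuous k1 by rewrite /k1; cont.
have ck2 : continuous k2.
  apply: continuous_add; first by cont.
  by apply: continuous_sum => i; have c1 := @cG i; have c2 := @cPi i; cont.
have ck3 : continuous k3 by rewrite /k3; cont.
have ck4 : continuous k4 by rewrite /k4; cont.
have E1 s : \int[leb3]_x (Ut (s, x) * phi (s, x)) = B k1 s.
  by apply: (IB k1) => // x i Nx; rewrite /k1 (vphi _ _ _ Nx) mulr0.
have E2 s : \int[leb3]_x (- (Ut (s, x) * Pt (s, x)) + \sum_(i < 3) G i (s, x) * Pi i (s, x)) = B k2 s.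
  apply: (IB k2) => // x i Nx; rewrite /k2 (vPt _ _ _ Nx) mulr0 oppr0 add0r.
  by apply: big1 => j _; rewrite (vPi j _ _ _ Nx) mulr0.
have E3 s : 0 <= s -> \int[leb3]_x (2 / (1 + s) * Ut (s, x) * phi (s, x)) = B k3 s.
  move=> s0; have -> : (fun x => 2 / (1 + s) * Ut (s, x) * phi (s, x)) = (fun x => k3 (s, x)).
    by apply/funext => x; rewrite /k3 /inv /= max_id.
  by apply: (IB k3) => // x i Nx; rewrite /k3 (vphi _ _ _ Nx) mulr0.
have E4 s : \int[leb3]_x (`|U (s, x)| `^ p * phi (s, x)) = B k4 s.
  by apply: (IB k4) => // x i Nx; rewrite /k4 (vphi _ _ _ Nx) mulr0.
have EI (k : st -> R) (h : R -> R) : continuous k -> (forall s, 0 <= s -> h s = B k s) ->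
    \int[lebesgue_measure]_(s in `[0, t]) h s = oint 0 t (B k).
  move=> ck hk; rewrite (oint_Rintegral (cB _ ck) t0); apply: eq_Rintegral => s.
  by rewrite inE /= in_itv /= => /andP[s0 _]; exact: hk.
rewrite !E1 (EI _ _ ck2 (fun s _ => E2 s)) (EI _ _ ck3 E3) (EI _ _ ck4 (fun s _ => E4 s)).
pose f1 (z : st) := H z * phi z - \sum_(i < 3) Wi i z * Pi i z.
have cf1 : continuous f1.
  apply: continuous_add; first by cont.
  apply: continuous_opp; apply: continuous_sum => i.
  by have c1 := @cWi i; have c2 := @cPi i; cont.
pose P (s : R) := box N (fun x => Wt (s, x) * phi (s, x)).
pose Q (s : R) := box N (fun x => W (s, x) * phi (s, x)).
(* The time of W_t and that of the test function are separated: at frozen test function [weak]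
   applies, and at frozen W_t one differentiates under the integral. *)
have dP (s : R) : is_derive s 1 P (box N (fun x => f1 (s, x)) + box N (fun x => Wt (s, x) * Pt (s, x))).
  have q1 (a b : R) : is_derive a 1 (fun a => box N (fun x => Wt (a, x) * phi (b, x)))
    (box N (fun x => H (a, x) * phi (b, x) - \sum_(i < 3) Wi i (a, x) * Pi i (b, x))).
    exact: (weak a (test_slice_C1 b Cphi) (fun i => test_slice_C1 b (CPi i)) (@vn b) nN).
  have q2 (a b : R) : is_derive b 1 (fun b => box N (fun x => Wt (a, x) * phi (b, x)))
    (box N (fun x => Wt (a, x) * Pt (b, x))).
    apply: (cfunctional_is_derive (box_cfunctional N)
      (k := fun b x => Wt (a, x) * phi (b, x)) (k' := fun b x => Wt (a, x) * Pt (b, x))).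
    + by move=> s' x; have d := test_time_derive s' x Cphi; der; rewrite mul0r add0r.
    + by move=> s'; cont.
    + by cont.
  apply: (is_derive_diagonal s q1 q2).
  - apply: (cfunctional_continuous (box_cfunctional N) (k := fun z : (R * R) * space =>
      H (z.1.1, z.2) * phi (z.1.2, z.2) - \sum_(i < 3) Wi i (z.1.1, z.2) * Pi i (z.1.2, z.2))).
    apply: continuous_add; first by cont.
    apply: continuous_opp; apply: continuous_sum => i.
    by have c1 := @cWi i; have c2 := @cPi i; cont.
  - by apply: (cfunctional_continuous (box_cfunctional N) (k := fun z : (R * R) * space =>
      Wt (z.1.1, z.2) * Pt (z.1.2, z.2))); cont.
have dQ (s : R) : is_derive s 1 Q (box N (fun x => Wt (s, x) * phi (s, x) + W (s, x) * Pt (s, x))).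
  apply: (cfunctional_is_derive (box_cfunctional N)
    (k := fun s x => W (s, x) * phi (s, x))
    (k' := fun s x => Wt (s, x) * phi (s, x) + W (s, x) * Pt (s, x))).
  + by move=> s' x; have d := test_time_derive s' x Cphi; have d' := dW s' x; der.
  + by move=> s'; cont.
  + by cont.
have lin (a b c d e : R) (g1 g2 g3 g4 g5 : space -> R) : continuous g1 -> continuous g2 ->
    continuous g3 -> continuous g4 -> continuous g5 ->
    box N (fun x => a * g1 x + b * g2 x + c * g3 x + d * g4 x + e * g5 x) =
    a * box N g1 + b * box N g2 + c * box N g3 + d * box N g4 + e * box N g5.
  move=> h1 h2 h3 h4 h5; have L := box_cfunctional N.
  by rewrite !(cfunctional_add L) ?(cfunctional_scale L) //; cont.
have slc (k : st -> R) s : continuous k -> continuous (fun x => k (s, x)).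
  by move=> ck; apply: (@continuous_compose _ _ _ k (fun x => (s, x)) ck); cont.
have EK s : 0 <= s -> B k1 s = (1 + s)^-1 * P s - (1 + s)^-1 ^+ 2 * Q s.
  move=> s0; have L := box_cfunctional N.
  have s1 := slc _ s cphi; have s3 := slc _ s cW; have s4 := slc _ s cWt.
  rewrite /B /P /Q -!(cfunctional_scale L); [|by cont..].
  rewrite -(cfunctional_sub L); [|by cont..].
  by congr box; apply/funext => x; rewrite /k1 UtE//; ring.
have dK (s : R) : 0 <= s <= t -> is_derive s 1
    (fun s : R => (1 + s)^-1 * P s - (1 + s)^-1 ^+ 2 * Q s) (B (fun z => k4 z - k2 z - k3 z) s).
  move=> /andP[s0 _]; have d2 := dP s; have d3 := dQ s; set c := (1 + s)^-1.
  have c0 : 0 <= c by rewrite invr_ge0 addr_ge0.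
  have s1 := slc _ s cphi; have s2 := slc _ s cPt; have s3 := slc _ s cW.
  have s4 := slc _ s cWt; have s5 := slc _ s cf1.
  have E : B (fun z => k4 z - k2 z - k3 z) s =
    c * box N (fun x => f1 (s, x)) + c * box N (fun x => Wt (s, x) * Pt (s, x)) +
    (- 2 * c ^+ 2) * box N (fun x => Wt (s, x) * phi (s, x)) +
    (2 * c ^+ 3) * box N (fun x => W (s, x) * phi (s, x)) +
    (- c ^+ 2) * box N (fun x => W (s, x) * Pt (s, x)).
    rewrite -lin; [|by cont..].
    congr box; apply/funext => x; rewrite /k4 /k2 /k3 /f1 UE// UtE// -/c.
    have -> : inv (s, x) = c by rewrite /inv /= max_id.
    (* Here (1 + s)^(-p) = (1 + s)^-1 (1 + s)^(1-p), which is why the undamped source carries the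
       power 1 - p. *)
    have -> : `|W (s, x) * c| `^ p = c * H (s, x).
      rewrite HW// normrM (ger0_norm c0) powRM// mulrA [LHS]mulrC; congr (_ * _).
      have s01 : 0 < 1 + s by rewrite ltr_pwDl.
      rewrite /c -[(1 + s)^-1]powR_inv1 ?(ltW s01)// -powRrM -powRD; last by rewrite (gt_eqF s01) implybT.
      by congr (_ `^ _); ring.
    have -> : \sum_(i < 3) G i (s, x) * Pi i (s, x) = c * \sum_(i < 3) Wi i (s, x) * Pi i (s, x).
      by rewrite mulr_sumr; apply: eq_bigr => i _; rewrite GE// mulrAC mulrC.
    exact: damped_balance.
  apply: (der_eq (damped_derive s0 d2 d3)); rewrite E -/c.
  rewrite (cfunctional_add (box_cfunctional N) (k := fun x => Wt (s, x) * phi (s, x))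
    (l := fun x => W (s, x) * Pt (s, x))); [|by cont..].
  rewrite /P /Q; move: (box _ _) (box _ _) (box _ _) (box _ _) (box _ _) => b1 b2 b3 b4 b5.
  by move: (c) => c'; ring.
have L := oint_cfunctional 0 t.
have c42 : continuous (fun z => k4 z - k2 z) by cont.
have c423 : continuous (fun z => k4 z - k2 z - k3 z) by cont.
have FK : B k1 t - B k1 0 = oint 0 t (B (fun z => k4 z - k2 z - k3 z)).
  rewrite (oint_Rintegral (cB _ c423) t0) (FTC2_segment t0 (cB _ c423) dK).
  by rewrite EK// EK// addr0.
have OB (k l : st -> R) : continuous k -> continuous l ->
    oint 0 t (B (fun z => k z - l z)) = oint 0 t (B k) - oint 0 t (B l).
  move=> ck cl; rewrite -(cfunctional_sub L (cB _ ck) (cB _ cl)); congr oint.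
  apply/funext => s.
  exact: (cfunctional_sub (box_cfunctional N) (slc _ s ck) (slc _ s cl)).
exact: (three_step FK (OB (fun z => k4 z - k2 z) k3 c42 ck3) (OB k4 k2 ck4 ck2)).
Qed.

End energy_solution.

(** * Weak form of the inhomogeneous wave equation *)

Section inhomogeneous_wave.
Context {R : realType}.
Local Notation space := (R * R * R)%type.
Local Notation st := (R * space)%type.

Lemma cone_supported_derive (F : st -> R) dF i : regular F dF -> cone_supported F ->
  cone_supported (dF i).
Proof.
move=> [_ _ dFE] F0 s y s0 sy; apply: (is_derive_unique (dFE s i y)).
have nf : \forall x \near y, 0 = slice F s x.
  have c : {for y, continuous (enorm : space -> R)} by exact: enorm_continuous.
  by apply: filterS (@cvgr_gt _ _ _ _ _ _ c _ sy) => x xs; rewrite /slice F0.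
exact: (near_eq_is_derive nf (der_cst y (unit_vec i) (0 : R))).
Qed.

Lemma duh'_outside (F : st -> R) dF : (forall i, cone_supported (dF i)) ->
  cone_supported F -> cone_supported (fun z => duh' F dF z.1 z.2).
Proof.
move=> dF0 F0 t x t0 xt /=; apply: oint_eq0 => s /andP[s0 s1].
rewrite add0r subr0; set u := t * s.
have u0 : 0 <= u by exact: mulr_ge0.
have ut : u <= t by rewrite /u ler_piMr.
have ray w : sqn w = 1 -> 1 + u < enorm (x + (t - u) *: w).
  move=> w1; have tu : 0 <= t - u by lra.
  by have := enorm_ray_ge x w1 tu; have := ler_norm (enorm x - (t - u)); lra.
rewrite /kir' (@sph_eq _ _ (fun _ => 0)) => [|w w1]; last by apply: F0 => //; exact: ray.
rewrite sph_cst add0r (@sph_eq _ _ (fun _ => 0)) ?sph_cst ?mulr0// => w w1.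
by apply: big1 => i _; rewrite /slice dF0 ?mul0r//; exact: ray.
Qed.

Variables (a at' att G H F : st -> R) (da : 'I_3 -> st -> R) (dda : 'I_3 -> 'I_3 -> st -> R).
Variables (dF : 'I_3 -> st -> R) (eps : R).
Hypotheses (ra : regular a da) (rda : forall i, regular (da i) (dda i)) (rF : regular F dF).
Hypotheses (cat' : continuous at') (catt : continuous att).
Hypotheses (cG : continuous G) (cH : continuous H).
Hypothesis d_a : forall (t : R) x, is_derive t 1 (fun t => a (t, x)) (at' (t, x)).
Hypothesis d_at : forall (t : R) x, is_derive t 1 (fun t => at' (t, x)) (att (t, x)).
Hypothesis FE : forall z, F z = eps * G z + H z.
Hypothesis wave_defect : forall z, att z + G z = \sum_(i < 3) dda i i z.

(** By [wave_defect] the wave operator sends eps a to - eps G, and formally it sends [duh F] to F =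
    eps G + H. The explicit part cancels and only the source H remains. *)
Definition field (z : st) : R := eps * a z + duh F z.1 z.2.
Definition field_t (z : st) : R := eps * at' z + duh' F dF z.1 z.2.
Definition field_x (i : 'I_3) (z : st) : R := eps * da i z + duh (dF i) z.1 z.2.

Lemma field_continuous : continuous field.
Proof.
have [ca _ _] := ra; have [cF _ _] := rF; have cd := duh_continuous cF.
by rewrite /field; cont.
Qed.

Lemma field_t_continuous : continuous field_t.
Proof. by have cd := duh'_continuous rF; rewrite /field_t; cont. Qed.

Lemma field_x_continuous i : continuous (field_x i).
Proof.
have [_ cda _] := ra; have [_ cdF _] := rF; have cd := duh_continuous (cdF i).
by have ci := cda i; rewrite /field_x; cont.
Qed.

Lemma field_time (t : R) x : is_derive t 1 (fun t => field (t, x)) (field_t (t, x)).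
Proof.
have d1 := d_a t x; have d2 := duh_time t x rF.
by rewrite /field /field_t /=; der; ring.
Qed.

Lemma field_space t i x : is_derive x (unit_vec i) (slice field t) (field_x i (t, x)).
Proof.
have [_ _ daE] := ra; have d1 := daE t i x; have d2 := duh_space t i x rF.
by rewrite /slice in d1; rewrite /slice /field /field_x /=; der; ring.
Qed.

(** [duh'_weak] puts both space derivatives on psi, and one of them is moved back to the C^1
    function [duh F]. For the explicit part one derivative is moved to psi instead. The margin 2
    covers the supports of the second derivatives of psi. *)
Lemma field_weak psi dpsi ddpsi (n N t : R) : C1 psi dpsi ->
  (forall i, C1 (dpsi i) (ddpsi i)) -> vanish n psi -> n + 2 <= N ->
  is_derive t 1 (fun t => box N (fun x => field_t (t, x) * psi x))
    (box N (fun x => H (t, x) * psi x - \sum_(i < 3) field_x i (t, x) * dpsi i x)).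
Proof.
move=> Cpsi Cdpsi vpsi nN; have L := box_cfunctional N.
have cpsi := C1_continuous Cpsi; have cdpsi := Cpsi.2.
have cddpsi i j : continuous (ddpsi i j) by exact: (Cdpsi i).2.
have [ca cda _] := ra; have [cF cdF _] := rF.
have cdda i j : continuous (dda i j) by case: (rda i).
have cduh := duh_continuous cF; have cduh' := duh'_continuous rF.
have cduhi i := duh_continuous (cdF i).
have slc (k : st -> R) s : continuous k -> continuous (fun x => k (s, x)).
  by move=> ck; apply: (@continuous_compose _ _ _ k (fun x => (s, x)) ck); cont.
have vdd i : vanish (n + 2) (ddpsi i i).
  have := vanish_derive i (Cdpsi i) (vanish_derive i Cpsi vpsi).
  by rewrite -addrA; have -> : 1 + 1 = 2 :> R by ring.
have vlap : vanish (n + 2) (fun x => \sum_(i < 3) ddpsi i i x).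
  by move=> x j H'; apply: big1 => i _; exact: (vdd i x j).
have vpsi2 : vanish (n + 2) psi by apply: vanish_le vpsi _; lra.
have D1 := duh'_weak rF Cpsi Cdpsi nN vpsi2 vlap t.
have D2 : is_derive t 1 (fun t => box N (fun x => at' (t, x) * psi x))
    (box N (fun x => att (t, x) * psi x)).
  apply: (cfunctional_is_derive L (k := fun t x => at' (t, x) * psi x)
    (k' := fun t x => att (t, x) * psi x)).
  - by move=> s x; have d := d_at s x; der; rewrite mulr0 addr0.
  - by move=> s; have c := slc _ s cat'; cont.
  - by cont.
have E (s : R) : box N (fun x => field_t (s, x) * psi x) =
    eps * box N (fun x => at' (s, x) * psi x) + box N (fun x => duh' F dF s x * psi x).
  have c1 := slc _ s cat'; have c2 := slc _ s cduh'.
  have c3 : continuous (fun x => at' (s, x) * psi x) by cont.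
  have c4 : continuous (fun x => duh' F dF s x * psi x) by apply: continuous_mul.
  rewrite -(cfunctional_scale L eps c3) -(cfunctional_add L _ c4); last by cont.
  by congr box; apply/funext => x; rewrite /field_t /= mulrDl mulrA.
under eq_fun do rewrite E.
have D3 : is_derive t 1 (fun s => eps * box N (fun x => at' (s, x) * psi x) +
    box N (fun x => duh' F dF s x * psi x)) (eps * box N (fun x => att (t, x) * psi x) +
    (box N (fun x => F (t, x) * psi x) + box N (fun x => duh F t x * \sum_(i < 3) ddpsi i i x))).
  apply: (der_eq (der_add (der_mul (der_cst t 1 eps) D2) D1)).
  by rewrite mul0r add0r.
apply: (der_eq D3).
have parts (u : space -> R) du i : C1 u du ->
    box N (fun x => u x * ddpsi i i x) = - box N (fun x => du i x * dpsi i x).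
  move=> Cu; have := box_by_parts i (Cdpsi i) Cu (vanish_derive i Cpsi vpsi) (N := N).
  have -> : n + 1 + 1 = n + 2 by ring.
  move=> /(_ nN) E'.
  rewrite (_ : (fun x => du i x * dpsi i x) = (fun x => dpsi i x * du i x)); last first.
    by apply/funext => x; rewrite mulrC.
  by rewrite E' opprK; congr box; apply/funext => x; rewrite mulrC.
have parts' (u : space -> R) du i : C1 u du ->
    box N (fun x => du i x * psi x) = - box N (fun x => u x * dpsi i x).
  move=> Cu; have nN1 : n + 1 <= N by lra.
  have := box_by_parts i Cpsi Cu vpsi nN1.
  rewrite (_ : (fun x => psi x * du i x) = (fun x => du i x * psi x)); last first.
    by apply/funext => x; rewrite mulrC.
  by move=> ->; congr (- box _ _); apply/funext => x; rewrite mulrC.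
have lin3 (u v w : space -> R) : continuous u -> continuous v -> continuous w ->
    box N (fun x => u x + v x + w x) = box N u + box N v + box N w.
  by move=> cu cv cw; rewrite !(cfunctional_add L)//; cont.
have c1 := slc _ t cG; have c2 := slc _ t cH; have c3 := slc _ t catt.
have cduht : continuous (fun x => duh F t x) by exact: (slc _ t cduh).
have cduhit i : continuous (fun x => duh (dF i) t x) by exact: (slc _ t (cduhi i)).
have cdat i : continuous (fun x => da i (t, x)) by exact: (slc _ t (cda i)).
have cddat i : continuous (fun x => dda i i (t, x)) by exact: (slc _ t (cdda i i)).
have p1 := continuous_mul c1 cpsi; have p2 := continuous_mul c2 cpsi.
have p3 := continuous_mul c3 cpsi.
have neg3 (x y z x' y' z' : R) : x = - x' -> y = - y' -> z = - z' ->
    x + y + z = - (x' + y' + z') by move=> -> -> ->; rewrite !opprD.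
have EF : box N (fun x => F (t, x) * psi x) =
    eps * box N (fun x => G (t, x) * psi x) + box N (fun x => H (t, x) * psi x).
  rewrite -(cfunctional_scale L eps p1) -(cfunctional_add L _ p2); last by cont.
  by congr box; apply/funext => x; rewrite FE mulrDl mulrA.
have EG : box N (fun x => att (t, x) * psi x) + box N (fun x => G (t, x) * psi x) =
    - (box N (fun x => da i0 (t, x) * dpsi i0 x) + box N (fun x => da i1 (t, x) * dpsi i1 x) +
       box N (fun x => da i2 (t, x) * dpsi i2 x)).
  apply: etrans (esym (cfunctional_add L p3 p1)) _.
  have -> : (fun x => att (t, x) * psi x + G (t, x) * psi x) =
    (fun x => dda i0 i0 (t, x) * psi x + dda i1 i1 (t, x) * psi x + dda i2 i2 (t, x) * psi x).
    by apply/funext => x; rewrite -mulrDl wave_defect sum3 !mulrDl.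
  rewrite lin3; [|by apply: continuous_mul; [exact: cddat|exact: cpsi]..].
  have P i := parts' (slice (da i) t) (fun j => slice (dda i j) t) i (regular_C1 t (rda i)).
  by rewrite /slice in P; exact: neg3 (P i0) (P i1) (P i2).
have ED : box N (fun x => duh F t x * \sum_(i < 3) ddpsi i i x) =
    - (box N (fun x => duh (dF i0) t x * dpsi i0 x) + box N (fun x => duh (dF i1) t x * dpsi i1 x) +
       box N (fun x => duh (dF i2) t x * dpsi i2 x)).
  have -> : (fun x => duh F t x * \sum_(i < 3) ddpsi i i x) =
    (fun x => duh F t x * ddpsi i0 i0 x + duh F t x * ddpsi i1 i1 x + duh F t x * ddpsi i2 i2 x).
    by apply/funext => x; rewrite sum3 !mulrDr.
  rewrite lin3; [|by apply: continuous_mul; [exact: cduht|exact: cddpsi]..].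
  have Cduh : C1 (duh F t) (fun i => duh (dF i) t).
    by split=> [i x|i]; [exact: duh_space|exact: cduhit].
  exact: neg3 (parts _ _ i0 Cduh) (parts _ _ i1 Cduh) (parts _ _ i2 Cduh).
have EX i : box N (fun x => field_x i (t, x) * dpsi i x) =
    eps * box N (fun x => da i (t, x) * dpsi i x) + box N (fun x => duh (dF i) t x * dpsi i x).
  have q1 := cdat i; have q2 := cduhit i; have q3 := cdpsi i.
  have r1 := continuous_mul q1 q3; have r2 := continuous_mul q2 q3.
  rewrite -(cfunctional_scale L eps r1) -(cfunctional_add L _ r2); last by cont.
  by congr box; apply/funext => x; rewrite /field_x /= mulrDl mulrA.
have cX i : continuous (fun x => field_x i (t, x) * dpsi i x).
  have q1 := slc _ t (@field_x_continuous i); have q3 := cdpsi i; by cont.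
have -> : box N (fun x => H (t, x) * psi x - \sum_(i < 3) field_x i (t, x) * dpsi i x) =
    box N (fun x => H (t, x) * psi x) - (box N (fun x => field_x i0 (t, x) * dpsi i0 x) +
    box N (fun x => field_x i1 (t, x) * dpsi i1 x) + box N (fun x => field_x i2 (t, x) * dpsi i2 x)).
  rewrite -lin3; [|exact: cX..].
  rewrite -(cfunctional_sub L p2); last first.
    exact: continuous_add (continuous_add (cX i0) (cX i1)) (cX i2).
  by congr box; apply/funext => x; rewrite sum3.
rewrite !EX EF ED.
have collect (e b1 b2 b3 s1 s2 s3 r1 r2 r3 : R) : b1 + b2 = - (s1 + s2 + s3) ->
    e * b1 + (e * b2 + b3 + - (r1 + r2 + r3)) = b3 - (e * s1 + r1 + (e * s2 + r2) + (e * s3 + r3)).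
  move=> Eb; have -> : b1 = - (s1 + s2 + s3) - b2 by rewrite -Eb addrK.
  by ring.
exact: collect EG.
Qed.

End inhomogeneous_wave.

(** * The initial data and the choice of constants *)

Section initial_data.
Context {R : realType}.
Local Notation space := (R * R * R)%type.
Local Notation st := (R * space)%type.

Definition unit_ball_test (f : space -> R) : Prop :=
  Cc_infty f /\ supp f `<=` [set x | enorm x <= 1].

Lemma unit_ball_test_derive (f : space -> R) v : unit_ball_test f -> unit_ball_test ('D_v f).
Proof.
move=> [Cf sf]; split; first exact: Cc_infty_derive.
exact: subset_trans (@supp_derive _ _ f v) sf.
Qed.

Lemma unit_ball_test_bound (f : space -> R) : unit_ball_test f ->
  exists2 M : R, 0 <= M & forall x, `|f x| <= M /\ (1 < enorm x -> f x = 0).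
Proof.
move=> [Cf sf]; have cf := Cc_infty_continuous Cf.
have /compact_bounded[M [_ HM]] := continuous_compact (continuous_subspaceT cf) Cf.2.
exists (`|M| + 1); first exact: addr_ge0.
move=> x; split.
  have [Sx|/notin_supp ->] := pselect (supp f x); last by rewrite normr0 addr_ge0.
  by apply: (HM (`|M| + 1)); [have := ler_norm M; lra|exists x].
by move=> x1; apply: notin_supp => /sf /=; lra.
Qed.

(* The data are propagated by these explicit functions, whose exponential decay
   in time makes every contribution of the data a small source. *)
Definition decaying (c0 c1 : R) (f : space -> R) (z : st) : R :=
  (c0 + c1 * z.1) * expR (- z.1) * f z.2.

Lemma decaying_continuous c0 c1 f : continuous f -> continuous (decaying c0 c1 f).
Proof. by move=> cf; rewrite /decaying; cont. Qed.

Lemma decaying_regular c0 c1 f : unit_ball_test f ->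
  regular (decaying c0 c1 f) (fun i => decaying c0 c1 ('D_(unit_vec i) f)).
Proof.
move=> tf; split.
- exact: decaying_continuous (Cc_infty_continuous tf.1).
- by move=> i; apply: decaying_continuous; exact: Cc_infty_continuous (Cc_infty_derive _ tf.1).
- move=> t i x; rewrite /slice /decaying /=.
  have d := Cc_infty_is_derive (unit_vec i) x tf.1.
  apply: (der_eq (der_mul (der_cst x (unit_vec i) ((c0 + c1 * t) * expR (- t))) d)).
  by rewrite mul0r add0r.
Qed.

Lemma decaying_time c0 c1 f (t : R) x :
  is_derive t 1 (fun t => decaying c0 c1 f (t, x)) (decaying (c1 - c0) (- c1) f (t, x)).
Proof. by rewrite /decaying /=; der; move: (expR _) (f x) => e y; ring. Qed.

(** Sixteenth power of 1 + t <= 16 exp(t/16). The exponent is 15 + 1: 15 for the decay of the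
    weights and 1 for the linear factor of [decaying]. *)
Lemma expR_ge_power16 (t : R) : 0 <= t -> (1 + t) ^+ 16 <= 16 ^+ 16 * expR t.
Proof.
move=> t0; have t16 : 0 <= t / 16 by rewrite divr_ge0.
have -> : expR t = expR (t / 16) ^+ 16.
  by rewrite -expRM_natl; congr expR; rewrite -[16%:R]/(16 : R); field.
rewrite -exprMn; apply: lerXn2r; rewrite ?nnegrE ?addr_ge0 ?mulr_ge0 ?expR_ge0//.
by have := expR_ge1Dx (t / 16); lra.
Qed.

Variable p : R.
Hypotheses (p1 : 3 / 2 < p) (p3 : p < 3).

(** With b = 4 (1 + t), which bounds all the bases involved, the weights are at least b^-(1+q) and
    b^-(p-1+p(1+q)). For p < 3 these exponents are below 4 and 14 in absolute value, so b^-15 lies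
    under both weights. *)
Lemma exponential_below_weights (t : R) (x : space) : 0 <= t -> enorm x <= 1 ->
  (1 + t) * expR (- t) <= 4 ^+ 15 * 16 ^+ 16 * weight p t x /\
  (1 + t) * expR (- t) <= 4 ^+ 15 * 16 ^+ 16 * source_weight p t x.
Proof.
move=> t0 x1; pose b : R := 4 * (1 + t); have p1' := p1; have p3' := p3.
have b1 : 1 <= b by rewrite /b; lra.
have b0 : 0 < b by lra.
have xt : enorm x <= 1 + t by lra.
have base := cone_base t0 xt.
have q0 : 0 <= qexp p by rewrite /qexp; lra.
have q3 : qexp p <= 3 by rewrite /qexp; lra.
have key (y : R) : b `^ (- 15) <= y -> (1 + t) * expR (- t) <= 4 ^+ 15 * 16 ^+ 16 * y.
  have -> : b `^ (- 15) = (b ^+ 15)^-1 by rewrite powRN powR_mulrn// ltW.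
  move=> by15; have P : 0 <= 4 ^+ 15 * 16 ^+ 16 :> R by rewrite mulr_ge0 ?exprn_ge0.
  apply: le_trans (ler_wpM2l P by15).
  rewrite ler_pdivlMr ?exprn_gt0// expRN mulrAC ler_pdivrMr ?expR_gt0//.
  have -> : (1 + t) * b ^+ 15 = 4 ^+ 15 * (1 + t) ^+ 16.
    by rewrite /b exprMn mulrCA -exprS.
  rewrite -[leRHS]mulrA; apply: ler_wpM2l; first exact: exprn_ge0.
  exact: expR_ge_power16.
have w1 : b `^ (- (1 + qexp p)) <= weight p t x.
  rewrite /weight xt opprD powRD; last by rewrite (gt_eqF b0) implybT.
  apply: ler_pM; rewrite ?powR_ge0//.
    rewrite powR_inv1 ?(ltW b0)// lef_pV2 ?posrE//; last by lra.
    by rewrite /b; lra.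
  apply: le_powRN_base => //; first lra.
  by rewrite /b; have := japx_gt0 x; lra.
split; apply: key.
  by apply: le_trans w1; apply: ler_powR => //; lra.
have w2 : b `^ (1 - p) * (b `^ (- (1 + qexp p))) `^ p <= source_weight p t x.
  apply: ler_pM; rewrite ?powR_ge0//.
    have -> : 1 - p = - (p - 1) by ring.
    by apply: le_powRN_base; [lra|rewrite /b; lra|lra].
  by apply: le_powR_base; rewrite ?powR_ge0//; lra.
apply: le_trans w2; rewrite -powRrM -powRD; last by rewrite (gt_eqF b0) implybT.
by apply: ler_powR => //; rewrite /qexp; nra.
Qed.

(** Both bounds are asked at once because the same explicit functions occur as parts of the
    solution, measured by [wt], and as sources, measured by [swt]. *)
Definition tame (F : st -> R) : Prop :=
  exists2 C : R, 0 <= C & forall z, 0 <= z.1 ->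
    `|F z| <= C * wt p z /\ `|F z| <= C * swt p z.

Let max_id (t : R) : 0 <= t -> Num.max t 0 = t. Proof. by move=> t0; apply/max_idPl. Qed.

Lemma wt_at (z : st) : 0 <= z.1 -> wt p z = weight p z.1 z.2.
Proof. by move=> z0; rewrite /wt max_id. Qed.

Lemma swt_at (z : st) : 0 <= z.1 -> swt p z = source_weight p z.1 z.2.
Proof. by move=> z0; rewrite /swt max_id. Qed.

Lemma decaying_tame c0 c1 f : unit_ball_test f -> tame (decaying c0 c1 f).
Proof.
move=> /unit_ball_test_bound[M M0 HM]; set K : R := 4 ^+ 15 * 16 ^+ 16.
have K0 : 0 <= K by rewrite mulr_ge0 ?exprn_ge0.
have c0' : 0 <= `|c0| + `|c1| by rewrite addr_ge0.
exists ((`|c0| + `|c1|) * M * K); first by rewrite !mulr_ge0.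
move=> [t x] /= t0; rewrite wt_at// swt_at//=; have [fM f0] := HM x.
have [x1|x1] := leP (enorm x) 1; last first.
  rewrite /decaying /= f0// mulr0 normr0.
  have P := mulr_ge0 (mulr_ge0 c0' M0) K0.
  by split; apply: (mulr_ge0 P); [exact: weight_ge0|exact: source_weight_ge0].
have B : `|decaying c0 c1 f (t, x)| <= (`|c0| + `|c1|) * M * ((1 + t) * expR (- t)).
  rewrite /decaying /= !normrM (ger0_norm (expR_ge0 _)).
  have -> : (`|c0| + `|c1|) * M * ((1 + t) * expR (- t)) =
    (`|c0| + `|c1|) * (1 + t) * expR (- t) * M by ring.
  apply: (ler_pM (mulr_ge0 (normr_ge0 _) (expR_ge0 _)) (normr_ge0 _) _ fM).
  rewrite ler_wpM2r ?expR_ge0//; apply: le_trans (ler_normD _ _) _.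
  rewrite normrM (ger0_norm t0) mulrDl !mulrDr !mulr1.
  have := mulr_ge0 (normr_ge0 c0) t0; have := normr_ge0 c1; lra.
have [H1 H2] := exponential_below_weights t0 x1.
have P : 0 <= (`|c0| + `|c1|) * M by rewrite mulr_ge0.
by split; apply: le_trans B _; rewrite -[leRHS]mulrA; apply: ler_wpM2l.
Qed.

Lemma tame_add F G : tame F -> tame G -> tame (fun z => F z + G z).
Proof.
move=> [C C0 HC] [D D0 HD]; exists (C + D); first exact: addr_ge0.
move=> z z0; have [h1 h2] := HC z z0; have [h3 h4] := HD z z0.
by split; apply: le_trans (ler_normD _ _) _; rewrite mulrDl; exact: lerD.
Qed.

Lemma tame_family (F : 'I_3 -> st -> R) G : tame G -> (forall i, tame (F i)) ->
  exists2 C : R, 0 <= C & forall z, 0 <= z.1 ->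
    (`|G z| <= C * wt p z /\ `|G z| <= C * swt p z) /\
    forall i, `|F i z| <= C * wt p z /\ `|F i z| <= C * swt p z.
Proof.
move=> [C C0 HC] HF; have [D0 D00 H0] := HF i0; have [D1 D10 H1] := HF i1.
have [D2 D20 H2] := HF i2; exists (C + D0 + D1 + D2); first by rewrite !addr_ge0.
move=> z z0; have w0 : 0 <= wt p z by exact: wt_ge0.
have s0 : 0 <= swt p z by exact: source_weight_ge0.
have le (D y w : R) : 0 <= w -> y <= D * w -> D <= C + D0 + D1 + D2 ->
    y <= (C + D0 + D1 + D2) * w.
  by move=> w0' h1 h2; apply: le_trans h1 _; rewrite ler_wpM2r.
split.
  by have [h1 h2] := HC z z0; split; [apply: (le C)|apply: (le C)] => //; lra.
apply: ord3P.
- by have [h1 h2] := H0 z z0; split; [apply: (le D0)|apply: (le D0)] => //; lra.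
- by have [h1 h2] := H1 z z0; split; [apply: (le D1)|apply: (le D1)] => //; lra.
- by have [h1 h2] := H2 z z0; split; [apply: (le D2)|apply: (le D2)] => //; lra.
Qed.

Lemma wt_outside t x : 0 <= t -> 1 + t < enorm x -> wt p (t, x) = 0.
Proof. by move=> t0 tx; rewrite wt_at//= /weight leNgt tx. Qed.

Lemma tame_cone_supported F : tame F -> cone_supported F.
Proof.
move=> [C _ H] t x t0 tx; have [+ _] := H (t, x) t0.
by rewrite wt_outside// mulr0 normr_le0 => /eqP.
Qed.

Lemma regular_add F G dF dG : regular F dF -> regular G dG ->
  regular (fun z : st => F z + G z) (fun i z => dF i z + dG i z).
Proof.
move=> [cF cdF dFE] [cG cdG dGE]; split.
- exact: continuous_add.
- by move=> i; exact: continuous_add.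
- by move=> t i x; exact: der_add (dFE t i x) (dGE t i x).
Qed.

Hypothesis pk : 1 < p * (2 * p - 3).
Variables f g : space -> R.
Hypotheses (tf : unit_ball_test f) (tg : unit_ball_test g).

Let D (i : 'I_3) (h : space -> R) : space -> R := 'D_(unit_vec i) h.
Let tD i h : unit_ball_test h -> unit_ball_test (D i h).
Proof. exact: unit_ball_test_derive. Qed.

(* The value of (1 + t) u at 0 is f and its time derivative f + g, whence the
   coefficients (1 + 2 t) and t. *)
Let profile (h k : space -> R) (z : st) : R := decaying 1 2 h z + decaying 0 1 k z.
(** The coefficients are left unevaluated so that [decaying_time] applies as it stands. *)
Let profile_t (z : st) : R := decaying (2 - 1) (- 2) f z + decaying (1 - 0) (- 1) g z.
Let profile_tt (z : st) : R :=
  decaying (- 2 - (2 - 1)) (- - 2) f z + decaying (- 1 - (1 - 0)) (- - 1) g z.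
(** The second time derivatives of (1 + 2t) e^-t and t e^-t are (2t - 3) e^-t and (t - 2) e^-t. The
    data are arguments, so that space derivatives only replace h and k. *)
Let minus_tt (h k : space -> R) (z : st) : R := decaying 3 (- 2) h z + decaying 2 (- 1) k z.
Let defect (h k : space -> R) (z : st) : R :=
  profile (D i0 (D i0 h)) (D i0 (D i0 k)) z + profile (D i1 (D i1 h)) (D i1 (D i1 k)) z +
  profile (D i2 (D i2 h)) (D i2 (D i2 k)) z + minus_tt h k z.
Let G := defect f g.
Let dG (j : 'I_3) (z : st) : R :=
  profile (D j (D i0 (D i0 f))) (D j (D i0 (D i0 g))) z +
  profile (D j (D i1 (D i1 f))) (D j (D i1 (D i1 g))) z +
  profile (D j (D i2 (D i2 f))) (D j (D i2 (D i2 g))) z + minus_tt (D j f) (D j g) z.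

Let profile_regular h k : unit_ball_test h -> unit_ball_test k ->
  regular (profile h k) (fun i => profile (D i h) (D i k)).
Proof. by move=> th tk; apply: regular_add; exact: decaying_regular. Qed.

Let profile_tame h k : unit_ball_test h -> unit_ball_test k -> tame (profile h k).
Proof. by move=> th tk; apply: tame_add; exact: decaying_tame. Qed.

Let G_regular : regular G dG.
Proof.
rewrite /G /defect; apply: (regular_add (regular_add (regular_add _ _) _) _).
- by apply: profile_regular; do 2 apply: tD.
- by apply: profile_regular; do 2 apply: tD.
- by apply: profile_regular; do 2 apply: tD.
- by apply: regular_add; exact: decaying_regular.
Qed.

Let G_tame : tame G.
Proof.
apply: (tame_add (tame_add (tame_add _ _) _) _).
- by apply: profile_tame; do 2 apply: tD.
- by apply: profile_tame; do 2 apply: tD.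
- by apply: profile_tame; do 2 apply: tD.
- by apply: tame_add; exact: decaying_tame.
Qed.

Let dG_tame j : tame (dG j).
Proof.
apply: (tame_add (tame_add (tame_add _ _) _) _).
- by apply: profile_tame; do 3 apply: tD.
- by apply: profile_tame; do 3 apply: tD.
- by apply: profile_tame; do 3 apply: tD.
- by apply: tame_add; apply: decaying_tame; exact: tD.
Qed.

(** The radius A of the iteration is taken proportional to eps, A = K eps. Then [small1] holds for
    every eps by the choice of K, and [small2] becomes the smallness condition on eps, since p >
    1. *)
Lemma small_data_solution : exists2 eps0 : R, 0 < eps0 &
  forall eps : R, 0 < eps -> eps <= eps0 -> exists Phi : R -> space -> R,
    global_energy_solution p (fun x => eps * f x) (fun x => eps * g x) Phi.
Proof.
pose a := profile f g; pose da i := profile (D i f) (D i g).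
have ra : regular a da by exact: profile_regular.
have da_tame i : tame (da i) by apply: profile_tame; exact: tD.
have [Ca Ca0 HCa] := tame_family (profile_tame tf tg) da_tame.
have [CG CG0 HCG] := tame_family G_tame dG_tame.
have J0 := john_constant_ge0 p1 pk; set J := john_constant p in J0.
have p0 : 0 < p by have := p1; lra.
have pm0 : 0 < p - 1 by have := p1; lra.
pose K : R := 2 * (Ca + J * CG) + 1.
have K0 : 0 < K by rewrite ltr_wpDl// mulr_ge0// addr_ge0// mulr_ge0.
have Jp0 : 0 <= J * p by rewrite mulr_ge0// ltW.
(* J p m <= 1/8, and d is the radius with d^(p-1) = m; the summand 1 avoids a division by zero. *)
pose m : R := (8 * (J * p + 1))^-1.
have m0 : 0 < m by rewrite invr_gt0 mulr_gt0// ltr_wpDl.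
pose d : R := m `^ (p - 1)^-1.
have d0 : 0 < d by exact: powR_gt0.
exists (d / K); first exact: divr_gt0.
move=> eps eps0 epsd; pose A : R := K * eps.
have A0 : 0 < A by exact: mulr_gt0.
have Ad : A <= d by rewrite /A mulrC -ler_pdivlMr.
have small1 : eps * (Ca + J * CG) <= A / 2.
  have -> : A / 2 = eps * (K / 2) by rewrite /A; ring.
  by rewrite ler_wpM2l ?(ltW eps0)// /K; move: (Ca + J * CG) => y; lra.
have small2 : J * p * A `^ (p - 1) <= 1 / 8.
  have Am : A `^ (p - 1) <= m.
    have -> : m = d `^ (p - 1).
      by rewrite /d -powRrM mulVf ?gt_eqF// powRr1// ltW.
    exact: le_powR_base (ltW A0) Ad (ltW pm0).
  apply: le_trans (ler_wpM2l Jp0 Am) _.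
  rewrite /m ler_pdivrMr; last by rewrite mulr_gt0// ltr_wpDl.
  by move: (J * p) => y; lra.
have [w [v [rw wA wE]]] := fixed_point p1 pk ra G_regular CG0
  (fun z z0 => (HCa z z0).1.1) (fun i z z0 => ((HCa z z0).2 i).1)
  (fun z z0 => (HCG z z0).1.2) (fun i z z0 => ((HCG z z0).2 i).2) (ltW eps0) A0 small1 small2.
pose F := src p G eps w; pose dF := dsrc p dG eps w v.
have rF : regular F dF by exact: src_regular.
have [cF cdF _] := rF.
pose H (z : st) : R := damp p z * `|w z| `^ p.
have [cw _ _] := rw.
have cH : continuous H.
  have cd := @damp_continuous R p; have cp := continuous_compose (abs_powR_continuous p1) cw.
  by rewrite /H; cont.
(* The fixed point w is frozen for negative times and need not be differentiable in t at 0. W is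
   given by the same formula without truncation: it is differentiable for all t and agrees with w
   for t >= 0, which is all that the source sees at such times. *)
pose W := field a F eps; pose Wt := field_t profile_t F dF eps; pose Wx := field_x da dF eps.
have rda i : regular (da i) (fun j => profile (D j (D i f)) (D j (D i g))).
  by apply: profile_regular; exact: tD.
have Ww t x : 0 <= t -> W (t, x) = w (t, x).
  by move=> t0; rewrite wE /W /field /pos /duhz /= max_id.
have kw : cone_supported w.
  move=> t x t0 tx; have := wA (t, x); rewrite wt_outside// mulr0 normr_le0.
  by move/eqP.
have kF : cone_supported F.
  move=> t x t0 tx; rewrite /F /src (tame_cone_supported G_tame)// kw// normr0 powR0 ?gt_eqF//.
  by rewrite !mulr0 addr0.
have kdF i : cone_supported (dF i) by exact: cone_supported_derive rF kF.
have c_t : continuous profile_t.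
  by apply: continuous_add; apply: decaying_continuous; [exact: Cc_infty_continuous tf.1|exact: Cc_infty_continuous tg.1].
have c_tt : continuous profile_tt.
  by apply: continuous_add; apply: decaying_continuous; [exact: Cc_infty_continuous tf.1|exact: Cc_infty_continuous tg.1].
have d_a (t : R) x : is_derive t 1 (fun t => a (t, x)) (profile_t (t, x)).
  exact: der_add (decaying_time _ _ _ _ _) (decaying_time _ _ _ _ _).
have d_at (t : R) x : is_derive t 1 (fun t => profile_t (t, x)) (profile_tt (t, x)).
  exact: der_add (decaying_time _ _ _ _ _) (decaying_time _ _ _ _ _).
have FE z : F z = eps * G z + H z by [].
have wave_defect z : profile_tt z + G z = \sum_(i < 3) profile (D i (D i f)) (D i (D i g)) z.
  rewrite sum3 /G /defect.
  have -> : minus_tt f g z = - profile_tt z.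
    by rewrite /minus_tt /profile_tt /decaying; move: (expR _) (f _) (g _) => e y y'; ring.
  by rewrite addrC subrK.
have t_tame : tame profile_t by apply: tame_add; exact: decaying_tame.
exists (fun t x => undamped W (t, x)).
have -> : (fun x => eps * f x) = (fun x => W (0, x)).
  apply/funext => x; rewrite /W /field /duh oint_point addr0 /a /profile /decaying /=.
  by rewrite !mulr0 addr0 oppr0 expR0 !mul1r add0r !mul0r addr0.
have -> : (fun x => eps * g x) = (fun x => Wt (0, x) - W (0, x)).
  apply/funext => x; rewrite /W /Wt /field /field_t /duh /duh' !oint_point !addr0.
  rewrite /a /profile /profile_t /decaying /= oppr0 expR0; move: (f x) (g x) => y y'; ring.
apply: (@energy_solution R p p1 W Wt H Wx).
- exact: (@field_continuous R a F da dF eps ra rF).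
- exact: (@field_t_continuous R profile_t F dF eps rF c_t).
- exact: cH.
- by move=> i; exact: (@field_x_continuous R a F da dF eps ra rF i).
- exact: (field_time eps rF d_a).
- exact: (field_space eps ra rF).
- by move=> t x t0 tx; rewrite Ww// kw.
- move=> t x t0 tx; rewrite /Wt /field_t (tame_cone_supported t_tame)// mulr0 add0r.
  exact: (duh'_outside kdF kF t0 tx).
- move=> i t x t0 tx; rewrite /Wx /field_x (tame_cone_supported (da_tame i))// mulr0 add0r.
  exact: (duh_outside t0 (kdF i) tx).
- by move=> t x t0; rewrite Ww// /H /damp /= max_id.
- have [cG _ _] := G_regular; move=> psi dpsi ddpsi n N t C1psi C2psi psi0 nN.
  exact: (field_weak ra rda rF c_t c_tt cG cH d_at FE wave_defect t C1psi C2psi psi0 nN).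
Qed.

End initial_data.

(** For n = 5 half of the defining equation reads r (2r - 3) = 1, so the positive root exceeds 3/2,
    and p (2p - 3) increases beyond it. *)
Lemma p_c_range (R : realType) (p : R) : p_c 5 < p ->
  3 / 2 < p /\ 1 < p * (2 * p - 3).
Proof.
have [r0 rE] := p_c_root R (isT : (2 <= 5)%N); move=> rp.
move: (p_c 5) r0 rE rp => r r0 rE rp.
have rE' : r * (2 * r - 3) = 1 by lra.
have r3 : 3 / 2 < r by nra.
split; first lra.
by nra.
Qed.

Unset Implicit Arguments.

Theorem mainTheorem3 (R : realType) (p : R) (f g : R * R * R -> R)
  (hp : p_c 5 < p < 3)
  (hf : Cc_infty f) (hg : Cc_infty g)
  (hsf : supp f `<=` [set x | enorm x <= 1])
  (hsg : supp g `<=` [set x | enorm x <= 1]) :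
  exists2 eps0 : R, 0 < eps0 &
    forall eps : R, 0 < eps -> eps <= eps0 ->
      exists Phi : R -> R * R * R -> R,
        global_energy_solution p (fun x => eps * f x) (fun x => eps * g x) Phi.
Proof.
have /andP[hp1 hp3] := hp; have [p1 pk] := p_c_range hp1.
exact: small_data_solution.
Qed.
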